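(* Let $U$ be a convex subset of a separable Hilbert space $H_1$, and assume the operator condition, the Lipschitz condition, the derivative-Lipschitz condition, the semiconcavity condition and the linear-convex condition stated in the context. Then, for every $t\in[0,T]$, the function $V(t,\cdot)$ is convex.
   Context: Fix $T>0$. $(\Omega,\mathcal F,\mathbb P)$ is a probability space with a one-dimensional Brownian motion $w$, and $(\mathcal F_t)_{0\le t\le T}$ is the augmented natural filtration of $w$. $\mathcal V\subset H\subset\mathcal V^*$ is a Gelfand triple of separable Hilbert spaces ($\mathcal V$ densely embedded in $H$); $\langle\cdot,\cdot\rangle$ is the inner product of $H$ and $\langle\cdot,\cdot\rangle_*$ the duality pairing between $\mathcal V^*$ and $\mathcal V$. $\mathfrak L(X;Y)$ denotes bounded linear operators, $\mathfrak L(X)=\mathfrak L(X;X)$. Operator condition. $A:[0,T]\to\mathfrak L(\mathcal V;\mathcal V^* )$, $B:[0,T]\to\mathfrak L(\mathcal V;H)$; for each $\phi\in\mathcal V$, $A(t)\phi,B(t)\phi$ are measurable in $t$, and there are constants $\delta_0>0,K_1\ge0$ such that for all $t$ and $\phi\in\mathcal V$: $2\langle A(t)\phi,\phi\rangle_*+\|B(t)\phi\|_H^2\le-\delta_0\|\phi\|_{\mathcal V}^2+K_1\|\phi\|_H^2$, $\|A(t)\phi\|_{\mathcal V^*}\le K_1\|\phi\|_{\mathcal V}$, $|\langle B(t)\phi,\phi\rangle|\le K_1\|\phi\|_H^2$. Control system. $U$ carries the metric $d$ induced by $H_1$, and $|v|_U:=d(v,0)$ for a fixed element $0\in U$. $\mathcal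 U[t,T]$ is the set of $U$-valued progressively measurable processes $u$ on $[t,T]$ with $\mathbb E\int_t^T|u(s)|_U^\alpha ds<\infty$ for every $\alpha\ge1$. Coefficients: $a,b:[0,T]\times H\times U\to H$, $k:[0,T]\times H\times\mathbb R\times\mathbb R\times U\to\mathbb R$, $h:H\to\mathbb R$. For $(t,x)\in[0,T]\times H$, $u\in\mathcal U[t,T]$, $X=X^{t,x;u}$ solves $dX(s)=[A(s)X(s)+a(s,X(s),u(s))]ds+[B(s)X(s)+b(s,X(s),u(s))]dw(s)$ on $[t,T]$, $X(t)=x$, and $(Y,Z)=(Y^{t,x;u},Z^{t,x;u})$ solves $Y(s)=h(X(T))+\int_s^Tk(r,X(r),Y(r),Z(r),u(r))dr-\int_s^TZ(r)dw(r)$. The value function is $V(t,x):=\operatorname{ess\,inf}_{u\in\mathcal U[t,T]}Y^{t,x;u}(t)$, which is deterministic. Lipschitz condition. $a,b,k,h$ are continuous in $(t,x,y,z,v)$ and there are constants $L_3,L_4,L_5>0$ such that for all $t,v$ and $(x_i,y_i,z_i)$: $\|a(t,x_1,v)-a(t,x_2,v)\|_H+\|b(t,x_1,v)-b(t,x_2,v)\|_H\le L_3\|x_1-x_2\|_H$; $|k(t,x_1,y_1,z_1,v)-k(t,x_2,y_2,z_2,v)|\le L_3(\|x_1-x_2\|_H+|y_1-y_2|+|z_1-z_2|)$; $|h(x_1)-h(x_2)|\le L_3\|x_1-x_2\|_H$; $a,b,h,k$ are bounded by $L_4(1+\|x\|_H+|y|+|z|+|v|_U)$; $a(t,0,v),b(t,0,v),k(t,0,0,0,v)$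 are bounded by $L_5$. Derivative-Lipschitz condition. $a,b$ are Fréchet differentiable in $x$ and there is a constant $C>0$ with $\|a_x(t,x,v)-a_x(t,x',v)\|_{\mathfrak L(H)}+\|b_x(t,x,v)-b_x(t,x',v)\|_{\mathfrak L(H)}\le C\|x-x'\|_H$ for all $t\in[0,T]$, $x,x'\in H$, $v\in U$. Semiconcavity condition. There is $C_1>0$ such that $\lambda k(t,x,y,z,v)+(1-\lambda)k(t,x',y',z',v)-k(t,\lambda x+(1-\lambda)x',\lambda y+(1-\lambda)y',\lambda z+(1-\lambda)z',v)\le C_1\lambda(1-\lambda)\|x-x'\|_H^2$ for all $\lambda\in[0,1]$, $x,x'\in H$, $y,y',z,z'\in\mathbb R$, $t\in[0,T]$, $v\in U$; and there is $C_2>0$ such that $\lambda h(x)+(1-\lambda)h(x')-h(\lambda x+(1-\lambda)x')\le C_2\lambda(1-\lambda)\|x-x'\|_H^2$ for all $\lambda\in[0,1]$, $x,x'\in H$. Linear-convex condition. $a,b$ are (restrictions to $[0,T]\times H\times U$ of) maps $[0,T]\times H\times H_1\to H$ that are linear in $(x,u)\in H\times H_1$; for each $t\in[0,T]$, $k(t,\cdot,\cdot,\cdot,\cdot):H\times\mathbb R\times\mathbb R\times U\to\mathbb R$ is convex, and $h:H\to\mathbb R$ is convex. *)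

(* Defs.v *)
From HB Require Import structures.
From mathcomp Require Import all_boot all_order all_algebra.
From mathcomp Require Import all_classical all_reals all_analysis.

Set Implicit Arguments.
Unset Strict Implicit.
Unset Printing Implicit Defensive.

Import Order.TTheory GRing.Theory Num.Theory.
Import numFieldNormedType.Exports.

Local Open Scope classical_set_scope.
Local Open Scope ring_scope.

HB.mixin Record CompleteNormedModule_isHilbert (R : realType) H
    of CompleteNormedModule R H := {
  inner : H -> H -> R ;
  innerC : forall x y, inner x y = inner y x ;
  inner_linearl : forall c x y z,
    inner (c *: x + y) z = c * inner x z + inner y z ;
  inner_norm : forall x, inner x x = `|x| ^+ 2
}.

#[short(type="hilbertType")]
HB.structure Definition Hilbert (R : realType) :=
  {H of CompleteNormedModule_isHilbert R H & CompleteNormedModule R H}.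

Definition separable (X : topologicalType) :=
  exists D : set X, countable D /\ dense D.

(* The supremum is meaningful for bounded linear [f], the only case used. *)
Definition opnorm (R : realType) (X Y : normedModType R) (f : X -> Y) : R :=
  sup [set `|f x| | x in [set x | `|x| <= 1]].

(* [j] is the inclusion of V in H.  [Vs], through the pairing, is the dual of V
   with the dual norm.  The inclusion of H in [Vs] is left implicit: an h in H
   is the functional v |-> inner h (j v). *)
Record gelfand_triple (R : realType) (V H Vs : hilbertType R)
    (j : {linear V -> H}) (pair : Vs -> {linear V -> R^o}) : Prop := {
  gelfand_separableV : separable V ;
  gelfand_separableH : separable H ;
  gelfand_continuous : continuous j ;
  gelfand_injective : injective j ;
  gelfand_dense : dense (range j) ;
  gelfand_pair_linearl : forall (c : R) (f g : Vs) (v : V),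
    pair (c *: f + g) v = c * pair f v + pair g v ;
  gelfand_pair_continuous : forall f : Vs, continuous (pair f) ;
  gelfand_pair_norm : forall f : Vs, `|f| = opnorm (pair f) ;
  gelfand_pair_surjective : forall g : {linear V -> R^o},
    continuous g -> exists f : Vs, forall v, pair f v = g v
}.

(* Measurability for an explicit sigma-algebra [G], the target carrying its
   Borel sigma-algebra. *)
Definition measurable_wrt (S : Type) (X : topologicalType) (G : set (set S))
    (D : set S) (f : S -> X) :=
  forall B, <<s @open X >> B -> G (D `&` f @^-1` B).

Section stochastic_basis.
Context (R : realType) (d : measure_display) (Om : measurableType d).
Context (P : probability Om R).
Implicit Types (w : R -> Om -> R) (F : R -> set (set Om)) (s t T : R).

Notation mu := (@lebesgue_measure R).

Definition natural_filtration w s : set (set Om) :=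
  <<s [set E | exists r B, [/\ 0 <= r <= s, measurable B &
                               E = w r @^-1` B]] >>.

Definition augmented_filtration w s : set (set Om) :=
  <<s natural_filtration w s `|` [set N | measurable N /\ P N = 0%E] >>.

Record brownian_motion T w : Prop := {
  bm_measurable : forall t, 0 <= t <= T -> measurable_fun setT (w t) ;
  bm_start : {ae P, forall om, w 0 om = 0} ;
  bm_continuous :
    {ae P, forall om, {within `[0, T], continuous (w ^~ om)}} ;
  bm_gaussian : forall s t, 0 <= s -> s < t -> t <= T ->
    forall B, measurable B ->
    P [set om | B (w t om - w s om)] = normal_prob 0 (Num.sqrt (t - s)) B ;
  bm_independent : forall s t, 0 <= s -> s < t -> t <= T ->
    forall E B, natural_filtration w s E -> measurable B ->
    P (E `&` [set om | B (w t om - w s om)]) =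
    (P E * P [set om | B (w t om - w s om)%R])%E
}.

(* The trace on [t, s] x Om of the sigma-algebra below is B([t, s]) (x) F s. *)
Definition progressive (X : topologicalType) F t T (u : R -> Om -> X) :=
  forall s, t <= s <= T ->
    measurable_wrt <<s [set I `*` E | I in measurable & E in F s] >>
      (`[t, s]%classic `*` setT) (fun p : R * Om => u p.1 p.2).

(* A simple process is given by a subdivision p 0 <= ... <= p n of [s, t] and
   the values xi i taken on ]p i, p (i + 1)]. *)
Definition simple_process F s t (n : nat) (p : nat -> R)
    (xi : nat -> Om -> R) :=
  [/\ p 0%N = s, p n = t,
      forall i, (i < n)%N -> p i <= p i.+1,
      forall i, (i < n)%N -> measurable_wrt (F (p i)) setT (xi i) &
      forall i, (i < n)%N -> exists M, forall om, `|xi i om| <= M].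

Definition simple_val (n : nat) (p : nat -> R) (xi : nat -> Om -> R)
    (r : R) (om : Om) : R :=
  \sum_(i < n) xi i om * \1_`]p i, p i.+1]%classic r.

Definition simple_integral w (n : nat) (p : nat -> R) (xi : nat -> Om -> R)
    (om : Om) : R :=
  \sum_(i < n) xi i om * (w (p i.+1) om - w (p i) om).

(* [J] is a version of the Ito integral of [f] with respect to [w] over
   [s, t]: the L^2 limit of integrals of simple processes that approximate [f]
   in L^2([s, t] x Om).  It is determined up to a null set. *)
Definition ito_integral w F s t (f : R -> Om -> R) (J : Om -> R) :=
  [/\ progressive F s t f,
      measurable_fun setT J &
      exists (n : nat -> nat) (p : nat -> nat -> R)
             (xi : nat -> nat -> Om -> R),
      [/\ forall k, simple_process F s t (n k) (p k) (xi k),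
          (fun k => \int[P]_om \int[mu]_(r in `[s, t])
             ((f r om - simple_val (n k) (p k) (xi k) r om) ^+ 2)%:E)%E
            @ \oo --> 0%E &
          (fun k => \int[P]_om
             ((J om - simple_integral w (n k) (p k) (xi k) om) ^+ 2)%:E)%E
            @ \oo --> 0%E]].

Definition square_integrable (X : normedModType R) t T (f : R -> Om -> X) :=
  (\int[P]_om \int[mu]_(r in `[t, T]) (`|f r om| ^+ 2)%:E < +oo)%E.

(* E sup_{t <= s <= T} |f s|^2 < oo, via a square-integrable upper bound since
   the supremum over an interval need not be measurable. *)
Definition square_integrable_sup (X : normedModType R) t T
    (f : R -> Om -> X) :=
  exists M : Om -> R,
    [/\ measurable_fun setT M,
        (\int[P]_om (M om ^+ 2)%:E < +oo)%E &
        {ae P, forall om, forall s, t <= s <= T -> `|f s om| <= M om}].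

(* [g] is the essential infimum of the family [E] of random variables. *)
Definition is_ess_inf (E : set (Om -> R)) (g : Om -> R) :=
  [/\ measurable_fun setT g,
      forall f, E f -> {ae P, forall om, g om <= f om} &
      forall g' : Om -> R, measurable_fun setT g' ->
        (forall f, E f -> {ae P, forall om, g' om <= f om}) ->
        {ae P, forall om, g' om <= g om}].

End stochastic_basis.

Section control_system.
Context (R : realType) (d : measure_display) (Om : measurableType d).
Context (P : probability Om R) (T : R) (w : R -> Om -> R).
Context (V H Vs H1 : hilbertType R).
Context (j : {linear V -> H}) (pair : Vs -> {linear V -> R^o}).
Context (A : R -> {linear V -> Vs}) (B : R -> {linear V -> H}).
(* [v0] is the distinguished element of U, so that |v|_U = `|v - v0|. *)
Context (U : set H1) (v0 : H1).
Context (a b : R -> H -> H1 -> H) (k : R -> H -> R -> R -> H1 -> R).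
Context (h : H -> R).

Notation mu := (@lebesgue_measure R).
Notation F := (augmented_filtration P w).

Record operator_condition : Prop := {
  oc_A_continuous : forall t, 0 <= t <= T -> continuous (A t) ;
  oc_B_continuous : forall t, 0 <= t <= T -> continuous (B t) ;
  oc_A_measurable : forall phi : V,
    measurable_wrt measurable `[0, T]%classic (fun t => A t phi) ;
  oc_B_measurable : forall phi : V,
    measurable_wrt measurable `[0, T]%classic (fun t => B t phi) ;
  oc_bounds : exists delta0 K1 : R, [/\ 0 < delta0, 0 <= K1 &
    forall t (phi : V), 0 <= t <= T ->
      [/\ 2 * pair (A t phi) phi + `|B t phi| ^+ 2 <=
            - delta0 * `|phi| ^+ 2 + K1 * `|j phi| ^+ 2,
          `|A t phi| <= K1 * `|phi| &
          `|inner (B t phi) (j phi)| <= K1 * `|j phi| ^+ 2]]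
}.

Record lipschitz_condition : Prop := {
  lc_a_continuous : {within [set p : R * H * H1 | 0 <= p.1.1 <= T /\ U p.2],
    continuous (fun p => a p.1.1 p.1.2 p.2)} ;
  lc_b_continuous : {within [set p : R * H * H1 | 0 <= p.1.1 <= T /\ U p.2],
    continuous (fun p => b p.1.1 p.1.2 p.2)} ;
  lc_k_continuous :
    {within [set p : R * H * R * R * H1 | 0 <= p.1.1.1.1 <= T /\ U p.2],
    continuous (fun p => k p.1.1.1.1 p.1.1.1.2 p.1.1.2 p.1.2 p.2)} ;
  lc_h_continuous : continuous h ;
  lc_bounds : exists L3 L4 L5 : R, [/\ [/\ 0 < L3, 0 < L4 & 0 < L5],
    forall x1 x2, `|h x1 - h x2| <= L3 * `|x1 - x2|,
    forall x, `|h x| <= L4 * (1 + `|x|) &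
    forall t v, 0 <= t <= T -> U v ->
    [/\ forall x1 x2, `|a t x1 v - a t x2 v| + `|b t x1 v - b t x2 v| <=
          L3 * `|x1 - x2|,
        forall x1 x2 y1 y2 z1 z2, `|k t x1 y1 z1 v - k t x2 y2 z2 v| <=
          L3 * (`|x1 - x2| + `|y1 - y2| + `|z1 - z2|),
        forall x, `|a t x v| <= L4 * (1 + `|x| + `|v - v0|) /\
                  `|b t x v| <= L4 * (1 + `|x| + `|v - v0|),
        forall x y z,
          `|k t x y z v| <= L4 * (1 + `|x| + `|y| + `|z| + `|v - v0|) &
        [/\ `|a t 0 v| <= L5, `|b t 0 v| <= L5 & `|k t 0 0 0 v| <= L5]]]
}.

Record derivative_lipschitz_condition : Prop := {
  dc_a_differentiable : forall t x v, 0 <= t <= T -> U v ->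
    differentiable (fun y => a t y v) x ;
  dc_b_differentiable : forall t x v, 0 <= t <= T -> U v ->
    differentiable (fun y => b t y v) x ;
  dc_bound : exists2 C : R, 0 < C & forall t x x' v, 0 <= t <= T -> U v ->
    opnorm (fun y => 'd (fun y => a t y v) x y - 'd (fun y => a t y v) x' y) +
    opnorm (fun y => 'd (fun y => b t y v) x y - 'd (fun y => b t y v) x' y) <=
    C * `|x - x'|
}.

Record semiconcavity_condition : Prop := {
  sc_k : exists2 C1 : R, 0 < C1 &
    forall (l : R) x x' y y' z z' t v,
    0 <= l <= 1 -> 0 <= t <= T -> U v ->
    l * k t x y z v + (1 - l) * k t x' y' z' v -
    k t (l *: x + (1 - l) *: x') (l * y + (1 - l) * y')
        (l * z + (1 - l) * z') v <=
    C1 * l * (1 - l) * `|x - x'| ^+ 2 ;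
  sc_h : exists2 C2 : R, 0 < C2 &
    forall (l : R) x x', 0 <= l <= 1 ->
    l * h x + (1 - l) * h x' - h (l *: x + (1 - l) *: x') <=
    C2 * l * (1 - l) * `|x - x'| ^+ 2
}.

Definition linear_coefficient (c : R -> H -> H1 -> H) :=
  exists c' : R -> H -> H1 -> H,
    (forall t, 0 <= t <= T -> linear (fun p : H * H1 => c' t p.1 p.2)) /\
    (forall t x v, 0 <= t <= T -> U v -> c t x v = c' t x v).

Record linear_convex_condition : Prop := {
  lcc_a : linear_coefficient a ;
  lcc_b : linear_coefficient b ;
  lcc_k : forall t, 0 <= t <= T ->
    @convex_function R (H * R^o * R^o * H1)%type [set p | U p.2]
      (fun p => k t p.1.1.1 p.1.1.2 p.1.2 p.2) ;
  lcc_h : @convex_function R H setT h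
}.

(* The class U[t, T]. *)
Definition admissible (t : R) (u : R -> Om -> H1) :=
  [/\ forall s om, t <= s <= T -> U (u s om),
      progressive F t T u &
      forall alpha : R, 1 <= alpha ->
        (\int[P]_om \int[mu]_(s in `[t, T])
           (`|u s om - v0| `^ alpha)%:E < +oo)%E].

(* Variational solution of the state equation: the equation holds in the dual
   of V, hence is tested against each phi in V; [XV] is the V-valued version
   of [X] to which A and B apply. *)
Definition state_equation (t : R) (x : H) (u : R -> Om -> H1)
    (X : R -> Om -> H) :=
  [/\ progressive F t T X,
      {ae P, forall om, {within `[t, T], continuous (X ^~ om)}},
      square_integrable_sup P t T X &
  exists XV : R -> Om -> V,
  [/\ progressive F t T XV,
      square_integrable P t T XV,
      {ae P, forall om, {ae mu, forall s, t <= s <= T ->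
        j (XV s om) = X s om}} &
  forall s (phi : V), t <= s <= T -> exists2 J : Om -> R,
    ito_integral P w F t s
      (fun r om => inner (B r (XV r om) + b r (X r om) (u r om)) (j phi)) J &
    {ae P, forall om,
      inner (X s om) (j phi) = inner x (j phi) +
      \int[mu]_(r in `[t, s]) (pair (A r (XV r om)) phi +
                               inner (a r (X r om) (u r om)) (j phi)) +
      J om}]].

Definition backward_equation (t : R) (u : R -> Om -> H1)
    (X : R -> Om -> H) (Y Z : R -> Om -> R) :=
  [/\ progressive F t T Y /\ progressive F t T Z,
      {ae P, forall om, {within `[t, T], continuous (Y ^~ om)}},
      square_integrable_sup P t T (Y : R -> Om -> R^o),
      square_integrable P t T (Z : R -> Om -> R^o) &
  forall s, t <= s <= T -> exists2 J : Om -> R,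
    ito_integral P w F s T Z J &
    {ae P, forall om,
      Y s om = h (X T om) +
      \int[mu]_(r in `[s, T]) k r (X r om) (Y r om) (Z r om) (u r om) -
      J om}].

(* [val] is the deterministic value function
   val t x = ess inf over u in U[t, T] of Y^{t,x;u}(t). *)
Definition value_function (Y : R -> H -> (R -> Om -> H1) -> R -> Om -> R)
    (val : R -> H -> R) :=
  forall t x, 0 <= t <= T ->
    is_ess_inf P [set Y t x u t | u in admissible t] (cst (val t x)).

End control_system.

(* Main.v *)
(* The value at l x1 + (1 - l) x2 is bounded by the cost of the control
   l u1 + (1 - l) u2, for arbitrary controls u1 and u2.  As the coefficients are
   linear, the corresponding state is the combination of the two states, by
   uniqueness for the linear stochastic evolution equation.  Uniqueness is an
   energy estimate: the Ito product formula for the squares of the coordinates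
   is summed over a basis of V orthonormal for <j u, j v> + ep <u, v>, and then
   ep tends to 0.

   Semiconcavity with equal states makes the generator k concave in (y, z), and
   convexity makes it convex, so it is affine in (y, z); joint convexity on all
   of H x R x R x U then forces the slopes to depend on time only.  Hence the
   defect Y3 - l Y1 - (1 - l) Y2 solves a linear backward equation with
   nonpositive terminal value and nonpositive source.  It is nonpositive by
   comparison, where an integrating factor removes the term in y and the term in
   z is cancelled by Girsanov densities that are piecewise constant in time and
   approximate the required drift.  Taking essential infima over u1 and then
   over u2 gives convexity. *)
Require Import Defs.
From HB Require Import structures.
From mathcomp Require Import all_boot all_order all_algebra.
From mathcomp Require Import all_classical all_reals all_analysis.
From mathcomp Require Import measurable_realfun ring lra.

Set Implicit Arguments.
Unset Strict Implicit.
Unset Printing Implicit Defensive.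

Import Order.TTheory GRing.Theory Num.Theory.
Import numFieldNormedType.Exports.

Local Open Scope classical_set_scope.
Local Open Scope ring_scope.

(** * Square-integrable functions *)

(** Both estimates are carried out in expectation only. For a coordinate ξ of the state with drift α
    and diffusion β, the identity E ξ(s)² = 2 E ∫ α ξ + E ∫ β² follows from the isometry and the
    martingale property, without a pathwise formula. Girsanov enters only as an expectation against
    one weight; the slopes of the generator being deterministic, that weight is a product of
    exponentials of Gaussian increments, and the moment generating function is all the Gaussian
    input. The obstacle in the energy estimate is that A takes values in the dual of V: projections
    orthogonal in H need not be bounded in V, so the truncation errors could not be dominated. With
    the added term ep <u, v> the truncations are bounded in V for fixed ep, and their limit (j'j +
    ep)^-1 j'j x, with j' the adjoint of j, differs from x by at most |x| in V and sqrt(ep) |x| in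
    H. This fixes the order of the limits: the truncation is removed before ep. The comparison tests
    only the event where the inequality fails at the initial time, and the mesh error is closed by
    Cauchy-Schwarz, the weights being bounded in L² uniformly in the mesh. *)

Lemma cvg0_le (R : realType) (u v : nat -> R) : (forall n, 0 <= v n <= u n) ->
  u @ \oo --> (0:R) -> v @ \oo --> (0:R).
Proof.
move=> uv u0; apply: (@squeeze_cvgr _ _ _ _ (fun=> 0) u) => //; last exact: cvg_cst.
by apply: nearW => n; exact: uv.
Qed.

Lemma ae_mono d (S : measurableType d) (R : realType) (m : {measure set S -> \bar R})
    (A B : S -> Prop) : (forall x, A x -> B x) ->
  {ae m, forall x, A x} -> {ae m, forall x, B x}.
Proof. by move=> AB; apply: filterS. Qed.

Section square_integrable_functions.
Context d (S : measurableType d) (R : realType) (m : {measure set S -> \bar R}).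
Implicit Types f g h : S -> R.

Definition sqint f :=
  measurable_fun setT f /\ (\int[m]_x ((f x) ^+ 2)%:E < +oo)%E.

Definition ip f g : R := \int[m]_x (f x * g x).

Lemma sqint_integrable2 f : sqint f ->
  m.-integrable setT (EFin \o (fun x => f x ^+ 2)).
Proof.
move=> [mf foo]; apply/integrableP; split.
  by apply/measurable_EFinP; exact: measurable_funX.
by under eq_integral do rewrite /= ger0_norm ?sqr_ge0//.
Qed.

Lemma sqint_integrableM f g : sqint f -> sqint g ->
  m.-integrable setT (EFin \o (fun x => f x * g x)).
Proof.
move=> sf sg.
apply: (@le_integrable _ _ _ m setT measurableT _
  (EFin \o (fun x => f x ^+ 2 + g x ^+ 2))).
- by apply/measurable_EFinP; apply: measurable_funM; [case: sf|case: sg].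
- move=> x _ /=; rewrite lee_fin normrM [leRHS]ger0_norm ?addr_ge0 ?sqr_ge0//.
  rewrite -(real_normK (num_real (f x))) -(real_normK (num_real (g x))).
  by have := sqr_ge0 (`|f x| - `|g x|); have := normr_ge0 (f x); have := normr_ge0 (g x); nra.
- have := integrableD measurableT (sqint_integrable2 sf) (sqint_integrable2 sg).
  by apply: eq_integrable.
Qed.

Lemma sqint_le f g : measurable_fun setT f -> (forall x, `|f x| <= `|g x|) ->
  sqint g -> sqint f.
Proof.
move=> mf fg [mg goo]; split => //; apply: le_lt_trans goo.
apply: ge0_le_integral => //.
- by move=> x _; rewrite lee_fin sqr_ge0.
- by apply/measurable_EFinP; exact: measurable_funX.
- by apply/measurable_EFinP; exact: measurable_funX.
- move=> x _; rewrite lee_fin -(real_normK (num_real (f x))).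
  by rewrite -(real_normK (num_real (g x))) lerXn2r ?nnegrE.
Qed.

Lemma sqint0 : sqint (fun=> 0).
Proof.
split; first exact: measurable_cst.
by under eq_integral do rewrite expr0n/=; rewrite integral0.
Qed.

Lemma sqintD f g : sqint f -> sqint g -> sqint (fun x => f x + g x).
Proof.
move=> sf sg.
have ig := integrableD measurableT (sqint_integrable2 sf) (sqint_integrable2 sg).
have ifg := integrableD measurableT ig
  (integrableD measurableT (sqint_integrableM sf sg) (sqint_integrableM sf sg)).
split; first by apply: measurable_funD; [case: sf|case: sg].
have /integrableP[_] : m.-integrable setT (EFin \o (fun x => (f x + g x) ^+ 2)).
  apply: eq_integrable ifg => //= x _.
  by rewrite -!EFinD; congr EFin; ring.
by under eq_integral do rewrite /= ger0_norm ?sqr_ge0//.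
Qed.

Lemma sqintZ c f : sqint f -> sqint (fun x => c * f x).
Proof.
move=> sf; split; first by apply: measurable_funM => //; case: sf.
have /integrableP[_] : m.-integrable setT (EFin \o (fun x => (c * f x) ^+ 2)).
  have := integrableZl measurableT (c ^+ 2) (sqint_integrable2 sf).
  by apply: eq_integrable => //= x _; rewrite exprMn.
by under eq_integral do rewrite /= ger0_norm ?sqr_ge0//.
Qed.

Lemma sqintN f : sqint f -> sqint (fun x => - f x).
Proof.
move=> /(sqintZ (-1)); congr sqint; apply/funext => x; by rewrite mulN1r.
Qed.

Lemma sqintB f g : sqint f -> sqint g -> sqint (fun x => f x - g x).
Proof. by move=> sf sg; apply: sqintD => //; exact: sqintN. Qed.

Lemma sqint_sum (I : Type) (r : seq I) (F : I -> S -> R) :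
  (forall i, sqint (F i)) -> sqint (fun x => \sum_(i <- r) F i x).
Proof.
move=> sF; elim: r => [|i r ih].
  by under eq_fun do rewrite big_nil; exact: sqint0.
by under eq_fun do rewrite big_cons; exact: sqintD.
Qed.

Lemma ipC f g : ip f g = ip g f.
Proof. by apply: eq_Rintegral => x _; rewrite mulrC. Qed.

Lemma ipDl f g h : sqint f -> sqint g -> sqint h ->
  ip (fun x => f x + g x) h = ip f h + ip g h.
Proof.
move=> sf sg sh; rewrite /ip; under eq_Rintegral do rewrite mulrDl.
by rewrite RintegralD//; exact: sqint_integrableM.
Qed.

Lemma ipZl c f h : sqint f -> sqint h -> ip (fun x => c * f x) h = c * ip f h.
Proof.
move=> sf sh; rewrite /ip; under eq_Rintegral do rewrite -mulrA.
by rewrite RintegralZl//; exact: sqint_integrableM.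
Qed.

Lemma ipNl f h : sqint f -> sqint h -> ip (fun x => - f x) h = - ip f h.
Proof.
move=> sf sh; rewrite -mulN1r -ipZl//; congr ip; apply/funext => x.
by rewrite mulN1r.
Qed.

Lemma ipBl f g h : sqint f -> sqint g -> sqint h ->
  ip (fun x => f x - g x) h = ip f h - ip g h.
Proof. by move=> sf sg sh; rewrite ipDl ?ipNl//; exact: sqintN. Qed.

Lemma ipDr f g h : sqint f -> sqint g -> sqint h ->
  ip h (fun x => f x + g x) = ip h f + ip h g.
Proof. by move=> *; rewrite ipC ipDl// (ipC f) (ipC g). Qed.

Lemma ipBr f g h : sqint f -> sqint g -> sqint h ->
  ip h (fun x => f x - g x) = ip h f - ip h g.
Proof. by move=> *; rewrite ipC ipBl// (ipC f) (ipC g). Qed.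

Lemma ipZr c f h : sqint f -> sqint h -> ip h (fun x => c * f x) = c * ip h f.
Proof. by move=> *; rewrite ipC ipZl// (ipC f). Qed.

Lemma ip0l f : ip (fun=> 0) f = 0.
Proof.
rewrite /ip; under eq_Rintegral do rewrite mul0r.
by rewrite /Rintegral integral0.
Qed.

Lemma ip_ge0 f : 0 <= ip f f.
Proof. by apply: Rintegral_ge0 => x _; rewrite -expr2 sqr_ge0. Qed.

Lemma ip_le f g f' g' : sqint f -> sqint g -> sqint f' -> sqint g' ->
  (forall x, f x * g x <= f' x * g' x) -> ip f g <= ip f' g'.
Proof.
move=> sf sg sf' sg' fg; apply: le_Rintegral => //; exact: sqint_integrableM.
Qed.

Lemma ip_ae f g f' g' : sqint f -> sqint g -> sqint f' -> sqint g' ->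
  {ae m, forall x, f x * g x = f' x * g' x} -> ip f g = ip f' g'.
Proof.
move=> sf sg sf' sg' fg; congr fine; apply: ae_eq_integral => //.
- exact: measurable_int (sqint_integrableM sf sg).
- exact: measurable_int (sqint_integrableM sf' sg').
- by apply: filterS fg => x + _; move=> /= ->.
Qed.

Lemma Rintegral_ge0_ae h : m.-integrable setT (EFin \o h) ->
  {ae m, forall x, 0 <= h x} -> 0 <= \int[m]_x h x.
Proof.
move=> ih h0; have mh := measurable_int _ ih.
suff -> : \int[m]_x h x = \int[m]_x `|h x| by apply: Rintegral_ge0.
congr fine; apply: ae_eq_integral => //.
  by apply/measurable_EFinP; apply: measurableT_comp => //; exact/measurable_EFinP.
by apply: filterS h0 => x h0 _; rewrite ger0_norm.
Qed.

Lemma ip_le_ae f g f' g' : sqint f -> sqint g -> sqint f' -> sqint g' ->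
  {ae m, forall x, f x * g x <= f' x * g' x} -> ip f g <= ip f' g'.
Proof.
move=> sf sg sf' sg' fg.
have i1 := sqint_integrableM sf sg; have i2 := sqint_integrableM sf' sg'.
rewrite /ip -subr_ge0 -RintegralB//; apply: Rintegral_ge0_ae.
  exact: (integrableB measurableT i2 i1).
by apply: filterS fg => x; rewrite subr_ge0.
Qed.

Lemma ip_quad f g c : sqint f -> sqint g ->
  ip (fun x => f x + c * g x) (fun x => f x + c * g x) =
  ip f f + 2 * c * ip f g + c ^+ 2 * ip g g.
Proof.
move=> sf sg; have sg' := sqintZ c sg.
rewrite ipDl ?ipDr ?ipZl ?ipZr//; last exact: sqintD.
rewrite (ipC g f); ring.
Qed.

Lemma ip_CS f g : sqint f -> sqint g -> ip f g ^+ 2 <= ip f f * ip g g.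
Proof.
move=> sf sg.
have [g0|g0] := eqVneq (ip g g) 0.
  suff -> : ip f g = 0 by rewrite expr0n/= g0 mulr0.
  apply/eqP/negPn/negP => fg0.
  (* With [ip g g = 0] the quadratic in the multiplier is affine, and this multiplier gives it the
     value -1. *)
  have := ip_ge0 (fun x => f x + (- (ip f f + 1) / (2 * ip f g)) * g x).
  rewrite ip_quad// g0 mulr0 addr0.
  rewrite (_ : 2 * _ * _ = - (ip f f + 1)); last by field.
  by rewrite leNgt => /negP; apply; lra.
have gp : 0 < ip g g by rewrite lt_neqAle eq_sym g0 ip_ge0.
(* The minimiser of the quadratic: its value there is the Cauchy-Schwarz defect divided by
   [ip g g]. *)
have := ip_ge0 (fun x => f x + (- ip f g / ip g g) * g x).
rewrite ip_quad//.
rewrite (_ : _ + _ = ip f f - ip f g ^+ 2 / ip g g); last by field.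
by rewrite subr_ge0 ler_pdivrMr.
Qed.

Lemma ip_CS_sqrt f g : sqint f -> sqint g ->
  `|ip f g| <= Num.sqrt (ip f f) * Num.sqrt (ip g g).
Proof.
move=> sf sg; rewrite -sqrtrM ?ip_ge0// -sqrtr_sqr ler_sqrt.
  exact: ip_CS.
by rewrite mulr_ge0// ip_ge0.
Qed.

Lemma ipE f : sqint f -> (\int[m]_x (f x ^+ 2)%:E)%E = (ip f f)%:E.
Proof.
move=> sf; rewrite /ip /Rintegral fineK; last first.
  by apply: integrable_fin_num => //; exact: sqint_integrableM.
by apply: eq_integral => x _; rewrite expr2.
Qed.

Lemma ip_eq0 f : sqint f -> ip f f = 0 -> {ae m, forall x, f x = 0}.
Proof.
move=> sf f0.
have : (\int[m]_x `|(f x ^+ 2)%:E|)%E = 0%E.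
  under eq_integral do rewrite /= ger0_norm ?sqr_ge0//.
  by rewrite ipE// f0.
move/(ae_eq_integral_abs _ measurableT) => H.
have /H : measurable_fun setT (fun x => (f x ^+ 2)%:E).
  exact: measurable_int (sqint_integrable2 sf).
by apply: filterS => x /(_ I) [] /eqP; rewrite sqrf_eq0 => /eqP.
Qed.

Definition L2cvg (F : nat -> S -> R) f :=
  (fun n => ip (fun x => F n x - f x) (fun x => F n x - f x)) @ \oo --> (0 : R).

Lemma L2cvg_ip (F : nat -> S -> R) f g : (forall n, sqint (F n)) -> sqint f ->
  sqint g -> L2cvg F f -> (fun n => ip (F n) g) @ \oo --> ip f g.
Proof.
move=> sF sf sg cF.
have H n : `|ip (F n) g - ip f g| <=
   Num.sqrt (ip (fun x => F n x - f x) (fun x => F n x - f x)) * Num.sqrt (ip g g).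
  by rewrite -ipBl//; apply: ip_CS_sqrt => //; exact: sqintB.
apply/cvgrPdist_le => /= e e0.
have /cvgrPdist_le/(_ _ e0) : (fun n => Num.sqrt (ip (fun x => F n x - f x) (fun x => F n x - f x)) * Num.sqrt (ip g g)) @ \oo --> (Num.sqrt 0 * Num.sqrt (ip g g)).
  apply: cvgMr_tmp; apply: continuous_cvg => //; exact: sqrt_continuous.
rewrite sqrtr0 mul0r; apply: filterS => n; rewrite sub0r normrN.
move=> he; rewrite distrC; apply: le_trans (H n) _; apply: le_trans he.
exact: ler_norm.
Qed.

Lemma ip_ae0 f : sqint f -> {ae m, forall x, f x = 0} -> ip f f = 0.
Proof.
move=> sf f0; rewrite -(ip0l f); apply: ip_ae => //; try exact: sqint0.
by apply: filterS f0 => x ->; rewrite mul0r.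
Qed.

(** Expand around the limits: the product of the two errors is small by Cauchy-Schwarz, and the
    remaining terms involve one sequence only, where [L2cvg_ip] applies. *)
Lemma L2cvg_ip2 (F G : nat -> S -> R) f g : (forall n, sqint (F n)) ->
  (forall n, sqint (G n)) -> sqint f -> sqint g -> L2cvg F f -> L2cvg G g ->
  (fun n => ip (F n) (G n)) @ \oo --> ip f g.
Proof.
move=> sF sG sf sg cF cG.
have -> : (fun n => ip (F n) (G n)) = (fun n =>
    ip (fun x => F n x - f x) (fun x => G n x - g x) + ip (F n) g + (ip (G n) f - ip f g)).
  apply/funext => n; rewrite !(ipBl, ipBr)//; last exact: sqintB.
  rewrite (ipC (G n)); ring.
rewrite -[X in _ --> X](_ : 0 + ip f g + (ip f g - ip f g) = _); last by ring.
apply: cvgD; last first.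
  apply: cvgB; last exact: cvg_cst.
  by rewrite [X in _ --> X]ipC; exact: L2cvg_ip.
apply: cvgD; last exact: L2cvg_ip.
have H n : `|ip (fun x => F n x - f x) (fun x => G n x - g x)| <=
   Num.sqrt (ip (fun x => F n x - f x) (fun x => F n x - f x)) *
   Num.sqrt (ip (fun x => G n x - g x) (fun x => G n x - g x)).
  by apply: ip_CS_sqrt; exact: sqintB.
apply/norm_cvg0P.
apply: (@squeeze_cvgr _ _ _ _ (fun=> 0) (fun n =>
   Num.sqrt (ip (fun x => F n x - f x) (fun x => F n x - f x)) *
   Num.sqrt (ip (fun x => G n x - g x) (fun x => G n x - g x)))).
- by apply: nearW => n; rewrite normr_ge0 H.
- exact: cvg_cst.
- rewrite -[X in _ --> X](_ : Num.sqrt 0 * Num.sqrt 0 = _); last by rewrite sqrtr0 mul0r.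
  by apply: cvgM; apply: continuous_cvg => //; exact: sqrt_continuous.
Qed.

(** By the parallelogram law the squared distance from [G n] to [f] is at most twice the sum of two
    squared norms that tend to 0. It serves to exchange one approximating sequence for another. *)
Lemma L2cvg_sub (F G : nat -> S -> R) f : (forall n, sqint (F n)) ->
  (forall n, sqint (G n)) -> sqint f -> L2cvg F f ->
  (fun n => ip (fun x => F n x - G n x) (fun x => F n x - G n x)) @ \oo --> (0:R) ->
  L2cvg G f.
Proof.
move=> sF sG sf cF FG.
have sFG n : sqint (fun x => F n x - G n x) by exact: sqintB.
have H n : ip (fun x => G n x - f x) (fun x => G n x - f x) <=
    2 * ip (fun x => F n x - f x) (fun x => F n x - f x) +
    2 * ip (fun x => F n x - G n x) (fun x => F n x - G n x).
  have sFf : sqint (fun x => F n x - f x) by exact: sqintB.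
  have := ip_ge0 (fun x => (F n x - f x) + 1 * (F n x - G n x)).
  rewrite ip_quad//.
  rewrite (_ : (fun x => G n x - f x) = (fun x => (F n x - f x) + (-1) * (F n x - G n x))).
    rewrite ip_quad//; lra.
  apply/funext => x; ring.
apply: (@squeeze_cvgr _ _ _ _ (fun=> 0) (fun n =>
    2 * ip (fun x => F n x - f x) (fun x => F n x - f x) +
    2 * ip (fun x => F n x - G n x) (fun x => F n x - G n x))).
- by apply: nearW => n; rewrite ip_ge0 H.
- exact: cvg_cst.
- rewrite -[X in _ --> X](_ : 2 * 0 + 2 * 0 = _); last by rewrite mulr0 addr0.
  by apply: cvgD; apply: cvgMl_tmp.
Qed.

Lemma L2cvg_lin (F G : nat -> S -> R) f g c : (forall n, sqint (F n)) ->
  (forall n, sqint (G n)) -> sqint f -> sqint g -> L2cvg F f -> L2cvg G g ->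
  L2cvg (fun n x => F n x + c * G n x) (fun x => f x + c * g x).
Proof.
move=> sF sG sf sg cF cG; rewrite /L2cvg.
have L0 (H : nat -> S -> R) h : L2cvg H h -> L2cvg (fun n x => H n x - h x) (fun=> 0).
  rewrite /L2cvg => cH; apply: cvg_trans cH; apply: near_eq_cvg; apply: nearW => n.
  by congr ip; apply/funext => x; rewrite subr0.
have -> : (fun n => ip (fun x => F n x + c * G n x - (f x + c * g x))
    (fun x => F n x + c * G n x - (f x + c * g x))) = (fun n =>
    ip (fun x => F n x - f x) (fun x => F n x - f x) + 2 * c *
    ip (fun x => F n x - f x) (fun x => G n x - g x) + c ^+ 2 *
    ip (fun x => G n x - g x) (fun x => G n x - g x)).
  apply/funext => n; rewrite -ip_quad; try exact: sqintB.
  by congr ip; apply/funext => x; ring.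
rewrite -[X in _ --> X](_ : 0 + 2 * c * 0 + c ^+ 2 * 0 = _); last by ring.
apply: cvgD; last by apply: cvgMl_tmp.
apply: cvgD => //; apply: cvgMl_tmp.
rewrite -[X in _ --> X](ip0l (fun=> 0)).
by apply: L2cvg_ip2; do ?[exact: sqint0 | exact: L0 | by move=> n; exact: sqintB].
Qed.

End square_integrable_functions.

(** * Brownian increments *)

Section gaussian_moments.
Context (R : realType).
Notation mu := (@lebesgue_measure R).

(** The change of variables is done with the Radon-Nikodym derivative, which agrees almost
    everywhere with the explicit density because both have the same integral over every measurable
    set. *)
Lemma ge0_integral_normal_prob (s : R) (g : R -> \bar R) : s != 0 ->
  measurable_fun setT g -> (forall x, (0 <= g x)%E) ->
  (\int[normal_prob 0 s]_x g x = \int[mu]_x (g x * (normal_pdf 0 s x)%:E))%E.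
Proof.
move=> s0 mg g0.
have dom := normal_prob_dominates 0 s.
rewrite -(Radon_Nikodym_SigmaFinite.change_of_variables dom g0 measurableT mg).
have mRN := measurable_int _ (Radon_Nikodym_SigmaFinite.f_integrable dom).
have mpdf : measurable_fun setT (fun x => (normal_pdf 0 s x)%:E).
  by apply/measurable_EFinP; exact: measurable_normal_pdf.
apply: ae_eq_integral => //.
- by apply: emeasurable_funM.
- by apply: emeasurable_funM.
apply: ae_eqe_mul2l; apply: integral_ae_eq => //.
- exact: Radon_Nikodym_SigmaFinite.f_integrable.
- move=> E ET mE; rewrite -Radon_Nikodym_SigmaFinite.f_integral//.
Qed.

(** Completing the square: e^(cx) times the centred density is e^(c²s²/2) times the density centred
    at c s². *)
Lemma normal_prob_mgf (s c : R) : s != 0 ->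
  (\int[normal_prob 0 s]_x (expR (c * x))%:E = (expR (c ^+ 2 * s ^+ 2 / 2))%:E)%E.
Proof.
move=> s0; rewrite ge0_integral_normal_prob//; last first.
  by apply/measurable_EFinP; apply: measurableT_comp => //; exact: measurable_funM.
transitivity (\int[mu]_x ((expR (c ^+ 2 * s ^+ 2 / 2))%:E *
    (normal_pdf (c * s ^+ 2) s x)%:E))%E; last first.
  rewrite ge0_integralZl//.
  - by rewrite integral_normal_pdf mule1.
  - by apply/measurable_EFinP; exact: measurable_normal_pdf.
  - by move=> x _; rewrite lee_fin normal_pdf_ge0.
apply: eq_integral => x _; rewrite -!EFinM; congr EFin.
rewrite /normal_pdf (negbTE s0) /normal_fun.
rewrite [LHS]mulrCA [RHS]mulrCA -!expRD; congr (_ * expR _).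
by field.
Qed.

(** * Moments of a variable known only by its Gaussian moment generating function *)

Context d (Om : measurableType d) (P : probability Om R) (D : Om -> R) (v : R).
Hypothesis mD : measurable_fun setT D.
Hypothesis mgf : forall c, (\int[P]_x (expR (c * D x))%:E = (expR (c ^+ 2 * v / 2))%:E)%E.

Lemma measurable_expD c : measurable_fun setT (fun x => expR (c * D x)).
Proof. by apply: measurableT_comp => //; exact: measurable_funM. Qed.

Lemma integrable_expD c : P.-integrable setT (EFin \o (fun x => expR (c * D x))).
Proof.
apply/integrableP; split; first by apply/measurable_EFinP; exact: measurable_expD.
under eq_integral do rewrite /= ger0_norm ?expR_ge0//.
by rewrite mgf ltry.
Qed.

Lemma sqint_expD c : sqint P (fun x => expR (c * D x)).
Proof.
split; first exact: measurable_expD.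
under eq_integral do rewrite expr2 -expRD -mulrDl.
by rewrite mgf ltry.
Qed.

Lemma Rintegral_expD c : \int[P]_x expR (c * D x) = expR (c ^+ 2 * v / 2).
Proof. by rewrite /Rintegral mgf. Qed.

Lemma le_expR_sum c (x : R) : expR (c * `|x|) <= expR (c * x) + expR (- c * x).
Proof.
case: (lerP 0 x) => x0.
  by rewrite ger0_norm// lerDl expR_ge0.
by rewrite ltr0_norm// mulrN -mulNr lerDr expR_ge0.
Qed.

Lemma le_expR_norm (x : R) : `|x| <= expR `|x|.
Proof. by apply: le_trans (expR_ge1Dx _); rewrite lerDr. Qed.

Lemma integrable_absexpD c (g : R -> R) : measurable_fun setT g ->
  (forall x, `|g x| <= expR (c * `|x|)) ->
  P.-integrable setT (EFin \o (fun x => g (D x))).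
Proof.
move=> mg gc.
have i := integrableD measurableT (integrable_expD c) (integrable_expD (- c)).
apply: le_integrable i => //.
  by apply/measurable_EFinP; exact: measurableT_comp.
move=> x _ /=; rewrite lee_fin.
rewrite [leRHS]ger0_norm ?addr_ge0 ?expR_ge0//.
by apply: le_trans (gc _) _; exact: le_expR_sum.
Qed.

(** Since |x| <= e^|x| <= e^x + e^(-x), the product is dominated by two exponentials with exponents
    c + 1 and c - 1. *)
Lemma sqint_D_exp c : sqint P (fun x => D x * expR (c * D x)).
Proof.
apply: (@sqint_le _ _ _ P _ (fun x => expR ((c + 1) * D x) + expR ((c - 1) * D x))).
- by apply: measurable_funM => //; exact: measurable_expD.
- move=> x; rewrite [leRHS]ger0_norm ?addr_ge0 ?expR_ge0//.
  rewrite normrM [X in _ * X]ger0_norm ?expR_ge0//.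
  rewrite !(mulrDl c) !expRD -mulrDr mulrC ler_pM2l ?expR_gt0//.
  by apply: le_trans (le_expR_norm _) _; rewrite -{1}(mul1r `|_|); exact: le_expR_sum.
- by apply: sqintD; exact: sqint_expD.
Qed.

Lemma sqint_D : sqint P D.
Proof.
by have := sqint_D_exp 0; congr sqint; apply/funext => x; rewrite mul0r expR0 mulr1.
Qed.

Lemma integrable_D_exp c : P.-integrable setT (EFin \o (fun x => D x * expR (c * D x))).
Proof.
by have := sqint_integrableM sqint_D (sqint_expD c).
Qed.

(** The generating function is differentiated without exchanging limit and integral: e^(hx) >= 1 +
    hx makes [psi] nonnegative, it vanishes at 0, and so its derivative at that minimum is 0. *)
Lemma Rintegral_D_exp c :
  \int[P]_x (D x * expR (c * D x)) = c * v * expR (c ^+ 2 * v / 2).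
Proof.
set a := LHS.
have H h : h * a <= expR ((c + h) ^+ 2 * v / 2) - expR (c ^+ 2 * v / 2).
  rewrite -!Rintegral_expD -RintegralZl//; last exact: integrable_D_exp.
  rewrite -RintegralB//; [|exact: integrable_expD..].
  apply: le_Rintegral => //.
  - exact: (integrableZl measurableT h (integrable_D_exp c)).
  - exact: (integrableB measurableT (integrable_expD (c + h)) (integrable_expD c)).
  - move=> x _; rewrite mulrDl expRD mulrA [_ * expR _]mulrC.
    rewrite -{3}(mulr1 (expR (c * D x))) -mulrBr ler_pM2l ?expR_gt0//.
    by rewrite lerBrDl expR_ge1Dx.
pose psi (h : R) := expR ((c + h) ^+ 2 * v / 2) - expR (c ^+ 2 * v / 2) - h * a.
have dpsi : is_derive (0 : R) (1:R) psi (c * v * expR (c ^+ 2 * v / 2) - a).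
  rewrite /psi; apply: is_derive_eq.
  rewrite !(scaler0, addr0, mulr1, add0r) /GRing.scale/=; by field.
have : is_derive (0:R) 1 psi 0.
  apply: (@derive1_at_min R psi (-1) 1 0) => //.
  - by rewrite in_itv/=; lra.
  - by move=> t _; rewrite {1}/psi addr0 subrr mul0r subr0 /psi subr_ge0.
move=> /(@derive_val _ _ _ _ _ _ _); rewrite (@derive_val _ _ _ _ _ _ _ dpsi).
by move/eqP; rewrite subr_eq0 => /eqP.
Qed.

Lemma Rintegral_D0 : \int[P]_x D x = 0.
Proof.
have := Rintegral_D_exp 0; rewrite !mul0r => <-.
by apply: eq_Rintegral => x _; rewrite mul0r expR0 mulr1.
Qed.

(** The fraction is the symmetric difference quotient at 0 of c -> x e^(cx), with limit x². The
    expression is even in [x]; for x >= 0 the error is at most h x³ e^(hx), and x <= e^x with h <= 1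
    gives the fourth power. *)
Lemma sinh_bound (h x : R) : 0 < h -> h <= 1 ->
  `|(x * expR (h * x) - x * expR (- h * x)) / (2 * h) - x ^+ 2| <= h * (expR `|x|) ^+ 4.
Proof.
move=> h0 h1.
wlog x0 : x / 0 <= x.
  move=> W; case: (lerP 0 x) => [|x0]; first exact: W.
  have := W (- x); rewrite oppr_ge0 ltW// => /(_ isT).
  rewrite normrN sqrrN !mulNr !mulrN !opprK.
  by rewrite (addrC (- _)).
set y := h * x; have y0 : 0 <= y by rewrite mulr_ge0// ltW.
have -> : (x * expR y - x * expR (- h * x)) / (2 * h) - x ^+ 2 =
   x / h * ((expR y - expR (- y)) / 2 - y).
  by rewrite mulNr -/y /y; field; rewrite gt_eqF.
(* The upper and the lower bound use nothing but 1 + u <= e^u, at u = y, -y and -2y. *)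
have ub : (expR y - expR (- y)) / 2 - y <= y ^+ 2 * expR y.
  have E1 : expR (- y) * expR (- y) * expR y = expR (- y).
    by rewrite -!expRD; congr expR; ring.
  have A1 := expR_ge1Dx (- y - y); rewrite expRD in A1.
  have A2 := expR_ge1Dx (- y).
  have ep := expR_gt0 y.
  have E2 : expR (- y) * expR y = 1 by rewrite -expRD addNr expR0.
  have B1 : expR y - expR (- y) <= 2 * y * expR y by nra.
  have B2 : expR y - 1 <= y * expR y by nra.
  nra.
have lb : - (y ^+ 2 * expR y) <= (expR y - expR (- y)) / 2 - y.
  have A1 := expR_ge1Dx y.
  have E2 : expR (- y) * expR y = 1 by rewrite -expRD addNr expR0.
  have ep := expR_gt0 (- y).
  have C : expR (- y) <= 1 - y + y ^+ 2.
    have C1 : expR (- y) * (1 + y) <= 1 by nra.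
    have C2 : 1 <= (1 - y + y ^+ 2) * (1 + y) by have := exprn_ge0 3 y0; nra.
    have C3 : 0 < 1 + y by lra.
    by rewrite -(ler_pM2r C3); apply: le_trans C1 C2.
  nra.
rewrite normrM (ger0_norm x0) ger0_norm; last by rewrite divr_ge0// ltW.
have AB : `|(expR y - expR (- y)) / 2 - y| <= y ^+ 2 * expR y by rewrite ler_norml lb ub.
have E3 : x / h * (y ^+ 2 * expR y) = h * (x ^+ 3 * expR y).
  by rewrite /y; field; rewrite gt_eqF.
apply: (@le_trans _ _ (x / h * (y ^+ 2 * expR y))).
  by rewrite ler_wpM2l// divr_ge0// ltW.
rewrite E3 ler_pM2l// [leRHS]exprSr ler_pM ?exprn_ge0 ?expR_ge0//.
  by rewrite lerXn2r ?nnegrE ?expR_ge0//; have := le_expR_norm x; rewrite ger0_norm.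
by rewrite ler_expR /y ler_piMl.
Qed.

(** By [Rintegral_D_exp] the symmetric quotients with h = 1/(n+1) have mean v e^(h²v/2), which tends
    to v, while [sinh_bound] keeps them within h times an integrable function of the square. *)
Lemma Rintegral_D2 : \int[P]_x (D x ^+ 2) = v.
Proof.
pose f n x : R := (D x * expR (n.+1%:R^-1 * D x) - D x * expR (- n.+1%:R^-1 * D x)) / (2 * n.+1%:R^-1).
have fi n : P.-integrable setT (EFin \o f n).
  have := integrableB measurableT (integrable_D_exp n.+1%:R^-1) (integrable_D_exp (- n.+1%:R^-1)).
  by move/(integrableZr measurableT (2 * n.+1%:R^-1)^-1).
have ED2 : P.-integrable setT (EFin \o (fun x => D x ^+ 2)).
  exact: sqint_integrable2 sqint_D.
have Ef n : \int[P]_x f n x = v * expR ((n.+1%:R^-1) ^+ 2 * v / 2).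
  rewrite RintegralZr//; last first.
    exact: (integrableB measurableT (integrable_D_exp _) (integrable_D_exp _)).
  rewrite RintegralB//; [|exact: integrable_D_exp..].
  rewrite !Rintegral_D_exp sqrrN; field.
  by rewrite nat1r pnatr_eq0.
pose K : R := \int[P]_x (expR `|D x|) ^+ 4.
have Ki : P.-integrable setT (EFin \o (fun x => (expR `|D x|) ^+ 4)).
  apply: (@integrable_absexpD 4 (fun x => (expR `|x|) ^+ 4)).
    by apply: measurable_funX; apply: measurableT_comp => //; exact: measurableT_comp.
  by move=> x; rewrite ger0_norm ?exprn_ge0 ?expR_ge0// -expRM_natl.
have B n : `|v * expR ((n.+1%:R^-1) ^+ 2 * v / 2) - \int[P]_x (D x ^+ 2)| <= n.+1%:R^-1 * K.
  rewrite -Ef -RintegralB//.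
  apply: le_trans (le_normr_Rintegral measurableT _) _.
    exact: (integrableB measurableT (fi n) ED2).
  rewrite -RintegralZl//; apply: le_Rintegral => //.
  - by apply: (integrable_norm (integrableB measurableT (fi n) ED2)).
  - exact: (integrableZl measurableT n.+1%:R^-1 Ki).
  - move=> x _; apply: sinh_bound; first by rewrite invr_gt0.
    by rewrite invf_le1 ?ler1n.
have cv : (fun n => v * expR ((n.+1%:R^-1) ^+ 2 * v / 2)) @ \oo --> v.
  rewrite -[X in _ --> X](_ : v * expR ((0:R) ^+ 2 * v / 2) = _); last first.
    by rewrite expr0n/= !mul0r expR0 mulr1.
  apply: cvgMl_tmp; apply: continuous_cvg; first exact: continuous_expR.
  apply: cvgMr_tmp; apply: cvgMr_tmp.
  rewrite expr0n/=; under eq_fun do rewrite expr2.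
  have := cvgM (@cvg_harmonic R) (@cvg_harmonic R); rewrite mulr0; exact.
apply/esym/(cvg_unique (@norm_hausdorff _ R^o) cv)/cvgrPdist_le => /= e e0.
have /cvgrPdist_le/(_ _ e0) : (fun n : nat => n.+1%:R^-1 * K) @ \oo --> 0 * K.
  by apply: cvgMr_tmp; exact: cvg_harmonic.
apply: filterS => n; rewrite mul0r sub0r normrN => he.
by rewrite distrC; apply: le_trans (B n) _; apply: le_trans he; exact: ler_norm.
Qed.

End gaussian_moments.

(** The bridge between [measurable_wrt], stated with open sets, and [measurable_fun] for real-valued
    maps. *)
Lemma measurable_borel (R : realType) :
  (measurable : set (set R)) = <<s @open R >>.
Proof.
apply/seteqP; split.
  have sub : <<s @RGenOInfty.G R >> `<=` <<s @open R >>.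
    by apply: sub_sigma_algebra2 => _ [x ->]; exact: interval_open.
  move=> A mA; apply: sub.
  have : (RGenOInfty.G (R := R)).-sigma.-measurable A by rewrite -RGenOInfty.measurableE.
  exact.
apply: smallest_sub; first exact: sigma_algebra_measurable.
exact: open_measurable.
Qed.

Section brownian_increments.
Context (R : realType) (d : measure_display) (Om : measurableType d).
Context (P : probability Om R) (T : R) (w : R -> Om -> R).
Hypothesis w_bm : brownian_motion P T w.
Notation F := (augmented_filtration P w).

Lemma augmented_filtration_le s t : s <= t -> F s `<=` F t.
Proof.
move=> st; apply: sub_sigma_algebra2; apply: setSU.
apply: sub_sigma_algebra2 => _ [r [B [/andP[r0 rs] mB ->]]].
by exists r, B; split=> //; rewrite r0 (le_trans rs).
Qed.

Lemma natural_filtration_measurable s : s <= T -> natural_filtration w s `<=` measurable.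
Proof.
move=> sT; apply: smallest_sub; first exact: sigma_algebra_measurable.
move=> _ [r [B [/andP[r0 rs] mB ->]]].
have := bm_measurable w_bm (t := r).
rewrite r0 (le_trans rs sT) => /(_ isT) mw.
by rewrite -[X in measurable X]setTI; exact: mw.
Qed.

Lemma augmented_filtration_measurable s : s <= T -> F s `<=` measurable.
Proof.
move=> sT; apply: smallest_sub; first exact: sigma_algebra_measurable.
by move=> A [|[]//]; exact: natural_filtration_measurable.
Qed.

(* Om carrying the sigma-algebra F s, so that F s-measurability becomes
   [measurable_fun] and its closure lemmas apply. *)
Definition filtType s := g_sigma_algebraType
  (natural_filtration w s `|` [set N | measurable N /\ P N = 0%E]).

HB.instance Definition _ s := Measurable.on (filtType s).

Definition Fm s (f : Om -> R) := measurable_fun setT (f : filtType s -> R).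

Lemma FmP s (f : Om -> R) : Fm s f <-> measurable_wrt (F s) setT f.
Proof.
split=> [mf B|mf]; first by rewrite -measurable_borel => mB; exact: mf.
by move=> _ B mB; apply: mf; rewrite -measurable_borel.
Qed.

Lemma Fm_le s t f : s <= t -> Fm s f -> Fm t f.
Proof.
by move=> st mf mD B mB; apply: (augmented_filtration_le st); exact: mf.
Qed.

Lemma Fm_measurable s f : s <= T -> Fm s f -> measurable_fun setT f.
Proof.
by move=> st mf mD B mB; apply: (augmented_filtration_measurable st); exact: mf.
Qed.

Lemma Fm_w r s : 0 <= r -> r <= s -> Fm s (w r).
Proof.
move=> r0 rs mD B mB; rewrite setTI.
apply: sub_sigma_algebra; left; apply: sub_sigma_algebra.
by exists r, B; split => //; rewrite r0.
Qed.

(** The sets that agree with a set of the natural filtration off a null set form a sigma-algebra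
    containing both generating families. Independence is assumed for the natural filtration and is
    carried over to the augmented one through this description. *)
Lemma augmented_filtration_natural s E : s <= T -> F s E ->
  exists E' N, [/\ natural_filtration w s E', measurable N, P N = 0%E &
                   E `\` N = E' `\` N].
Proof.
move=> sT; move: E; apply: smallest_sub; last first.
  move=> A [nA|[mA A0]]; first by exists A, set0.
  exists set0, A; split => //; first exact: sigma_algebra0.
  by rewrite setDv set0D.
split.
- exists set0, set0; split=> //; exact: sigma_algebra0.
- move=> A [E' [N [nE mN N0 AE]]]; exists (~` E'), N; split => //.
    by rewrite -setTD; exact: sigma_algebraCD.
  rewrite setTD; apply/seteqP; split => x [Ax Nx]; split => //= E'x; apply: Ax.
    have : (E' `\` N) x by []; by rewrite -AE => -[].
  have : (A `\` N) x by []; by rewrite AE => -[].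
- move=> A AE.
  have [E' HE] := choice AE; have [N HN] := choice HE.
  exists (\bigcup_k E' k), (\bigcup_k N k); split.
  + by apply: sigma_algebra_bigcup => k; case: (HN k).
  + by apply: bigcupT_measurable => k; case: (HN k).
  + apply/(negligibleP P); first by apply: bigcupT_measurable => k; case: (HN k).
    apply: negligible_bigcup => k; case: (HN k) => _ mN N0 _.
    exact/(negligibleP P mN).
  + apply/seteqP; split => x [[k _ Ax] Nx]; split => //; exists k => //.
      have : (A k `\` N k) x by split => // Nk; apply: Nx; exists k.
      by case: (HN k) => _ _ _ -> [].
    have : (E' k `\` N k) x by split => // Nk; apply: Nx; exists k.
    by case: (HN k) => _ _ _ <- [].
Qed.

Lemma eq_measure_offnull (A A' N : set Om) : measurable A -> measurable A' ->
  measurable N -> P N = 0%E -> A `\` N = A' `\` N -> P A = P A'.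
Proof.
move=> mA mA' mN N0 AA'.
have H B : measurable B -> P B = P (B `\` N).
  move=> mB; rewrite measureD//; last by rewrite -ge0_fin_numE// fin_num_measure.
  rewrite (@subset_measure0 _ _ _ P _ _ _ mN (@subIsetr _ B N) N0) ?sube0//.
  exact: measurableI.
by rewrite H// AA' -H.
Qed.

Definition increment s t om := w t om - w s om.
Local Notation dw := increment.

Lemma measurable_dw s t : 0 <= s -> s <= t -> t <= T -> measurable_fun setT (dw s t).
Proof.
move=> s0 st tT; apply: measurable_funB; apply: bm_measurable w_bm _ _.
  by rewrite (le_trans s0).
by rewrite s0 (le_trans st).
Qed.

Lemma augmented_filtration_indep s t E B : 0 <= s -> s < t -> t <= T -> F s E ->
  measurable B -> P (E `&` dw s t @^-1` B) = (P E * P (dw s t @^-1` B))%E.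
Proof.
move=> s0 st tT FE mB; have sT : s <= T by apply: le_trans tT; exact: ltW.
have [E' [N [nE mN N0 EE]]] := augmented_filtration_natural sT FE.
have mE := augmented_filtration_measurable sT FE.
have mE' := natural_filtration_measurable sT nE.
have mD : measurable (dw s t @^-1` B).
  by rewrite -[X in measurable X]setTI; apply: measurable_dw => //; exact: ltW.
rewrite (eq_measure_offnull mE mE' mN N0 EE).
rewrite -(bm_independent w_bm s0 st tT nE mB).
apply: (@eq_measure_offnull _ _ N) => //; try exact: measurableI.
by rewrite !setDE ![_ `&` _ `&` ~` N]setIAC -!setDE EE.
Qed.

Lemma dw_mgf s t : 0 <= s -> s < t -> t <= T -> forall c,
  (\int[P]_x (expR (c * dw s t x))%:E = (expR (c ^+ 2 * (t - s) / 2))%:E)%E.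
Proof.
move=> s0 st tT c; have mD := measurable_dw s0 (ltW st) tT.
have sg : Num.sqrt (t - s) != 0 by rewrite gt_eqF// sqrtr_gt0 subr_gt0.
rewrite -[in RHS](@sqr_sqrtr _ (t - s)) ?subr_ge0 ?ltW//.
rewrite -(normal_prob_mgf c sg).
have mD' : @measurable_fun _ _ Om (g_sigma_algebraType R.-ocitv.-measurable) setT (dw s t).
  exact: mD.
pose X : {mfun Om >-> g_sigma_algebraType R.-ocitv.-measurable} :=
  @mfun_Sub _ _ Om (g_sigma_algebraType R.-ocitv.-measurable) _ (mem_set mD').
rewrite -[LHS](@ge0_integral_distribution _ _ _ _ _ P X (fun x => (expR (c * x))%:E)).
- apply: eq_measure_integral => A mA _.
  exact: (bm_gaussian w_bm s0 st tT mA).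
- by apply/measurable_EFinP; apply: measurableT_comp => //; exact: measurable_funM.
- by move=> y; rewrite lee_fin expR_ge0.
Qed.

(** * Expectation of a product of a past variable and a function of an increment *)

Section independence.
Variables (s t : R) (s0 : 0 <= s) (st : s < t) (tT : t <= T).

Let mD := measurable_dw s0 (ltW st) tT.
Let sT : s <= T. Proof. by apply: le_trans tT; exact: ltW. Qed.

Let mid : measurable_fun setT (id : Om -> filtType s).
Proof.
move=> _ B mB; rewrite setTI; exact: augmented_filtration_measurable sT _ mB.
Qed.

(** The identity of [Om], seen as a random element of the space that carries [F s]. Independence of
    the sigma-algebra and the increment then says that the pair [X] has a product law. *)
Let X1 : {mfun Om >-> filtType s} := mfun_Sub (mem_set mid).
Let X2 : {mfun Om >-> R} := mfun_Sub (mem_set mD).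
Let mX : measurable_fun setT (fun om => (X1 om, X2 om)).
Proof. by apply: measurable_fun_pair. Qed.
Let X : {mfun Om >-> (filtType s * R)%type} := mfun_Sub (mem_set mX).

Let joint A : measurable A ->
  (distribution P X1 \x distribution P X2)%E A = distribution P X A.
Proof.
apply: product_measure_unique => A1 A2 mA1 mA2.
exact: (augmented_filtration_indep s0 st tT).
Qed.

(** Under the product law of [X] the integrand is a product of functions of one variable each, and
    Tonelli factors the integral. *)
Lemma ge0_integral_indep (z : Om -> R) (g : R -> R) : Fm s z ->
  measurable_fun setT g -> (forall x, 0 <= z x) -> (forall x, 0 <= g x) ->
  (\int[P]_x (z x * g (dw s t x))%:E =
   \int[P]_x (z x)%:E * \int[P]_x (g (dw s t x))%:E)%E.
Proof.
move=> mz mg z0 g0.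
pose f (p : filtType s * R) := ((z p.1)%:E * (g p.2)%:E)%E.
have mf : measurable_fun setT f.
  apply: emeasurable_funM; apply/measurable_EFinP.
    exact: (measurableT_comp mz measurable_fst).
  exact: (measurableT_comp mg measurable_snd).
have f0 p : (0 <= f p)%E by rewrite mule_ge0 ?lee_fin.
transitivity (\int[distribution P X]_p f p)%E.
  by rewrite ge0_integral_distribution.
rewrite -(@eq_measure_integral _ _ _ _ (distribution P X) (distribution P X1 \x distribution P X2)%E); last first.
  by move=> A mA _; exact: joint.
rewrite fubini_tonelli1//.
have E2 : (\int[distribution P X2]_y (g y)%:E = \int[P]_x (g (dw s t x))%:E)%E.
  by rewrite ge0_integral_distribution//; exact/measurable_EFinP.
rewrite -E2.
transitivity (\int[distribution P X1]_x ((z x)%:E * \int[distribution P X2]_y (g y)%:E))%E.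
  apply: eq_integral => x _; rewrite /fubini_F /f/= ge0_integralZl//.
  - exact/measurable_EFinP.
  - by move=> y _; rewrite lee_fin.
  - by rewrite lee_fin.
rewrite ge0_integralZr//.
- congr (_ * _)%E; rewrite ge0_integral_distribution//.
  exact/measurable_EFinP.
- exact/measurable_EFinP.
- by move=> y _; rewrite lee_fin.
- by apply: integral_ge0 => y _; rewrite lee_fin.
Qed.

Lemma integrable_indep (z : Om -> R) (g : R -> R) : Fm s z ->
  measurable_fun setT g -> P.-integrable setT (EFin \o z) ->
  P.-integrable setT (EFin \o (g \o dw s t)) ->
  P.-integrable setT (EFin \o (fun x => z x * g (dw s t x))).
Proof.
move=> mz mg iz ig; apply/integrableP; split.
  apply/measurable_EFinP; apply: measurable_funM; first exact: Fm_measurable mz.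
  exact: measurableT_comp.
under eq_integral do rewrite /= normrM.
rewrite (@ge0_integral_indep (fun x => `|z x|) (fun x => `|g x|))//.
- move/integrableP : iz => [_ iz]; move/integrableP : ig => [_ ig].
  by rewrite lte_mul_pinfty// ?integral_ge0// ge0_fin_numE// integral_ge0.
- by apply: measurableT_comp.
- by apply: measurableT_comp.
Qed.

Lemma Rintegral_indep (z : Om -> R) (g : R -> R) : Fm s z ->
  measurable_fun setT g -> P.-integrable setT (EFin \o z) ->
  P.-integrable setT (EFin \o (g \o dw s t)) ->
  \int[P]_x (z x * g (dw s t x)) = (\int[P]_x z x) * (\int[P]_x g (dw s t x)).
Proof.
move=> mz mg iz ig.
have izg := integrable_indep mz mg iz ig.
pose f (p : filtType s * R) := (z p.1 * g p.2)%:E.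
have mf : measurable_fun setT f.
  apply/measurable_EFinP; apply: measurable_funM.
    exact: (measurableT_comp mz measurable_fst).
  exact: (measurableT_comp mg measurable_snd).
have iz1 : (distribution P X1).-integrable setT (EFin \o z).
  apply/integrableP; split; first exact/measurable_EFinP.
  rewrite ge0_integral_distribution//; first by case/integrableP : iz.
  by apply: measurableT_comp => //; exact/measurable_EFinP.
have ig2 : (distribution P X2).-integrable setT (EFin \o g).
  apply/integrableP; split; first exact/measurable_EFinP.
  rewrite ge0_integral_distribution//; first by case/integrableP : ig.
  by apply: measurableT_comp => //; exact/measurable_EFinP.
rewrite /Rintegral -(@integral_distribution _ _ _ _ _ P X f)//; last first.
rewrite -(@eq_measure_integral _ _ _ _ (distribution P X) (distribution P X1 \x distribution P X2)%E); last first.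
  by move=> A mA _; exact: joint.
rewrite -integral12_prod_meas1//; last first.
  apply/integrableP; split => //.
  rewrite (@eq_measure_integral _ _ _ _ (distribution P X)); last first.
    by move=> A mA _; exact: joint.
  rewrite ge0_integral_distribution//; first by case/integrableP : izg.
  exact: measurableT_comp.
rewrite /fubini_F /f.
transitivity (fine (\int[distribution P X1]_x ((z x)%:E * \int[distribution P X2]_y (g y)%:E))%E).
  congr fine; apply: eq_integral => x _ /=; under eq_integral do rewrite EFinM.
  by rewrite integralZl.
have gfin : (\int[distribution P X2]_y (g y)%:E \is a fin_num)%E.
  exact: integrable_fin_num ig2.
rewrite -(fineK gfin) integralZr// fineM//; last exact: integrable_fin_num iz1.
rewrite (fineK gfin).
congr (fine _ * fine _).
  by rewrite integral_distribution//; exact/measurable_EFinP.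
by rewrite integral_distribution//; exact/measurable_EFinP.
Qed.

End independence.

Section increment_expectations.
Variables (s t : R) (s0 : 0 <= s) (st : s < t) (tT : t <= T).
Variables (z : Om -> R) (mz : Fm s z) (iz : P.-integrable setT (EFin \o z)).
Let mD := measurable_dw s0 (ltW st) tT.
Let mgf := dw_mgf s0 st tT.

Let mexp c : measurable_fun setT (fun x : R => expR (c * x)).
Proof. by apply: measurableT_comp => //; exact: measurable_funM. Qed.

Lemma Rintegral_z_dw : \int[P]_x (z x * dw s t x) = 0.
Proof.
rewrite (Rintegral_indep s0 st tT (g := id))//; first by rewrite (Rintegral_D0 mD mgf) mulr0.
by have := integrable_D_exp mD mgf 0; apply: eq_integrable => // x _ /=; rewrite mul0r expR0 mulr1.
Qed.

Lemma Rintegral_z_dw2 : \int[P]_x (z x * (dw s t x) ^+ 2) = (t - s) * \int[P]_x z x.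
Proof.
rewrite (Rintegral_indep s0 st tT (g := fun x => x ^+ 2))//.
- by rewrite (Rintegral_D2 mD mgf) mulrC.
- exact: sqint_integrable2 (sqint_D mD mgf).
Qed.

Lemma integrable_z_expdw c : P.-integrable setT (EFin \o (fun x => z x * expR (c * dw s t x))).
Proof.
apply: (integrable_indep s0 st tT (g := fun x => expR (c * x))) => //.
exact: integrable_expD mD mgf c.
Qed.

Lemma Rintegral_z_expdw c : \int[P]_x (z x * expR (c * dw s t x)) =
  expR (c ^+ 2 * (t - s) / 2) * \int[P]_x z x.
Proof.
rewrite (Rintegral_indep s0 st tT (g := fun x => expR (c * x)))//.
- by rewrite (Rintegral_expD mgf) mulrC.
- exact: integrable_expD mD mgf c.
Qed.

Lemma integrable_z_dw_expdw c :
  P.-integrable setT (EFin \o (fun x => z x * (dw s t x * expR (c * dw s t x)))).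
Proof.
apply: (integrable_indep s0 st tT (g := fun x => x * expR (c * x))) => //.
- exact: measurable_funM.
- exact: integrable_D_exp mD mgf c.
Qed.

Lemma Rintegral_z_dw_expdw c : \int[P]_x (z x * (dw s t x * expR (c * dw s t x))) =
  c * (t - s) * expR (c ^+ 2 * (t - s) / 2) * \int[P]_x z x.
Proof.
rewrite (Rintegral_indep s0 st tT (g := fun x => x * expR (c * x)))//.
- by rewrite (Rintegral_D_exp mD mgf) mulrC.
- exact: measurable_funM.
- exact: integrable_D_exp mD mgf c.
Qed.

End increment_expectations.

End brownian_increments.

(** * Elementary and Ito integrals *)

Section product_space.
Context d1 d2 (T1 : measurableType d1) (T2 : measurableType d2) (R : realType).
Context (m1 : {sigma_finite_measure set T1 -> \bar R}).
Context (m2 : {sigma_finite_measure set T2 -> \bar R}).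
Notation M := (m1 \x m2)%E.

Section real_fubini.
Context (h : T1 * T2 -> R) (ih : M.-integrable setT (EFin \o h)).

Lemma integrable_Rfubini1 : m1.-integrable setT (EFin \o (fun x => \int[m2]_y h (x, y))).
Proof.
have iF := integrable_fubini_F ih.
apply: (le_integrable measurableT _ _ iF).
  apply/measurable_EFinP; apply: (measurableT_comp (fine_measurable measurableT)).
  exact: measurable_fubini_F ih.
move=> x _ /=; rewrite /fubini_F/=; rewrite /Rintegral.
by case: (\int[m2]_y _)%E => [r| |]; rewrite //= normr0 leey.
Qed.

Lemma integrable_Rfubini2 : m2.-integrable setT (EFin \o (fun y => \int[m1]_x h (x, y))).
Proof.
have iG : m2.-integrable setT (fubini_G m1 (EFin \o h)).
  apply/integrableP; split; first exact: measurable_fubini_G ih.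
  apply: le_lt_trans ((integrable21ltyP m1 m2 (measurable_int _ ih)).1 ih).
  apply: ge0_le_integral => //.
  - by apply: measurableT_comp => //; exact: measurable_fubini_G ih.
  - have mh := measurable_int _ ih.
    by apply: (measurable_fun_fubini_tonelli_G (fun x => `|(EFin \o h) x|)%E) => //; exact: measurableT_comp.
  - move=> y _; apply: le_abse_integral => //.
    exact: measurableT_comp (measurable_int _ ih) (measurable_pair2 y).
apply: (le_integrable measurableT _ _ iG).
  apply/measurable_EFinP; apply: (measurableT_comp (fine_measurable measurableT)).
  exact: measurable_fubini_G ih.
move=> x _ /=; rewrite /fubini_G/= /Rintegral.
by case: (\int[m1]_y _)%E => [r| |]; rewrite //= normr0 leey.
Qed.

Lemma Rintegral_fubini1 : \int[M]_z h z = \int[m1]_x \int[m2]_y h (x, y).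
Proof.
rewrite {1 2}/Rintegral -integral12_prod_meas1//; congr fine.
apply: ae_eq_integral => //.
- exact: measurable_fubini_F ih.
- exact: measurable_int integrable_Rfubini1.
apply: filterS (ae_integrable1 ih) => x ix _; rewrite /fubini_F /Rintegral fineK//.
exact: integrable_fin_num ix.
Qed.

Lemma Rintegral_fubini2 : \int[M]_z h z = \int[m2]_y \int[m1]_x h (x, y).
Proof.
rewrite {1 2}/Rintegral -integral21_prod_meas1//; congr fine.
apply: ae_eq_integral => //.
- exact: measurable_fubini_G ih.
- exact: measurable_int integrable_Rfubini2.
apply: filterS (ae_integrable2 ih) => x ix _; rewrite /fubini_G /Rintegral fineK//.
exact: integrable_fin_num ix.
Qed.

End real_fubini.

Lemma integrable_tensor (phi : T1 -> R) (z : T2 -> R) :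
  m1.-integrable setT (EFin \o phi) -> m2.-integrable setT (EFin \o z) ->
  M.-integrable setT (EFin \o (fun x => phi x.1 * z x.2)).
Proof.
move=> iphi iz.
have mphi : measurable_fun setT phi by apply/measurable_EFinP; exact: measurable_int iphi.
have mz : measurable_fun setT z by apply/measurable_EFinP; exact: measurable_int iz.
have mf : measurable_fun setT (fun x : T1 * T2 => phi x.1 * z x.2).
  apply: measurable_funM; first exact: (measurableT_comp mphi measurable_fst).
  exact: (measurableT_comp mz measurable_snd).
apply/integrable12ltyP; first exact/measurable_EFinP.
have zfin : (\int[m2]_y `|(z y)%:E| \is a fin_num)%E.
  by rewrite ge0_fin_numE ?integral_ge0//; case/integrableP : iz.
under eq_integral => x _.
  under eq_integral do rewrite /= normrM EFinM.
  rewrite ge0_integralZl//; last first.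
    by apply/measurable_EFinP; exact: measurableT_comp.
  rewrite -(fineK zfin); over.
rewrite ge0_integralZr//.
- rewrite lte_mul_pinfty ?ltry ?integral_ge0// ge0_fin_numE ?integral_ge0//.
  by case/integrableP : iphi.
- by apply/measurable_EFinP; exact: measurableT_comp.
- by rewrite fineK// integral_ge0.
Qed.

Lemma Rintegral_tensor (phi : T1 -> R) (z : T2 -> R) :
  m1.-integrable setT (EFin \o phi) -> m2.-integrable setT (EFin \o z) ->
  \int[M]_x (phi x.1 * z x.2) = (\int[m1]_r phi r) * (\int[m2]_om z om).
Proof.
move=> iphi iz; rewrite Rintegral_fubini1; last exact: integrable_tensor.
by under eq_Rintegral do rewrite /= RintegralZl//; rewrite RintegralZr.
Qed.

Lemma sqint_tensor (phi : T1 -> R) (z : T2 -> R) :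
  sqint m1 phi -> sqint m2 z -> sqint M (fun x => phi x.1 * z x.2).
Proof.
move=> sphi sz; split.
  apply: measurable_funM; first exact: (measurableT_comp sphi.1 measurable_fst).
  exact: (measurableT_comp sz.1 measurable_snd).
have /integrableP[_] := integrable_tensor (sqint_integrable2 sphi) (sqint_integrable2 sz).
congr (_ < _)%E; apply: eq_integral => x _ /=.
have h : 0 <= phi x.1 ^+ 2 * z x.2 ^+ 2 by rewrite mulr_ge0// sqr_ge0.
by rewrite ger0_norm// -exprMn.
Qed.

End product_space.

Lemma sqint_mull (R : realType) d' (S : measurableType d') (m : {measure set S -> \bar R}) (z f : S -> R) K :
  measurable_fun setT z -> (forall x, `|z x| <= K) -> sqint m f ->
  sqint m (fun x => z x * f x).
Proof.
move=> mz zK sf; apply: (@sqint_le _ _ _ m _ (fun x => K * f x)).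
- by apply: measurable_funM => //; case: sf.
- move=> x; rewrite !normrM ler_wpM2r//.
  by apply: le_trans (zK x) _; exact: ler_norm.
- exact: sqintZ.
Qed.

Lemma sqint_indic_itv (R : realType) (i : interval R) a b : [set` i] `<=` `[a, b] -> sqint (@lebesgue_measure R) \1_[set` i].
Proof.
move=> iab; split; first exact: measurable_indic.
rewrite (_ : (\int[lebesgue_measure]_x _)%E = (\int[lebesgue_measure]_x (\1_[set` i] x)%:E)%E); last first.
  apply: eq_integral => x _; rewrite indicE.
  by case: (x \in _) => /=; rewrite ?expr1n ?expr0n.
rewrite integral_indic// setIT; apply: (@le_lt_trans _ _ (lebesgue_measure `[a, b])).
  by apply: le_measure => //; rewrite inE.
by rewrite lebesgue_measure_itv/=; case: ifP => _; rewrite -?EFinB ?ltry.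
Qed.

(** * Isometry and martingale property of elementary integrals *)

Section elementary_integrals.
Context (R : realType) (d : measure_display) (Om : measurableType d).
Context (P : probability Om R) (T : R) (w : R -> Om -> R).
Hypothesis w_bm : brownian_motion P T w.
Notation F := (augmented_filtration P w).
Notation mu := (@lebesgue_measure R).
Notation M := (mu \x P)%E.
Notation Fm := (Fm P w).
Notation dw := (increment w).

Definition bounded_rv (z : Om -> R) := exists K, forall om, `|z om| <= K.

Lemma bounded_rvM z z' : bounded_rv z -> bounded_rv z' -> bounded_rv (fun x => z x * z' x).
Proof.
move=> [K zK] [K' zK']; exists (K * K') => om; rewrite normrM ler_pM//.
Qed.

Lemma sqint_bounded z : measurable_fun setT z -> bounded_rv z -> sqint P z.
Proof.
move=> mz [K zK].
have : sqint P (fun=> (1:R)).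
  split; first exact: measurable_cst.
  by rewrite expr1n integral_cst//= mul1e -ge0_fin_numE// fin_num_measure.
move/(sqint_mull mz zK); congr sqint; apply/funext => x; by rewrite mulr1.
Qed.

Lemma sqint1 : sqint P (fun=> (1:R)).
Proof.
apply: sqint_bounded; first exact: measurable_cst.
by exists 1 => om; rewrite normr1.
Qed.

Lemma sqint_integrable z : sqint P z -> P.-integrable setT (EFin \o z).
Proof.
move=> sz; have := sqint_integrableM sqint1 sz.
by apply: eq_integrable => // x _ /=; rewrite mul1r.
Qed.

Lemma dwxx s om : dw s s om = 0. Proof. by rewrite /increment subrr. Qed.

Lemma dwD r s t om : dw r t om = dw r s om + dw s t om.
Proof. by rewrite /increment; ring. Qed.

Lemma sqint_dw s t : 0 <= s -> s <= t -> t <= T -> sqint P (dw s t).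
Proof.
move=> s0; rewrite le_eqVlt => /orP[/eqP <- _|st tT].
  by rewrite (_ : dw s s = fun=> 0); [exact: sqint0|apply/funext => om; rewrite dwxx].
exact: (sqint_D (measurable_dw w_bm s0 (ltW st) tT) (dw_mgf w_bm s0 st tT)).
Qed.

Lemma Fm_dw r s t : 0 <= r -> r <= s -> s <= t -> Fm t (dw r s).
Proof.
move=> r0 rs st; apply: measurable_funB; apply: Fm_w; lra.
Qed.

Lemma FmM s z z' : Fm s z -> Fm s z' -> Fm s (fun x => z x * z' x).
Proof. by move=> *; apply: measurable_funM. Qed.

Lemma E_dw s t z : 0 <= s -> s <= t -> t <= T -> Fm s z ->
  P.-integrable setT (EFin \o z) -> \int[P]_x (z x * dw s t x) = 0.
Proof.
move=> s0; rewrite le_eqVlt => /orP[/eqP <- _ _ _|st tT mz iz].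
  by under eq_Rintegral do rewrite dwxx mulr0; rewrite /Rintegral integral0.
exact: (Rintegral_z_dw w_bm s0 st tT).
Qed.

Lemma E_dw2 s t z : 0 <= s -> s <= t -> t <= T -> Fm s z ->
  P.-integrable setT (EFin \o z) ->
  \int[P]_x (z x * (dw s t x) ^+ 2) = (t - s) * \int[P]_x z x.
Proof.
move=> s0; rewrite le_eqVlt => /orP[/eqP <- _ _ _|st tT mz iz].
  under eq_Rintegral do rewrite dwxx expr0n/= mulr0.
  by rewrite /Rintegral integral0 subrr mul0r.
exact: (Rintegral_z_dw2 w_bm s0 st tT).
Qed.

(** The longer increment is split at [q]: the part after q is independent of [z] times the increment
    up to q and centred, so only the square of the common part remains. *)
Lemma E_dwdw p q q' z : 0 <= p -> p <= q -> q <= q' -> q' <= T -> Fm p z ->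
  bounded_rv z ->
  \int[P]_x (z x * dw p q x * dw p q' x) = (q - p) * \int[P]_x z x.
Proof.
move=> p0 pq qq' qT mz bz.
have pT : p <= T by rewrite (le_trans pq)// (le_trans qq').
have qT' : q <= T by rewrite (le_trans qq').
have q0 : 0 <= q by rewrite (le_trans p0).
have sz : sqint P z by apply: sqint_bounded => //; exact: (Fm_measurable w_bm _ mz).
have [K zK] := bz.
have szd : sqint P (fun x => z x * dw p q x).
  by apply: sqint_mull zK _; [exact: (Fm_measurable w_bm _ mz)|exact: sqint_dw].
rewrite -E_dw2//; last exact: sqint_integrable.
under eq_Rintegral do rewrite (dwD p q q') mulrDr.
rewrite RintegralD//; last 2 first.
- by apply: sqint_integrableM => //; exact: sqint_dw.
- by apply: sqint_integrableM => //; exact: sqint_dw.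
rewrite [X in _ + X]E_dw ?addr0//.
- by apply: eq_Rintegral => x _; rewrite expr2 mulrA.
- by apply: FmM; [exact: Fm_le mz|exact: Fm_dw].
- exact: sqint_integrable.
Qed.

(* (xi, p, q) is the elementary process xi 1_]p, q].  A process is any list of
   these, with overlaps allowed, which makes the class additive without common
   refinements of subdivisions. *)
Definition estep : Type := ((Om -> R) * R * R)%type.
Implicit Types (e : estep) (l : seq estep).

Definition evalid s t e :=
  [/\ s <= e.1.2, e.1.2 <= e.2, e.2 <= t, Fm e.1.2 e.1.1 & bounded_rv e.1.1].

Definition eint1 e om := e.1.1 om * dw e.1.2 e.2 om.
Definition eval1 e (x : R * Om) := \1_`]e.1.2, e.2] x.1 * e.1.1 x.2.

Fixpoint evalids s t l := if l is e :: l' then evalid s t e /\ evalids s t l' else True.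
Definition eint l om := \sum_(e <- l) eint1 e om.
Definition eval l x := \sum_(e <- l) eval1 e x.

Lemma eint_cons e l : eint (e :: l) = fun om => eint1 e om + eint l om.
Proof. by apply/funext => om; rewrite /eint big_cons. Qed.

Lemma eval_cons e l : eval (e :: l) = fun om => eval1 e om + eval l om.
Proof. by apply/funext => om; rewrite /eval big_cons. Qed.

Lemma eint_nil : eint [::] = fun=> 0.
Proof. by apply/funext => om; rewrite /eint big_nil. Qed.

Lemma eval_nil : eval [::] = fun=> 0.
Proof. by apply/funext => om; rewrite /eval big_nil. Qed.

Lemma sqint_eint1 s t e : 0 <= s -> t <= T -> evalid s t e -> sqint P (eint1 e).
Proof.
move=> s0 tT [sp pq qt mz [K zK]]; apply: sqint_mull zK _.
  by apply: (Fm_measurable w_bm _ mz); lra.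
by apply: sqint_dw => //; [exact: le_trans sp|exact: le_trans tT].
Qed.

Lemma sqint_eint s t l : 0 <= s -> t <= T -> evalids s t l -> sqint P (eint l).
Proof.
move=> s0 tT; elim: l => [_|e l ih /= [ve vl]]; first by rewrite eint_nil; exact: sqint0.
by rewrite eint_cons; apply: sqintD; [exact: sqint_eint1 ve|exact: ih].
Qed.

Lemma sqint_eval1 s t e : t <= T -> evalid s t e -> sqint M (eval1 e).
Proof.
move=> tT [sp pq qt mz bz]; apply: sqint_tensor.
  apply: (@sqint_indic_itv R _ s t) => x /=; rewrite !in_itv/= => /andP[a b].
  by rewrite (le_trans sp (ltW a)) (le_trans b qt).
apply: sqint_bounded => //.
by apply: (Fm_measurable w_bm _ mz); lra.
Qed.

Lemma sqint_eval s t l : t <= T -> evalids s t l -> sqint M (eval l).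
Proof.
move=> tT; elim: l => [_|e l ih /= [ve vl]]; first by rewrite eval_nil; exact: sqint0.
by rewrite eval_cons; apply: sqintD; [exact: sqint_eval1 ve|exact: ih].
Qed.

(** The factor before the integral is the length of the intersection of the two intervals; the outer
    maximum with 0 covers disjoint ones. *)
Lemma ip_eval1 s t s' t' e e' : t <= T -> t' <= T -> evalid s t e -> evalid s' t' e' ->
  ip M (eval1 e) (eval1 e') =
  Num.max 0 (Num.min e.2 e'.2 - Num.max e.1.2 e'.1.2) * \int[P]_x (e.1.1 x * e'.1.1 x).
Proof.
move=> tT tT' ve ve'.
have [sp pq qt mz bz] := ve; have [sp' pq' qt' mz' bz'] := ve'.
have sz : sqint P e.1.1.
  apply: sqint_bounded => //.
  by apply: (Fm_measurable w_bm _ mz); lra.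
have sz' : sqint P e'.1.1.
  apply: sqint_bounded => //.
  by apply: (Fm_measurable w_bm _ mz'); lra.
rewrite /ip.
transitivity (\int[M]_x ((\1_`]e.1.2, e.2] x.1 * \1_`]e'.1.2, e'.2] x.1) * (e.1.1 x.2 * e'.1.1 x.2))).
  by apply: eq_Rintegral => x _; rewrite /eval1; ring.
rewrite (@Rintegral_tensor _ _ _ _ _ mu P (fun r => \1_`]e.1.2, e.2] r * \1_`]e'.1.2, e'.2] r)
   (fun x => e.1.1 x * e'.1.1 x)); last 2 first.
- apply: sqint_integrableM.
    apply: (@sqint_indic_itv R _ s t) => x /=; rewrite !in_itv/= => /andP[a b].
    by rewrite (le_trans sp (ltW a)) (le_trans b qt).
  apply: (@sqint_indic_itv R _ s' t') => x /=; rewrite !in_itv/= => /andP[a b].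
  by rewrite (le_trans sp' (ltW a)) (le_trans b qt').
- exact: sqint_integrableM.
congr (_ * _).
rewrite /Rintegral (_ : (\int[mu]_r _)%E =
    (\int[mu]_r (\1_`]Num.max e.1.2 e'.1.2, Num.min e.2 e'.2] r)%:E)%E); last first.
  apply: eq_integral => r _; rewrite !indicE -natrM mulnb; congr EFin; congr GRing.natmul; congr nat_of_bool.
  rewrite !mem_setE !in_itv/= gt_max le_min.
  by case: (e.1.2 < r); case: (e'.1.2 < r); case: (r <= e.2); case: (r <= e'.2).
rewrite integral_indic// setIT.
transitivity (fine (mu [set` `]Num.max e.1.2 e'.1.2, Num.min e.2 e'.2]%R])); first by [].
rewrite lebesgue_measure_itv/= lte_fin.
case: ltP => h; rewrite -?EFinB/=.
  by rewrite [RHS]max_r// subr_ge0 ltW.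
by rewrite [RHS]max_l// subr_le0.
Qed.

(** By symmetry the first step starts first. Its increment before [p'] is known when the second step
    begins, hence contributes nothing; the two steps then start together and [E_dwdw] gives the
    length of the overlap. *)
Lemma ip_eint1 s t s' t' e e' : 0 <= s -> t <= T -> 0 <= s' -> t' <= T ->
  evalid s t e -> evalid s' t' e' ->
  ip P (eint1 e) (eint1 e') = ip M (eval1 e) (eval1 e').
Proof.
move=> s0 tT s0' tT'.
wlog pp' : s t s' t' s0 tT s0' tT' e e' / e.1.2 <= e'.1.2.
  move=> W; case: (lerP e.1.2 e'.1.2) => [|/ltW] h ve ve'; first exact: (W s t s' t').
  by rewrite ipC [RHS]ipC; exact: (W s' t' s t).
move=> ve ve'; rewrite (ip_eval1 tT tT' ve ve').
have [sp pq qt mz bz] := ve; have [sp' pq' qt' mz' bz'] := ve'.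
set p := e.1.2 in pp' *; set q := e.2 in pq qt *.
set p' := e'.1.2 in pp' pq' *; set q' := e'.2 in pq' qt' *.
rewrite (max_r pp'); set z := e.1.1 in mz bz *; set z' := e'.1.1 in mz' bz' *.
have p0 : 0 <= p by rewrite /p; lra.
have qT : q <= T by rewrite /q; lra.
have qT' : q' <= T by rewrite /q'; lra.
have se : sqint P (eint1 e) := sqint_eint1 s0 tT ve.
have se' : sqint P (eint1 e') := sqint_eint1 s0' tT' ve'.
have mzz : Fm p' (fun x => z x * z' x) by apply: FmM => //; exact: Fm_le mz.
have bzz : bounded_rv (fun x => z x * z' x) by exact: bounded_rvM.
case: (leP q p') => qp'.
  rewrite max_l; last by rewrite subr_le0 ge_min qp'.
  rewrite mul0r /ip /eint1 -/z -/z' -/p -/q -/p' -/q'.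
  under eq_Rintegral do rewrite mulrA.
  apply: (E_dw (s := p')) => //; try lra.
  - by apply: FmM => //; apply: Fm_le qp' _; apply: FmM; [exact: Fm_le mz|exact: Fm_dw].
  - apply: sqint_integrable; have [K zK] := bz'.
    under eq_fun do rewrite mulrC; apply: sqint_mull zK se.
    by apply: (Fm_measurable w_bm _ mz'); lra.
(* Only the increments after [p'] interact: the one from p to p' multiplies a centred increment
   independent of it. *)
have Eshift : ip P (eint1 e) (eint1 e') =
    \int[P]_x ((z x * z' x) * dw p' q x * dw p' q' x).
  have [K zK] := bz.
  have sz1 : sqint P (fun x => z x * dw p p' x).
    by apply: sqint_mull zK _; [apply: (Fm_measurable w_bm _ mz); lra|apply: sqint_dw => //; lra].
  have sz2 : sqint P (fun x => z x * dw p' q x).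
    by apply: sqint_mull zK _; [apply: (Fm_measurable w_bm _ mz); lra|apply: sqint_dw => //; lra].
  rewrite (_ : eint1 e = fun x => z x * dw p p' x + z x * dw p' q x); last first.
    by apply/funext => x; rewrite /eint1 -/p -/q -/z (dwD p p' q) mulrDr.
  rewrite ipDl// (_ : ip P (fun x => z x * dw p p' x) _ = 0) ?add0r.
    by apply: eq_Rintegral => x _; rewrite /eint1 -/p' -/q' -/z'; ring.
  rewrite /ip /eint1 -/z' -/p' -/q'; under eq_Rintegral do rewrite mulrA.
  apply: (E_dw (s := p')) => //; try lra.
  - by apply: FmM => //; apply: FmM; [exact: Fm_le mz|exact: Fm_dw].
  - apply: sqint_integrable; have [K' zK'] := bz'.
    under eq_fun do rewrite mulrC; apply: sqint_mull zK' sz1.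
    by apply: (Fm_measurable w_bm _ mz'); lra.
rewrite Eshift; case: (leP q q') => qq'.
  rewrite max_r; last lra.
  by rewrite E_dwdw//; lra.
rewrite max_r; last lra.
rewrite -(@E_dwdw p' q' q)//; try lra.
by apply: eq_Rintegral => x _; ring.
Qed.

Lemma ip_eint s t s' t' l l' : 0 <= s -> t <= T -> 0 <= s' -> t' <= T ->
  evalids s t l -> evalids s' t' l' ->
  ip P (eint l) (eint l') = ip M (eval l) (eval l').
Proof.
move=> s0 tT s0' tT'; elim: l => [_ _|e l ih /= [ve vl] vl'].
  by rewrite eint_nil eval_nil !ip0l.
rewrite eint_cons eval_cons !ipDl; last 6 first.
- exact: sqint_eval1 ve.
- exact: sqint_eval vl.
- exact: sqint_eval vl'.
- exact: sqint_eint1 ve.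
- exact: sqint_eint vl.
- exact: sqint_eint vl'.
rewrite ih//; congr (_ + _); clear ih.
elim: l' vl' => [_|e' l' ih' /= [ve' vl']].
  by rewrite eint_nil eval_nil ipC ip0l ipC ip0l.
rewrite eint_cons eval_cons !ipDr; last 6 first.
- exact: sqint_eval1 ve'.
- exact: sqint_eval vl'.
- exact: sqint_eval1 ve.
- exact: sqint_eint1 ve'.
- exact: sqint_eint vl'.
- exact: sqint_eint1 ve.
by rewrite ih'// (ip_eint1 s0 tT s0' tT' ve ve').
Qed.

Lemma evalids_cat s t l l' : evalids s t l -> evalids s t l' -> evalids s t (l ++ l').
Proof. by elim: l => //= e l ih [ve vl] vl'; split => //; exact: ih. Qed.

Definition escale c l : seq estep := [seq ((fun x => c * e.1.1 x), e.1.2, e.2) | e <- l].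

Lemma evalids_scale s t c l : evalids s t l -> evalids s t (escale c l).
Proof.
elim: l => //= e l ih [[sp pq qt mz [K zK]] vl]; split; last exact: ih.
split => //=; first by apply: measurable_funM => //; exact: measurable_cst.
by exists (`|c| * K) => om; rewrite normrM ler_wpM2l.
Qed.

Lemma eint_cat l l' om : eint (l ++ l') om = eint l om + eint l' om.
Proof. by rewrite /eint big_cat. Qed.

Lemma eval_cat l l' x : eval (l ++ l') x = eval l x + eval l' x.
Proof. by rewrite /eval big_cat. Qed.

Lemma eint_scale c l om : eint (escale c l) om = c * eint l om.
Proof. by rewrite /eint big_map mulr_sumr; apply: eq_bigr => e _; rewrite /eint1/= mulrA. Qed.

Lemma eval_scale c l x : eval (escale c l) x = c * eval l x.
Proof. by rewrite /eval big_map mulr_sumr; apply: eq_bigr => e _; rewrite /eval1/= mulrCA. Qed.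

(** A step that begins after [r] becomes a zero step on the empty interval ]r, r] instead of being
    removed, so the list keeps its shape and identities are checked step by step. *)
Definition eclip r l : seq estep :=
  [seq if e.1.2 <= r then (e.1.1, e.1.2, Num.min r e.2) else (fun=> 0, r, r) | e <- l].

Lemma evalids_clip s t r l : s <= r -> evalids s t l -> evalids s r (eclip r l).
Proof.
move=> sr; elim: l => //= e l ih [[sp pq qt mz bz] vl]; split; last exact: ih.
case: ifP => h; split => //=.
- by rewrite le_min h.
- by rewrite ge_min lexx.
- exact: measurable_cst.
- by exists 0 => om; rewrite normr0.
Qed.

Lemma eval_clip r l x : eval (eclip r l) x = (x.1 <= r)%R%:R * eval l x.
Proof.
rewrite /eval big_map mulr_sumr; apply: eq_bigr => e _; rewrite /eval1.
case: ifPn => h /=; rewrite !indicE !mem_setE !in_itv/= ?le_min mulrA -natrM mulnb.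
  by rewrite andbA [_ && (x.1 <= r)]andbC -andbA.
rewrite mulr0 (_ : _ && _ = false) ?mul0r//.
apply/negbTE; rewrite -ltNge in h; rewrite !negb_and -!ltNge -leNgt.
case: (ltP r x.1) => //= ?; rewrite (_ : x.1 <= e.1.2)//; lra.
Qed.

(** Increments after [r] are centred and independent of [F r], so they pair to 0 with [z]: clipping
    is conditional expectation given [F r]. *)
Lemma ip_eint_clip s t r l z : 0 <= s -> s <= r -> r <= t -> t <= T -> Fm r z ->
  sqint P z -> evalids s t l -> ip P z (eint l) = ip P z (eint (eclip r l)).
Proof.
move=> s0 sr rt tT mz sz; elim: l => [_|e l ih /= [ve vl]]; first by [].
have rT : r <= T by lra.
have := evalids_clip (t := t) (l := e :: l) sr (conj ve vl) => -[ve2 vl2].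
rewrite !eint_cons !ipDr ?ih//; last 4 first.
- exact: sqint_eint1 ve2.
- exact: sqint_eint vl2.
- exact: sqint_eint1 ve.
- exact: sqint_eint vl.
congr (_ + _); have [sp pq qt mz' bz'] := ve.
have mz1 : measurable_fun setT e.1.1 by apply: (Fm_measurable w_bm _ mz'); lra.
have zl : sqint P (fun x => z x * e.1.1 x).
  have [K zK] := bz'; under eq_fun do rewrite mulrC; exact: sqint_mull zK sz.
case: ifPn => h; last first.
  rewrite -ltNge in h.
  rewrite (_ : eint1 (fun=> 0, r, r) = fun=> 0); last by apply/funext => om; rewrite /eint1/= mul0r.
  rewrite [RHS]ipC ip0l /ip; under eq_Rintegral do rewrite mulrA.
  apply: E_dw; try lra; last exact: sqint_integrable.
  by apply: FmM => //; apply: Fm_le mz; lra.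
case: (leP r e.2) => re.
  rewrite (_ : eint1 e = fun x => eint1 (e.1.1, e.1.2, r) x + eint1 (e.1.1, r, e.2) x); last first.
    by apply/funext => x; rewrite /eint1/= (dwD e.1.2 r e.2) mulrDr.
  rewrite ipDr//; last 2 first.
  - by apply: (sqint_eint1 (s := s) (t := t)) => //; split => //=.
  - by apply: (sqint_eint1 (s := s) (t := t)) => //; split => //=; exact: Fm_le mz'.
  rewrite [X in _ + X](_ : _ = 0) ?addr0// /ip /eint1/=; under eq_Rintegral do rewrite mulrA.
  apply: E_dw; try lra; last exact: sqint_integrable.
  by apply: FmM => //; exact: Fm_le mz'.
by rewrite /eint1/=.
Qed.

End elementary_integrals.

(** * Ito integrals as limits of elementary integrals *)

Section ito_integrals.
Context (R : realType) (d : measure_display) (Om : measurableType d).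
Context (P : probability Om R) (T : R) (w : R -> Om -> R).
Hypothesis w_bm : brownian_motion P T w.
Notation F := (augmented_filtration P w).
Notation mu := (@lebesgue_measure R).
Notation M := (mu \x P)%E.
Notation Fm := (Fm P w).
Notation dw := (increment w).
Notation evalids := (evalids P w).
Notation eint := (eint w).

(** Processes are extended by 0 to the whole time line, so that integrals over different time
    intervals are inner products for the single measure [M]. *)
Definition cut s t (f : R -> Om -> R) (x : R * Om) : R := \1_`[s, t] x.1 * f x.1 x.2.

(** The working form of [ito_integral]: the iterated integral becomes one over [M], and subdivisions
    give way to arbitrary lists of steps, for which linear combinations are concatenations. *)
Definition ito s t (f : R -> Om -> R) (J : Om -> R) :=
  [/\ sqint P J, sqint M (cut s t f) & exists l : nat -> seq (@estep R d Om),
     [/\ forall k, evalids s t (l k),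
         L2cvg M (fun k => eval (l k)) (cut s t f) &
         L2cvg P (fun k => eint (l k)) J]].

Lemma cut_lin s t f g c x :
  cut s t (fun r om => f r om + c * g r om) x = cut s t f x + c * cut s t g x.
Proof. by rewrite /cut; ring. Qed.

Lemma cut_sub s t r f x : r <= t -> cut s r f x = (x.1 <= r)%R%:R * cut s t f x.
Proof.
move=> rt; rewrite /cut !indicE !mem_setE !in_itv/= mulrA -natrM mulnb.
congr (_%:R * _); congr nat_of_bool.
case: (leP x.1 r) => h /=; last by rewrite andbF.
by rewrite (le_trans h rt).
Qed.

Lemma ito_lin s t f g J K c : 0 <= s -> t <= T -> ito s t f J -> ito s t g K ->
  ito s t (fun r om => f r om + c * g r om) (fun om => J om + c * K om).
Proof.
move=> s0 tT [sJ sf [l [vl cl cJ]]] [sK sg [l' [vl' cl' cK]]]; split.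
- by apply: sqintD => //; exact: sqintZ.
- rewrite (_ : cut _ _ _ = fun x => cut s t f x + c * cut s t g x).
    by apply: sqintD => //; exact: sqintZ.
  by apply/funext => x; rewrite cut_lin.
exists (fun k => l k ++ escale c (l' k)); split.
- by move=> k; apply: evalids_cat => //; exact: evalids_scale.
- rewrite (_ : cut _ _ _ = fun x => cut s t f x + c * cut s t g x); last first.
    by apply/funext => x; rewrite cut_lin.
  rewrite (_ : (fun k => _) = (fun k x => eval (l k) x + c * eval (l' k) x)); last first.
    by apply/funext => k; apply/funext => x; rewrite eval_cat eval_scale.
  apply: L2cvg_lin => // k; first exact: (sqint_eval w_bm tT (vl _)).
  exact: (sqint_eval w_bm tT (vl' _)).
- rewrite (_ : (fun k => _) = (fun k x => eint (l k) x + c * eint (l' k) x)); last first.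
    by apply/funext => k; apply/funext => x; rewrite eint_cat eint_scale.
  apply: L2cvg_lin => // k.
    exact: (sqint_eint w_bm s0 tT (vl _)).
  exact: (sqint_eint w_bm s0 tT (vl' _)).
Qed.

Lemma ito_isometry s t f J : 0 <= s -> t <= T -> ito s t f J ->
  ip P J J = ip M (cut s t f) (cut s t f).
Proof.
move=> s0 tT [sJ sf [l [vl cl cJ]]].
have sl k := sqint_eval w_bm tT (vl k).
have sI k := sqint_eint w_bm s0 tT (vl k).
have c1 := L2cvg_ip2 sI sI sJ sJ cJ cJ.
have c2 := L2cvg_ip2 sl sl sf sf cl cl.
apply: (cvg_unique (@norm_hausdorff _ R^o) c1).
apply: cvg_trans c2; apply: near_eq_cvg; apply: nearW => k.
by rewrite (ip_eint w_bm s0 tT s0 tT (vl k) (vl k)).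
Qed.

(** The steps approximating [J], clipped at [r], need not be those given for [J']. Both approximate
    the same integrand on [s, r], so by the isometry their integrals have the same limit, and
    [ip_eint_clip] passes to the limit. *)
Lemma ito_martingale s r t f J J' z : 0 <= s -> s <= r -> r <= t -> t <= T ->
  ito s t f J -> ito s r f J' -> Fm r z -> sqint P z -> ip P z J = ip P z J'.
Proof.
move=> s0 sr rt tT [sJ sf [l [vl cl cJ]]] [sJ' sf' [l' [vl' cl' cJ']]] mz sz.
have rT : r <= T by lra.
have vc k := evalids_clip sr (vl k).
have sl k := sqint_eval w_bm tT (vl k).
have sl' k := sqint_eval w_bm rT (vl' k).
have slc k := sqint_eval w_bm rT (vc k).
have sI k := sqint_eint w_bm s0 tT (vl k).
have sI' k := sqint_eint w_bm s0 rT (vl' k).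
have sIc k := sqint_eint w_bm s0 rT (vc k).
have cc : L2cvg M (fun k => eval (eclip r (l k))) (cut s r f).
  apply: (cvg0_le _ cl) => k; rewrite ip_ge0/=.
  have s1 : sqint M (fun x => eval (eclip r (l k)) x - cut s r f x) by exact: sqintB.
  have s2 : sqint M (fun x => eval (l k) x - cut s t f x) by exact: sqintB.
  apply: ip_le => // x; rewrite eval_clip (cut_sub s f x rt) -mulrBr.
  case: (x.1 <= r) => /=; rewrite ?mul1r// !mul0r -expr2; exact: sqr_ge0.
have ccJ : L2cvg P (fun k => eint (eclip r (l k))) J'.
  apply: (L2cvg_sub sI' sIc sJ' cJ').
  have -> : (fun n => ip P (fun x => eint (l' n) x - eint (eclip r (l n)) x)
      (fun x => eint (l' n) x - eint (eclip r (l n)) x)) =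
    (fun n => ip M (eval (l' n)) (eval (l' n)) - 2 * ip M (eval (l' n)) (eval (eclip r (l n))) +
       ip M (eval (eclip r (l n))) (eval (eclip r (l n)))).
    apply/funext => n; rewrite ipBl ?ipBr//; last exact: sqintB.
    rewrite !(ip_eint w_bm s0 rT s0 rT)//; rewrite (ipC M (eval (eclip _ _)) (eval (l' _))); ring.
  rewrite -[X in _ --> X](_ : ip M (cut s r f) (cut s r f) - 2 * ip M (cut s r f) (cut s r f) + ip M (cut s r f) (cut s r f) = _); last by ring.
  apply: cvgD; last exact: L2cvg_ip2.
  apply: cvgB; first exact: L2cvg_ip2.
  by apply: cvgMl_tmp; exact: L2cvg_ip2.
have c1 := L2cvg_ip sI sJ sz cJ.
have c2 := L2cvg_ip sIc sJ' sz ccJ.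
rewrite ipC [RHS]ipC; apply: (cvg_unique (@norm_hausdorff _ R^o) c1).
apply: cvg_trans c2; apply: near_eq_cvg; apply: nearW => k.
by rewrite ipC -(ip_eint_clip w_bm s0 sr rt tT mz sz (vl k)) ipC.
Qed.

Lemma progressive_measurable (X : topologicalType) (f : R -> Om -> X) t s :
  t <= s -> s <= T -> progressive F t s f ->
  forall B, <<s @open X >> B ->
  measurable ((`[t, s]%classic `*` setT) `&` (fun p : R * Om => f p.1 p.2) @^-1` B).
Proof.
move=> ts sT pf B mB.
have := pf s; rewrite ts lexx => /(_ isT B mB).
apply: smallest_sub; first exact: sigma_algebra_measurable.
move=> _ [I mI [E FE <-]]; apply: measurableX => //.
exact: augmented_filtration_measurable w_bm _ sT _ FE.
Qed.

Lemma progressive_measurable_cut (f : R -> Om -> R) t s :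
  t <= s -> s <= T -> progressive F t s f -> measurable_fun setT (cut t s f).
Proof.
move=> ts sT pf; pose D : set (R * Om) := `[t, s]%classic `*` setT.
have mD : measurable D by exact: measurableX.
have mf : measurable_fun D (fun p : R * Om => f p.1 p.2).
  move=> _ B mB; apply: progressive_measurable => //.
  by rewrite -measurable_borel.
have -> : cut t s f = (fun p : R * Om => f p.1 p.2) \_ D.
  apply/funext => p; rewrite /cut patchE indicE.
  have -> : (p \in D) = (p.1 \in `[t, s]%classic).
    by apply/idP/idP; rewrite !inE /D/=; [case|].
  by case: (_ \in _); rewrite ?mul1r ?mul0r.
by apply/(measurable_restrictT _ mD).
Qed.

Lemma integral_M_cut (g : R -> Om -> R) s t :
  measurable_fun setT (cut s t g) ->
  (\int[M]_x ((cut s t g x) ^+ 2)%:E =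
   \int[P]_om \int[mu]_(r in `[s, t]) ((g r om) ^+ 2)%:E)%E.
Proof.
move=> mg.
have mg2 : measurable_fun setT (fun x => ((cut s t g x) ^+ 2)%:E).
  by apply/measurable_EFinP; exact: measurable_funX.
have g2 x : (0 <= ((cut s t g x) ^+ 2)%:E)%E by rewrite lee_fin sqr_ge0.
rewrite fubini_tonelli1// fubini_tonelli//.
apply: eq_integral => om _; rewrite /fubini_F [RHS]integral_mkcond.
apply: eq_integral => r _; rewrite /cut patchE indicE/=.
by case: (_ \in _); rewrite ?mul1r// mul0r expr0n.
Qed.

(** Square integrability of the limit is not assumed: the integrals are eventually finite, and then
    [g] is [G n] minus a square-integrable difference. *)
Lemma cvge0_L2cvg d' (S : measurableType d') (m : {measure set S -> \bar R})
    (G : nat -> S -> R) (g : S -> R) : (forall n, sqint m (G n)) -> measurable_fun setT g ->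
  (fun n => \int[m]_x ((G n x - g x) ^+ 2)%:E)%E @ \oo --> 0%E ->
  sqint m g /\ L2cvg m G g.
Proof.
move=> sG mg cv.
have mB n : measurable_fun setT (fun x => G n x - g x).
  by apply: measurable_funB => //; case: (sG n).
have /fine_cvgP[fin cv'] := cv.
have [n _ /(_ n (leqnn n)) Hn] := fin.
have sB : sqint m (fun x => G n x - g x).
  by split => //; rewrite -ge0_fin_numE//; apply: integral_ge0 => x _; rewrite lee_fin sqr_ge0.
have sg : sqint m g.
  have := sqintB (sG n) sB; congr sqint; apply/funext => x; ring.
by split.
Qed.

Lemma ito_integral_ito s t f J : 0 <= s -> s <= t -> t <= T ->
  ito_integral P w F s t f J -> ito s t f J.
Proof.
move=> s0 st tT [pf mJ [n [p [xi [sp cM cP]]]]].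
pose l k : seq (@estep R d Om) := [seq (xi k i, p k i, p k i.+1) | i <- iota 0 (n k)].
have vl k : evalids s t (l k).
  have [p0 pn pm mx bx] := sp k.
  have lep i : (i <= n k)%N -> s <= p k i /\ p k i <= t.
    move=> ik; split.
      elim: i ik => [_|i ih ik]; first by rewrite p0.
      by apply: le_trans (ih (ltnW ik)) (pm _ ik).
    have mono m : (i + m <= n k)%N -> p k i <= p k (i + m)%N.
      elim: m => [|m ih im]; first by rewrite addn0.
      rewrite addnS in im *; exact: le_trans (ih (ltnW im)) (pm _ im).
    by rewrite -pn -(subnKC ik); apply: mono; rewrite subnKC.
  rewrite /l; suff : forall m j, (j + m <= n k)%N ->
      evalids s t [seq (xi k i, p k i, p k i.+1) | i <- iota j m].
    by apply; rewrite add0n.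
  elim => [//|m ih] j jm /=; split; last by apply: ih; rewrite addSnnS.
  have jn : (j < n k)%N by rewrite (leq_trans _ jm)// addnS ltnS leq_addr.
  split => /=.
  - by case: (lep j (ltnW jn)).
  - exact: pm.
  - by case: (lep j.+1 jn).
  - by apply/FmP; exact: mx.
  - by have [K HK] := bx j jn; exists K.
have El k : eint (l k) = simple_integral w (n k) (p k) (xi k).
  apply/funext => om; rewrite /eint big_map /simple_integral.
  by rewrite -(big_mkord predT (fun i => xi k i om * (w (p k i.+1) om - w (p k i) om))) /index_iota subn0.
have Ev k x : eval (l k) x = simple_val (n k) (p k) (xi k) x.1 x.2.
  rewrite /eval big_map /simple_val.
  rewrite -(big_mkord predT (fun i => xi k i x.2 * \1_`]p k i, p k i.+1]%classic x.1)) /index_iota subn0.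
  by apply: eq_bigr => i _; rewrite /eval1 mulrC.
have sE k := sqint_eval w_bm tT (vl k).
have sI k := sqint_eint w_bm s0 tT (vl k).
have mf := progressive_measurable_cut st tT pf.
have [sJ cJ] : sqint P J /\ L2cvg P (fun k => eint (l k)) J.
  apply: cvge0_L2cvg => //; apply: cvg_trans cP; apply: near_eq_cvg.
  apply: nearW => k; apply: eq_integral => om _; rewrite El.
  by rewrite -sqrrN opprB.
(* All cells lie in ]s, t], so cutting a simple process to [s, t] does not change it. *)
have evcut k x : eval (l k) x = cut s t (simple_val (n k) (p k) (xi k)) x.
  rewrite /cut -Ev indicE; case: (boolP (_ \in _)) => [|h]; rewrite ?mul1r// mul0r.
  move: (vl k); rewrite /eval; elim: (l k) => [|e l' ih /= [ve vl']]; first by rewrite big_nil.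
  rewrite big_cons ih// addr0 /eval1 indicE.
  rewrite (_ : (_ \in _) = false) ?mul0r//; apply: contraNF h.
  have [h1 h2 h3 _ _] := ve; rewrite !inE/= !in_itv/= => /andP[a b].
  by rewrite (le_trans h1 (ltW a)) (le_trans b h3).
have [sf cf] : sqint M (cut s t f) /\ L2cvg M (fun k => eval (l k)) (cut s t f).
  apply: cvge0_L2cvg => //; apply: cvg_trans cM; apply: near_eq_cvg.
  apply: nearW => k.
  rewrite -(@integral_M_cut (fun r om => f r om - simple_val (n k) (p k) (xi k) r om)).
    apply: eq_integral => x _; rewrite evcut /cut; congr EFin; ring.
  rewrite (_ : cut _ _ _ = fun x => cut s t f x - eval (l k) x); last first.
    by apply/funext => x; rewrite evcut /cut; ring.
  by apply: measurable_funB => //; case: (sE k).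
by split => //; exists l.
Qed.

End ito_integrals.

(** * Time integrals and the product formula *)

Section product_sigma_finite.
Context d1 d2 (T1 : measurableType d1) (T2 : measurableType d2) (R : realType).
Context (m1 : {sigma_finite_measure set T1 -> \bar R}).
Context (m2 : {sigma_finite_measure set T2 -> \bar R}).

Lemma sigma_finite_prod : sigma_finite setT (m1 \x m2)%E.
Proof.
have /sigma_finiteP[F [UF ndF Ffin]] := sigma_finiteT m1.
have /sigma_finiteP[G [UG ndG Gfin]] := sigma_finiteT m2.
exists (fun n => F n `*` G n) => [|n]; last first.
  have [mF F_lty] := Ffin n; have [mG G_lty] := Gfin n.
  split; first exact: measurableX.
  by rewrite product_measure1E// lte_mul_pinfty// ge0_fin_numE.
apply/esym/seteqP; split => // -[x y] _.
have [i _ Fx] : (\bigcup_n F n) x by rewrite -UF.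
have [k _ Gy] : (\bigcup_n G n) y by rewrite -UG.
exists (maxn i k) => //; split => /=.
- exact: (subsetPset _ _ (ndF _ _ (leq_maxl i k))).
- exact: (subsetPset _ _ (ndG _ _ (leq_maxr i k))).
Qed.

(* The canonical sigma-finite structure on a product measure is the one of
   products of probabilities, hence this explicit one. *)
Definition product_sfmeasure : SigmaFiniteMeasure.type _ _ := HB.pack (m1 \x m2)%E
  (@Measure_isSigmaFinite.Build _ _ _ (m1 \x m2)%E sigma_finite_prod).

End product_sigma_finite.

Lemma integrable_indicM d (S : measurableType d) (R : realType)
    (m : {measure set S -> \bar R}) (A : set S) (f : S -> R) : measurable A ->
  m.-integrable setT (EFin \o f) -> m.-integrable setT (EFin \o fun x => \1_A x * f x).
Proof.
move=> mA ic; apply: (le_integrable measurableT _ _ ic).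
  apply/measurable_EFinP; apply: measurable_funM; first exact: measurable_indic.
  by apply/measurable_EFinP; exact: measurable_int ic.
move=> x _ /=; rewrite lee_fin normrM ler_piMl// indicE.
by case: (_ \in _); rewrite ?normr1 ?normr0.
Qed.

Lemma Rintegral_ae d (S : measurableType d) (R : realType)
    (m : {measure set S -> \bar R}) (f g : S -> R) :
  m.-integrable setT (EFin \o f) -> m.-integrable setT (EFin \o g) ->
  {ae m, forall x, f x = g x} -> \int[m]_x f x = \int[m]_x g x.
Proof.
move=> jf jg fg; congr fine; apply: ae_eq_integral => //.
- exact: measurable_int jf.
- exact: measurable_int jg.
- by apply: filterS fg => x /= ->.
Qed.

Section symmetric_kernels.
Context d1 (S : measurableType d1) d (Om : measurableType d) (R : realType).
Context (m : {sigma_finite_measure set S -> \bar R}).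
Context (P : {sigma_finite_measure set Om -> \bar R}).

(** For fixed [om] the absolute integral of h(r) h(q) over both times is the square of the integral
    of |h|, whose expectation is finite by hypothesis; Tonelli on the triple product then gives
    integrability. *)
Lemma integrable_kernel (h : S * Om -> R) : sqint (m \x P)%E h ->
  sqint P (fun om => \int[m]_r `|h (r, om)|) ->
  {ae P, forall om, m.-integrable setT (EFin \o fun r => h (r, om))} ->
  (m \x m)%E.-integrable setT
    (EFin \o fun x => ip P (fun om => h (x.1, om)) (fun om => h (x.2, om))).
Proof.
move=> sh sI ih.
pose k3 (x : (S * S) * Om) := h (x.1.1, x.2) * h (x.1.2, x.2).
have mk3 : measurable_fun setT k3.
  apply: measurable_funM; apply: (measurableT_comp sh.1); apply: measurable_fun_pair => //.
    exact: measurableT_comp measurable_fst measurable_fst.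
  exact: measurableT_comp measurable_snd measurable_fst.
pose mm := product_sfmeasure m m.
suff ik3 : (mm \x P)%E.-integrable setT (EFin \o k3).
  exact: (@integrable_Rfubini1 _ _ _ _ R mm P k3 ik3).
apply/(@integrable21ltyP _ _ _ _ R mm P); first exact/measurable_EFinP.
apply: le_lt_trans sI.2; apply: ae_ge0_le_integral => //.
- by move=> x _; apply: integral_ge0.
- apply: (@measurable_fun_fubini_tonelli_G _ _ _ _ R mm (fun x => `|(EFin \o k3) x|)%E) => //.
  by apply: measurableT_comp => //; exact/measurable_EFinP.
- by move=> x _; rewrite lee_fin sqr_ge0.
- by apply/measurable_EFinP; apply: measurable_funX; case: sI.
apply: filterS ih => om io _.
have io' : m.-integrable setT (EFin \o fun r => `|h (r, om)|) by exact: (integrable_norm io).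
have := Rintegral_tensor io' io'; rewrite -expr2 => <-.
rewrite /Rintegral fineK; last first.
  by apply: integrable_fin_num => //; exact: (integrable_tensor io' io').
rewrite le_eqVlt; apply/orP; left; apply/eqP; apply: eq_integral => x _ /=.
by rewrite /k3 normrM.
Qed.

Lemma integrable_half_kernel (c : S -> S -> R) (A : set (S * S)) :
  (m \x m)%E.-integrable setT (EFin \o fun x => c x.1 x.2) -> measurable A ->
  m.-integrable setT (EFin \o fun r => \int[m]_q (\1_A (r, q) * c r q)).
Proof. by move=> ic mA; exact: (integrable_Rfubini1 (integrable_indicM mA ic)). Qed.

(** [A] and its transpose cover the square and overlap in a null set, and a symmetric kernel has the
    same integral over both. *)
Lemma symmetric_kernel (c : S -> S -> R) (A : set (S * S)) :
  (m \x m)%E.-integrable setT (EFin \o fun x => c x.1 x.2) ->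
  (forall r q, c r q = c q r) -> measurable A ->
  (forall r q, A (r, q) \/ A (q, r)) ->
  (forall r, m.-negligible [set q | A (r, q) /\ A (q, r)]) ->
  \int[m]_r \int[m]_q c r q = 2 * \int[m]_r \int[m]_q (\1_A (r, q) * c r q).
Proof.
move=> ic csym mA Atot Adiag.
have mc : measurable_fun setT (fun x : S * S => c x.1 x.2).
  by apply/measurable_EFinP; exact: measurable_int ic.
have mA1 : measurable_fun setT (fun x : S * S => \1_A x : R) by exact: measurable_indic.
have mAc : measurable_fun setT (fun x : S * S => \1_A x * c x.1 x.2) by exact: measurable_funM.
have icL := integrable_indicM mA ic.
have icR : (m \x m)%E.-integrable setT (EFin \o fun x => c x.1 x.2 - \1_A x * c x.1 x.2).
  exact: (integrableB measurableT ic icL).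
(* Up to the null overlap, the complement of [A] is its transpose. *)
have E : \int[m]_q \int[m]_r (\1_A (q, r) * c q r) =
   \int[(m \x m)%E]_x (c x.1 x.2 - \1_A x * c x.1 x.2).
  rewrite (Rintegral_fubini2 icR); apply: eq_Rintegral => q _.
  congr fine; apply: ae_eq_integral => //.
  - apply/measurable_EFinP.
    exact: (measurableT_comp mAc (measurable_pair1 q)).
  - apply/measurable_EFinP.
    by apply: (measurableT_comp (measurable_funB mc mAc) (measurable_pair2 q)).
  apply: negligibleS (Adiag q) => r /=; apply: contra_notP => nA _.
  congr EFin; rewrite (csym q r) !indicE.
  case: (Atot q r) => h.
    have h' : ~ A (r, q) by move=> h2; apply: nA.
    by rewrite (mem_set h) (memNset h') mul0r subr0 mul1r.
  have h' : ~ A (q, r) by move=> h2; apply: nA.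
  by rewrite (mem_set h) (memNset h') mul0r mul1r subrr.
have E1 : \int[m]_r \int[m]_q c r q = \int[(m \x m)%E]_x c x.1 x.2.
  by rewrite (Rintegral_fubini1 ic).
have E2 : \int[m]_r \int[m]_q (\1_A (r, q) * c r q) = \int[(m \x m)%E]_x (\1_A x * c x.1 x.2).
  by rewrite (Rintegral_fubini1 icL).
rewrite E1 mulr_natl mulr2n {1}E2 E -RintegralD//.
by apply: eq_Rintegral => x _; ring.
Qed.

End symmetric_kernels.

Section time_integrals.
Context (R : realType) (d : measure_display) (Om : measurableType d).
Context (P : probability Om R).
Notation mu := (@lebesgue_measure R).
Notation M := (mu \x P)%E.
Implicit Types (f g : R -> Om -> R) (z : Om -> R) (s t : R).

Definition tint s t g om : R := \int[mu]_(r in `[s, t]) g r om.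

Lemma tintE s t g om : tint s t g om = \int[mu]_r cut s t g (r, om).
Proof.
rewrite /tint Rintegral_mkcond; apply: eq_Rintegral => r _.
by rewrite patchE /cut indicE/=; case: (_ \in _); rewrite ?mul1r ?mul0r.
Qed.

Lemma indicM (T : Type) (A : set T) (x : T) : \1_A x * \1_A x = \1_A x :> R.
Proof. by rewrite indicE; case: (_ \in _); rewrite ?mulr1 ?mulr0. Qed.

Lemma cutM s t f g x : cut s t f x * cut s t g x = cut s t (fun r om => f r om * g r om) x.
Proof. by rewrite /cut mulrACA indicM. Qed.

Lemma sqint_indic s t : sqint mu \1_`[s, t].
Proof. exact: (@sqint_indic_itv R `[s, t] s t). Qed.

Lemma sqint_cst s t z : sqint P z -> sqint M (cut s t (fun=> z)).
Proof. by move=> sz; apply: sqint_tensor => //; exact: sqint_indic. Qed.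

Lemma sqint_slice1 (h : R * Om -> R) : sqint M h -> {ae mu, forall r, sqint P (fun om => h (r, om))}.
Proof.
move=> sh; apply: filterS (ae_integrable1 (sqint_integrable2 sh)) => r ir; split.
  exact: measurableT_comp sh.1 (measurable_pair1 r).
move/integrableP : ir => [_].
by congr (_ < _)%E; apply: eq_integral => om _ /=; rewrite ger0_norm ?sqr_ge0.
Qed.

Lemma sqint_slice2 (h : R * Om -> R) : sqint M h -> {ae P, forall om, sqint mu (fun r => h (r, om))}.
Proof.
move=> sh; apply: filterS (ae_integrable2 (sqint_integrable2 sh)) => r ir; split.
  exact: measurableT_comp sh.1 (measurable_pair2 r).
move/integrableP : ir => [_].
by congr (_ < _)%E; apply: eq_integral => om _ /=; rewrite ger0_norm ?sqr_ge0.
Qed.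

Lemma ip_slices (f g : R * Om -> R) : sqint M f -> sqint M g ->
  ip M f g = \int[mu]_r ip P (fun om => f (r, om)) (fun om => g (r, om)).
Proof. by move=> sf sg; exact: (Rintegral_fubini1 (sqint_integrableM sf sg)). Qed.

Lemma integrable_slices (f g : R * Om -> R) : sqint M f -> sqint M g ->
  mu.-integrable setT (EFin \o fun r => ip P (fun om => f (r, om)) (fun om => g (r, om))).
Proof. by move=> sf sg; exact: (integrable_Rfubini1 (sqint_integrableM sf sg)). Qed.

Lemma ip_slice_cut s t f z r :
  ip P (fun om => cut s t f (r, om)) z = \1_`[s, t] r * ip P (f r) z.
Proof.
rewrite /cut/= indicE; case: (_ \in _) => /=.
  by rewrite mul1r; congr ip; apply/funext => om; rewrite mul1r.
rewrite mul0r -(ip0l P z); congr ip; apply/funext => om; by rewrite mul0r.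
Qed.

Lemma integrable_cut s t g : sqint M (cut s t g) -> M.-integrable setT (EFin \o cut s t g).
Proof.
move=> sg; have := sqint_integrableM (sqint_cst s t (sqint1 P)) sg.
apply: eq_integrable => // x _ /=; congr EFin.
by rewrite cutM; congr cut; apply/funext => r; apply/funext => om; rewrite mul1r.
Qed.

Lemma measurable_tint s t g : sqint M (cut s t g) -> measurable_fun setT (tint s t g).
Proof.
move=> sg; have := measurable_int _ (integrable_Rfubini2 (integrable_cut sg)).
move/measurable_EFinP; apply: eq_measurable_fun => om _ /=.
by rewrite tintE.
Qed.

(** Cauchy-Schwarz in time, against the indicator of [s, t]: the squared time integral is at most t
    - s times the time integral of the square. *)
Lemma sqint_tint s t g : s <= t -> sqint M (cut s t g) -> sqint P (tint s t g).
Proof.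
move=> st sg; have mI := measurable_tint sg; split => //.
have i2 := integrable_Rfubini2 (sqint_integrable2 sg).
have B : {ae P, forall om, (tint s t g om) ^+ 2 <= (t - s) * \int[mu]_r (cut s t g (r, om) ^+ 2)}.
  apply: filterS (sqint_slice2 sg) => om som.
  have -> : tint s t g om = ip mu \1_`[s, t] (fun r => cut s t g (r, om)).
    by rewrite tintE; apply: eq_Rintegral => r _; rewrite /cut/= mulrA indicM.
  apply: le_trans (ip_CS (sqint_indic s t) som) _.
  rewrite ler_wpM2r ?ip_ge0//.
  rewrite /ip; under eq_Rintegral do rewrite indicM.
  rewrite /Rintegral integral_indic// setIT.
  apply: (@le_trans _ _ (fine (mu [set` `[s, t]%R]))) => //.
  by rewrite lebesgue_measure_itv/= lte_fin; case: ifP => _; rewrite /= ?subr_ge0.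
have : P.-integrable setT (EFin \o fun om => (t - s) * \int[mu]_r (cut s t g (r, om) ^+ 2)).
  exact: (integrableZl measurableT (t - s) i2).
move/integrableP => [mi]; apply: le_lt_trans.
apply: ae_ge0_le_integral => //.
- by move=> x _; rewrite lee_fin sqr_ge0.
- by apply/measurable_EFinP; exact: measurable_funX.
- exact: measurableT_comp.
- apply: filterS B => om B _; rewrite lee_fin.
  by apply: le_trans B _; exact: ler_norm.
Qed.

Lemma sqint_cut_sub s r t g : r <= t -> sqint M (cut s t g) -> sqint M (cut s r g).
Proof.
move=> rt sg; have -> : cut s r g = fun x => \1_`]-oo, r] x.1 * cut s t g x.
  apply/funext => x; rewrite (cut_sub s g x rt) indicE; congr (_%:R * _).
  by rewrite mem_setE in_itv.
apply: (@sqint_mull _ _ _ _ _ _ 1 _ _ sg).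
  by apply: (measurableT_comp (f := \1_`]-oo, r] : R -> R)) => //; exact: measurable_indic.
by move=> x; rewrite indicE; case: (_ \in _); rewrite ?normr1 ?normr0.
Qed.

Lemma ip_tint s t g z : s <= t -> sqint M (cut s t g) -> sqint P z ->
  ip P z (tint s t g) = ip M (cut s t (fun=> z)) (cut s t g).
Proof.
move=> st sg sz.
rewrite [RHS](Rintegral_fubini2 (sqint_integrableM (sqint_cst s t sz) sg)).
congr fine; apply: ae_eq_integral => //.
- exact: measurable_int (sqint_integrableM sz (sqint_tint st sg)).
- exact: measurable_int (integrable_Rfubini2 (sqint_integrableM (sqint_cst s t sz) sg)).
apply: filterS (sqint_slice2 sg) => om som _; congr EFin.
rewrite tintE -RintegralZl//.
  by apply: eq_Rintegral => r _; rewrite /cut/= mulrACA indicM mulrCA.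
have := sqint_integrableM (sqint_indic s t) som.
by apply: eq_integrable => // r _ /=; rewrite /cut/= mulrA indicM.
Qed.

Lemma ip_tint_slices s t g z : s <= t -> sqint M (cut s t g) -> sqint P z ->
  ip P z (tint s t g) = \int[mu]_r (\1_`[s, t] r * ip P z (g r)).
Proof.
move=> st sg sz; rewrite ip_tint// ip_slices//; last exact: sqint_cst.
apply: eq_Rintegral => r _; rewrite ip_slice_cut ipC ip_slice_cut ipC.
by rewrite mulrA indicM.
Qed.

Section kernel.
Variables (s t : R) (g : R -> Om -> R) (st : s <= t) (sg : sqint M (cut s t g)).

Let c r q := ip P (fun om => cut s t g (r, om)) (fun om => cut s t g (q, om)).

Let ic : (mu \x mu)%E.-integrable setT (EFin \o fun x => c x.1 x.2).
Proof.
have sg' : sqint M (cut s t (fun r om => `|g r om|)).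
  have -> : cut s t (fun r om => `|g r om|) = fun x => `|cut s t g x|.
    by apply/funext => x; rewrite /cut normrM (ger0_norm (_ : 0 <= \1_`[s, t] x.1)).
  apply: (sqint_le _ _ sg).
    by apply: measurableT_comp => //; case: sg.
  by move=> x; rewrite normr_id.
apply: integrable_kernel => //.
  have := sqint_tint st sg'; congr sqint; apply/funext => om.
  rewrite tintE; apply: eq_Rintegral => r _.
  by rewrite /cut/= normrM (ger0_norm (_ : 0 <= \1_`[s, t] r)).
apply: filterS (sqint_slice2 sg) => om som.
have := sqint_integrableM (sqint_indic s t) som.
by apply: eq_integrable => // r _ /=; rewrite /cut/= mulrA indicM.
Qed.

Let mA : measurable [set x : R * R | x.2 <= x.1].
Proof.
have := @measurable_fun_ler _ (R * R)%type R setT snd fst measurable_snd measurable_fst.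
by move=> /(_ measurableT [set true] I); rewrite setTI.
Qed.

Lemma integrable_kernel_full : mu.-integrable setT (EFin \o fun r => \int[mu]_q c r q).
Proof. exact: (integrable_Rfubini1 ic). Qed.

Lemma integrable_kernel_half :
  mu.-integrable setT (EFin \o fun r => \int[mu]_q ((q <= r)%R%:R * c r q)).
Proof.
have := @integrable_half_kernel _ _ _ mu c _ ic mA.
apply: eq_integrable => // r _; congr EFin; apply: eq_Rintegral => q _.
by rewrite indicE mem_setE.
Qed.

Lemma kernel_symmetry :
  \int[mu]_r \int[mu]_q c r q = 2 * \int[mu]_r \int[mu]_q ((q <= r)%R%:R * c r q).
Proof.
have csym r q : c r q = c q r by exact: ipC.
have := @symmetric_kernel _ _ _ mu c _ ic csym mA.
move=> H; rewrite H.
- congr (2 * _); apply: eq_Rintegral => r _; apply: eq_Rintegral => q _.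
  by rewrite indicE mem_setE.
- by move=> r q /=; apply/orP; exact: le_total.
- move=> r; exists [set r]; split; [exact: measurable_set1|exact: lebesgue_measure_set1|].
  by move=> q /= [h1 h2]; apply/eqP; rewrite eq_le h1 h2.
Qed.

End kernel.

End time_integrals.

Section product_formula.
Context (R : realType) (d : measure_display) (Om : measurableType d).
Context (P : probability Om R) (T : R) (w : R -> Om -> R).
Hypothesis w_bm : brownian_motion P T w.
Notation mu := (@lebesgue_measure R).
Notation M := (mu \x P)%E.
Notation Fm := (Fm P w).

Lemma sqint_ae (f : R -> Om -> R) s t : sqint M (cut s t f) ->
  {ae mu, forall r, s <= r <= t -> sqint P (f r)}.
Proof.
move=> sf; apply: ae_mono (sqint_slice1 sf) => r sr srt.
move: sr; congr sqint; apply/funext => om.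
by rewrite /cut indicE mem_set ?mul1r//= in_itv.
Qed.

Lemma ip_slice_cst s t (f : R -> Om -> R) z r :
  ip P (fun om => cut s t f (r, om)) (fun om => cut s t (fun=> z) (r, om)) =
  ip P (fun om => cut s t f (r, om)) z.
Proof.
by rewrite !ip_slice_cut (ipC P (f r) (fun om => _)) ip_slice_cut (ipC P z) mulrA indicM.
Qed.

(* Integrating [E ((alpha r) (xi s))] over r, the martingale property reduces
   it to [E ((alpha r) (xi r))] up to [E ((alpha r) (\int_r^s alpha))], and the
   kernel [E ((alpha r) (alpha q))] is symmetric. *)
Lemma ito_product_formula (t0 s : R) (xi alpha beta : R -> Om -> R) :
  0 <= t0 -> t0 <= s -> s <= T ->
  (forall r, t0 <= r <= s -> sqint P (xi r)) ->
  (forall r, t0 <= r <= s -> exists2 J, ito P w t0 r beta J &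
     {ae P, forall om, xi r om = tint t0 r alpha om + J om}) ->
  sqint M (cut t0 s xi) -> sqint M (cut t0 s alpha) ->
  (forall r, t0 <= r <= s -> Fm r (alpha r)) ->
  ip P (xi s) (xi s) =
  2 * ip M (cut t0 s alpha) (cut t0 s xi) + ip M (cut t0 s beta) (cut t0 s beta).
Proof.
move=> t00 t0s sT sxi eqn sX sA mA.
have [J itoJ eqs] := eqn s (ltac:(by rewrite t0s lexx)).
have sJ : sqint P J by case: itoJ.
have sa : sqint P (tint t0 s alpha) := sqint_tint t0s sA.
have saJ : sqint P (fun om => tint t0 s alpha om + J om) := sqintD sa sJ.
have sxs : sqint P (xi s) by apply: sxi; rewrite t0s lexx.
rewrite (@ip_ae _ _ _ P _ _ (fun om => tint t0 s alpha om + J om) (fun om => tint t0 s alpha om + J om))//; last first.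
  by apply: filterS eqs => om ->.
rewrite !(ipDl, ipDr)// (ito_isometry w_bm t00 sT itoJ) (ipC P J).
pose c r q := ip P (fun om => cut t0 s alpha (r, om)) (fun om => cut t0 s alpha (q, om)).
have cE r f : t0 <= r <= s -> (fun om => cut t0 s f (r, om)) = f r.
  by move=> rs; apply/funext => om; rewrite /cut indicE mem_set ?mul1r//= in_itv.
have c0 r f : ~~ (t0 <= r <= s) -> (fun om => cut t0 s f (r, om)) = fun=> 0.
  move=> rs; apply/funext => om; rewrite /cut indicE memNset ?mul0r//= in_itv/=.
  exact/negP.
have full : {ae mu, forall r, ip P (fun om => cut t0 s alpha (r, om)) (tint t0 s alpha) = \int[mu]_q c r q}.
  apply: ae_mono (sqint_ae sA) => r sr; rewrite /c.
  have [rs|rs] := boolP (t0 <= r <= s); last first.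
    rewrite c0// ip0l; under eq_Rintegral do rewrite ip0l.
    by rewrite /Rintegral integral0.
  rewrite cE// ip_tint_slices//; last exact: sr.
  by apply: eq_Rintegral => q _; rewrite [RHS]ipC ip_slice_cut ipC.
have half : {ae mu, forall r, ip P (fun om => cut t0 s alpha (r, om)) J =
   ip P (fun om => cut t0 s alpha (r, om)) (fun om => cut t0 s xi (r, om)) -
   \int[mu]_q ((q <= r)%R%:R * c r q)}.
  apply: ae_mono (sqint_ae sA) => r sr; rewrite /c.
  have [rs|rs] := boolP (t0 <= r <= s); last first.
    rewrite c0// !ip0l; under eq_Rintegral do rewrite ip0l mulr0.
    by rewrite /Rintegral integral0 subrr.
  have {}sr : sqint P (alpha r) by exact: sr.
  have [t0r rs'] := andP rs; have rT : r <= T by lra.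
  have [Jr itoJr eqr] := eqn r rs; have sJr : sqint P Jr by case: itoJr.
  have sA' := sqint_cut_sub rs' sA.
  have sar := sqint_tint t0r sA'.
  rewrite !cE// (ito_martingale w_bm t00 t0r rs' sT itoJ itoJr (mA r rs) sr).
  have -> : ip P (alpha r) (xi r) = ip P (alpha r) (tint t0 r alpha) + ip P (alpha r) Jr.
    rewrite -ipDr//; apply: ip_ae => //; try exact: sqintD; first exact: sxi.
    by apply: filterS eqr => om ->.
  rewrite ip_tint_slices// addrAC.
  rewrite (_ : \int[mu]_q (\1_`[t0, r] q * _) = \int[mu]_q ((q <= r)%R%:R *
     ip P (alpha r) (fun om => cut t0 s alpha (q, om)))) ?subrr ?add0r//.
  apply: eq_Rintegral => q _; rewrite (ipC P _ (fun om => cut _ _ _ _)) ip_slice_cut.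
  rewrite ipC mulrA; congr (_ * _).
  rewrite !indicE !mem_setE !in_itv/= -natrM mulnb; congr (_%:R); congr nat_of_bool.
  case: (leP q r) => qr /=; last by rewrite andbF.
  by rewrite (le_trans qr rs') andbT.
have iF := integrable_kernel_full t0s sA.
have iH := integrable_kernel_half t0s sA.
have iX := integrable_slices sA sX.
have Eaa : ip P (tint t0 s alpha) (tint t0 s alpha) = \int[mu]_r \int[mu]_q c r q.
  rewrite ip_tint// ipC ip_slices//; last exact: sqint_cst.
  transitivity (\int[mu]_r ip P (fun om => cut t0 s alpha (r, om)) (tint t0 s alpha)).
    by apply: eq_Rintegral => r _; rewrite ip_slice_cst.
  apply: Rintegral_ae => //.
  have := integrable_slices sA (sqint_cst t0 s sa).
  apply: eq_integrable => // r _; congr EFin.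
  by rewrite ip_slice_cst.
have EaJ : ip P (tint t0 s alpha) J = ip M (cut t0 s alpha) (cut t0 s xi) -
    \int[mu]_r \int[mu]_q ((q <= r)%R%:R * c r q).
  rewrite ipC ip_tint// ipC ip_slices//; last exact: sqint_cst.
  rewrite ip_slices// -RintegralB//.
  transitivity (\int[mu]_r ip P (fun om => cut t0 s alpha (r, om)) J).
    by apply: eq_Rintegral => r _; rewrite ip_slice_cst.
  apply: Rintegral_ae => //; last exact: (integrableB measurableT iX iH).
  have := integrable_slices sA (sqint_cst t0 s sJ).
  apply: eq_integrable => // r _; congr EFin.
  by rewrite ip_slice_cst.
(* The square of the time integral gives the full kernel and twice the mixed term subtracts twice
   the half kernel; they cancel by symmetry. *)
rewrite Eaa EaJ (kernel_symmetry t0s sA) -/c; ring.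
Qed.

End product_formula.

(** * Orthonormal bases and smoothing in a Gelfand triple *)

Lemma mul_le_small (R : realFieldType) (g a e : R) : 0 <= g -> 0 < e ->
  a <= e / (g + 1) -> g * a <= e.
Proof.
move=> g0 e0; have g1 : 0 < g + 1 by rewrite ltr_wpDl.
rewrite ler_pdivlMr// => h.
case: (lerP 0 a) => a0; first by nra.
by rewrite (le_trans _ (ltW e0))// mulr_ge0_le0// ltW.
Qed.

Section inner_product.
Context (R : realType) (V : hilbertType R).
Implicit Types x y z : V.

Lemma innerDl x y z : inner (x + y) z = inner x z + inner y z.
Proof. by have := inner_linearl 1 x y z; rewrite scale1r mul1r. Qed.

Lemma inner0l z : inner 0 z = 0 :> R.
Proof. by have := innerDl 0 0 z; rewrite addr0 => /eqP; rewrite -subr_eq subrr => /eqP. Qed.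

Lemma innerZl c x z : inner (c *: x) z = c * inner x z.
Proof. by have := inner_linearl c x 0 z; rewrite !addr0 inner0l addr0. Qed.

Lemma innerNl x z : inner (- x) z = - inner x z.
Proof. by rewrite -scaleN1r innerZl mulN1r. Qed.

Lemma innerBl x y z : inner (x - y) z = inner x z - inner y z.
Proof. by rewrite innerDl innerNl. Qed.

Lemma innerDr x y z : inner z (x + y) = inner z x + inner z y.
Proof. by rewrite innerC innerDl (innerC x) (innerC y). Qed.

Lemma innerZr c x z : inner z (c *: x) = c * inner z x.
Proof. by rewrite innerC innerZl (innerC x). Qed.

Lemma innerBr x y z : inner z (x - y) = inner z x - inner z y.
Proof. by rewrite innerC innerBl (innerC x) (innerC y). Qed.

Lemma inner0r z : inner z 0 = 0 :> R. Proof. by rewrite innerC inner0l. Qed.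

Lemma normB_sq x y : `|x - y| ^+ 2 = `|x| ^+ 2 - 2 * inner x y + `|y| ^+ 2 :> R.
Proof. by rewrite -!inner_norm !(innerBl, innerBr) (innerC y x); ring. Qed.

Lemma normD_sq x y : `|x + y| ^+ 2 = `|x| ^+ 2 + 2 * inner x y + `|y| ^+ 2 :> R.
Proof. by rewrite -!inner_norm !(innerDl, innerDr) (innerC y x); ring. Qed.

Lemma inner_CS x y : `|inner x y| <= `|x| * `|y| :> R.
Proof.
have [->|y0] := eqVneq y 0; first by rewrite inner0r normr0 normr0 mulr0.
have yp : 0 < `|y| by rewrite normr_gt0.
have H : forall c : R, 2 * c * inner x y <= `|x| ^+ 2 + c ^+ 2 * `|y| ^+ 2.
  move=> c; have := normB_sq x (c *: y); rewrite innerZr normrZ exprMn real_normK ?num_real//.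
  by have := sqr_ge0 (`|x - c *: y| : R); lra.
suff : (inner x y) ^+ 2 <= (`|x| * `|y|) ^+ 2.
  by rewrite -(real_normK (num_real (inner x y))) ler_pXn2r ?nnegrE ?mulr_ge0.
have := H (inner x y / `|y| ^+ 2).
have -> : (inner x y / `|y| ^+ 2) ^+ 2 * `|y| ^+ 2 = (inner x y) ^+ 2 / `|y| ^+ 2.
  by field; rewrite gt_eqF.
have -> : 2 * (inner x y / `|y| ^+ 2) * inner x y = 2 * ((inner x y) ^+ 2 / `|y| ^+ 2).
  by field; rewrite gt_eqF.
move=> H2; have H3 : (inner x y) ^+ 2 / `|y| ^+ 2 <= `|x| ^+ 2 by lra.
by move: H3; rewrite ler_pdivrMr ?exprn_gt0// exprMn.
Qed.

Lemma inner_suml (I : Type) (r : seq I) (F : I -> V) z :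
  inner (\sum_(i <- r) F i) z = \sum_(i <- r) inner (F i) z.
Proof.
elim: r => [|i r ih]; first by rewrite !big_nil inner0l.
by rewrite !big_cons innerDl ih.
Qed.

Lemma inner_eq0 x : inner x x = 0 -> x = 0.
Proof. by rewrite inner_norm => /eqP; rewrite sqrf_eq0 normr_eq0 => /eqP. Qed.

Lemma cvg_of_sq_cauchy (u : nat -> V) (e : nat -> R) : e @ \oo --> (0 : R) ->
  (forall n m, (n <= m)%N -> `|u m - u n| ^+ 2 <= e n) -> cvgn u.
Proof.
move=> e0 ue; apply/cauchy_cvgP/cauchy_exP => eps eps0.
have : 0 < eps ^+ 2 by rewrite exprn_gt0.
move/cvgrPdist_lt : e0 => /[apply] -[N _ /(_ N (leqnn N))]/=.
rewrite sub0r normrN => eN; exists (u N); exists N => // m /= Nm.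
rewrite -ball_normE /ball_/= distrC.
rewrite -(ltr_pXn2r (n := 2)) ?nnegrE ?(ltW eps0)//.
by apply: le_lt_trans (ue _ _ Nm) _; apply: le_lt_trans eN; exact: ler_norm.
Qed.

End inner_product.

Section bounded_linear.
Context (R : realType) (V W : normedModType R).

Lemma continuous_linearP (f : {linear V -> W}) : continuous f ->
  exists2 K : R, 0 < K & forall x, `|f x| <= K * `|x|.
Proof.
move=> /linear_bounded_continuous/linear_boundedP fb.
have [K [K0 HK]] : exists K : R, 0 < K /\ forall x, `|f x| <= K * `|x|.
  near (pinfty_nbhs R) => K; exists K; split; first by near: K; exact: nbhs_pinfty_gt.
  by near: K.
by exists K.
Unshelve. all: by end_near. Qed.

Lemma cvg_linear (f : V -> W) K (u : nat -> V) x : linear f ->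
  (forall x, `|f x| <= K * `|x|) -> u @ \oo --> x -> (f \o u) @ \oo --> f x.
Proof.
move=> lf fK ux; apply/cvgrPdist_le => /= e e0.
have e1 : 0 < e / (`|K| + 1) by rewrite divr_gt0// ltr_wpDl.
move/cvgrPdist_le : ux => /(_ _ e1); apply: filterS => n ux.
have -> : f x - f (u n) = f (x - u n).
  by have := lf (-1) (u n) x; rewrite !scaleN1r addrC => <-; rewrite addrC.
apply: le_trans (fK _) _; apply: le_trans (mul_le_small _ e0 ux) => //.
by rewrite ler_wpM2r// ler_norm.
Qed.

End bounded_linear.

(* Vectors bounded in V and small in H are almost annihilated by any continuous
   functional: otherwise near-minimisers of the norm on the convex sets
   [|v| <= M, c <= f v, |j v| <= 1/(n+1)] form a Cauchy sequence whose limit is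
   killed by j but not by f. *)
Section weak_limit.
Context (R : realType) (V H : hilbertType R).
Variables (j : V -> H) (f : V -> R) (Kj Kf : R).
Hypothesis (jl : linear j) (jK : forall x, `|j x| <= Kj * `|x|) (j0 : forall x, j x = 0 -> x = 0).
Hypothesis (fl : linear (f : V -> R^o)) (fK : forall x, `|f x| <= Kf * `|x|).

Let fD x y : f (x + y) = f x + f y.
Proof. by have := fl 1 x y; rewrite !scale1r. Qed.
Let fZ c x : f (c *: x) = c * f x.
Proof.
have f0 : f 0 = 0 by have := fD 0 0; rewrite addr0 => /eqP; rewrite -subr_eq subrr => /eqP.
by have := fl c x 0; rewrite !addr0 f0 addr0.
Qed.
Let jD x y : j (x + y) = j x + j y.
Proof. by have := jl 1 x y; rewrite !scale1r. Qed.
Let jZ c x : j (c *: x) = c *: j x.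
Proof.
have j00 : j 0 = 0 by have := jD 0 0; rewrite addr0 => /eqP; rewrite -subr_eq subrr => /eqP.
by have := jl c x 0; rewrite !addr0 j00 addr0.
Qed.

Lemma small_on_weakly_null (M c : R) : 0 < c ->
  exists2 k : R, 0 < k & forall v, `|v| <= M -> `|j v| <= k -> `|f v| < c.
Proof.
move=> c0; apply: contrapT => nk.
pose K n := [set v : V | [/\ `|v| <= M, c <= f v & `|j v| <= n.+1%:R^-1]].
have neK n : K n !=set0.
  apply: contrapT => /nonemptyPn Kn; apply: nk; exists n.+1%:R^-1; first by rewrite invr_gt0.
  move=> v vM jv; rewrite ltNge; apply/negP => fv.
  have nK x : ~ K n x by rewrite Kn.
  case: (lerP 0 (f v)) => fv0.
    by apply: (nK v); split => //; rewrite -(ger0_norm fv0).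
  (* When [f v] is negative, the opposite vector belongs to the convex set. *)
  apply: (nK (- v)); split; rewrite ?normrN//.
    by rewrite -scaleN1r fZ mulN1r -(ltr0_norm fv0).
  by rewrite -scaleN1r jZ scaleN1r normrN.
pose A n : set R := [set `|v| ^+ 2 | v in K n].
have lbA n : has_lbound (A n) by exists 0 => _ [v _ <-]; rewrite sqr_ge0.
have infA n : has_inf (A n).
  by split => //; have [v Kv] := neK n; exists (`|v| ^+ 2); exists v.
(* The minimal squared norms over the decreasing sets [K n]: they are nondecreasing and bounded by
   M², with limit [D]. *)
pose de n := inf (A n).
have subK n m : (n <= m)%N -> K m `<=` K n.
  move=> nm v [a b jm]; split => //; apply: le_trans jm _.
  by rewrite lef_pV2 ?posrE// ler_nat.
have dele n v : K n v -> de n <= `|v| ^+ 2.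
  by move=> Kv; apply: ge_inf => //; exists v.
have dehomo : {homo de : n m / (n <= m)%N >-> n <= m}.
  move=> n m nm; apply: lb_le_inf; first by have [v Kv] := neK m; exists (`|v| ^+ 2); exists v.
  by move=> _ [v Kv <-]; apply: dele; exact: subK Kv.
have deub : has_ubound (range de).
  exists (M ^+ 2) => _ [n _ <-]; have [v Kv] := neK n.
  apply: le_trans (dele _ _ Kv) _; case: Kv => vM _ _.
  by rewrite lerXn2r ?nnegrE// (le_trans _ vM).
have decv := nondecreasing_cvgn dehomo deub; set D := sup _ in decv.
have deD n : de n <= D by apply: ub_le_sup => //; exists n.
have /choice[v Kv] : forall n, exists v, K n v /\ `|v| ^+ 2 <= de n + n.+1%:R^-1.
  move=> n; have [|_ [x Kx <-] xlt] := @inf_adherent _ (A n) n.+1%:R^-1 _ (infA n).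
    by rewrite invr_gt0.
  by exists x; split => //; exact: ltW.
have cv : cvgn v.
  (* The midpoint of [v n] and [v m] lies in [K n], so its squared norm is at least [de n]; inserted
     in the parallelogram law together with near-minimality, this gives the bound for n <= m. *)
  pose e n := 2 * (D - de n) + 4 * n.+1%:R^-1.
  apply: (@cvg_of_sq_cauchy _ _ _ e).
    rewrite -[X in _ --> X](_ : 2 * (D - D) + 4 * 0 = _); last by rewrite subrr !mulr0 addr0.
    apply: cvgD; last by apply: cvgMl_tmp; exact: cvg_harmonic.
    by apply: cvgMl_tmp; apply: cvgB => //; exact: cvg_cst.
  move=> n m nm; have [[vnM fn jn] vn] := Kv n; have [[vmM fm jm] vm] := Kv m.
  have mid : K n (2^-1 *: (v m + v n)).
    split.
    - rewrite normrZ ger0_norm ?invr_ge0//.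
      by rewrite ler_pdivrMl// (le_trans (ler_normD _ _))//; lra.
    - by rewrite fZ fD ler_pdivlMl//; lra.
    - rewrite jZ jD normrZ ger0_norm ?invr_ge0// ler_pdivrMl//.
      rewrite (le_trans (ler_normD _ _))//.
      have [_ _ jm2] := subK _ _ nm _ (And3 vmM fm jm).
      by rewrite mulr_natl mulr2n lerD.
  have := dele _ _ mid; rewrite normrZ ger0_norm ?invr_ge0// exprMn.
  have := normD_sq (v m) (v n); have := normB_sq (v m) (v n); have := deD m.
  have : m.+1%:R^-1 <= n.+1%:R^-1 :> R by rewrite lef_pV2 ?posrE// ler_nat.
  have -> : (2^-1 : R) ^+ 2 = 4^-1 by field.
  rewrite /e; set tn : R := n.+1%:R^-1 in vn *; set tm : R := m.+1%:R^-1 in vm *.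
  lra.
pose l := lim (v @ \oo); have vl : v @ \oo --> l by exact: cv.
have jl0 : j l = 0.
  have jv0 : (j \o v) @ \oo --> (0 : H).
    apply/cvgrPdist_le => /= e e0.
    have := @cvg_harmonic R; move/cvgrPdist_le => /(_ _ e0); apply: filterS => n.
    rewrite !sub0r !normrN => he; have [[_ _ jn] _] := Kv n.
    by apply: le_trans jn _; apply: le_trans he; exact: ler_norm.
  exact: (cvg_unique _ (cvg_linear jl jK vl) jv0).
have fl0 : c <= f l.
  have cf := cvg_linear fl fK vl.
  rewrite -(cvg_lim (@norm_hausdorff _ R^o) cf); apply: limr_ge; first exact: cvgP cf.
  by apply: nearW => n; have [[_ fn _] _] := Kv n.
move: fl0; rewrite (j0 jl0) (_ : f 0 = 0) ?leNgt ?c0//.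
by have := fZ 0 0; rewrite scale0r mul0r.
Qed.

End weak_limit.

(** * Gram-Schmidt for an abstract inner product *)

Section gram_schmidt.
Context (R : realType) (V : lmodType R) (b : V -> V -> R) (d : nat -> V).
Hypothesis (bC : forall x y, b x y = b y x).
Hypothesis (bl : forall c x y z, b (c *: x + y) z = c * b x z + b y z).
Hypothesis (b_ge0 : forall x, 0 <= b x x) (b_eq0 : forall x, b x x = 0 -> x = 0).

Let bD x y z : b (x + y) z = b x z + b y z.
Proof. by have := bl 1 x y z; rewrite scale1r mul1r. Qed.
Let b0 z : b 0 z = 0.
Proof. by have := bD 0 0 z; rewrite addr0 => /eqP; rewrite -subr_eq subrr => /eqP. Qed.
Let bZ c x z : b (c *: x) z = c * b x z.
Proof. by have := bl c x 0 z; rewrite !addr0 b0 addr0. Qed.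
Let bS (I : Type) (r : seq I) (F : I -> V) z :
  b (\sum_(i <- r) F i) z = \sum_(i <- r) b (F i) z.
Proof. by elim: r => [|i r ih]; rewrite ?big_nil ?b0// !big_cons bD ih. Qed.

(** The inverse of 0 being 0, the null vector is its own normalisation. Vectors depending linearly
    on their predecessors thus yield null entries and need not be discarded. *)
Definition normalize (v : V) : V := (Num.sqrt (b v v))^-1 *: v.

Definition gs_step (s : seq V) (x : V) : seq V :=
  rcons s (normalize (x - \sum_(u <- s) b x u *: u)).

Fixpoint gs_seq n : seq V := if n is m.+1 then gs_step (gs_seq m) (d m) else [::].

Definition gs n : V := normalize (d n - \sum_(u <- gs_seq n) b (d n) u *: u).

Lemma gs_seqE n : gs_seq n = [seq gs i | i <- iota 0 n].
Proof.
elim: n => [//|n ih].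
by rewrite -[in RHS]addn1 iotaD map_cat /= /gs_step -/(gs n) ih cats1.
Qed.

Lemma gs_sum n (F : V -> V) : \sum_(u <- gs_seq n) F u = \sum_(i < n) F (gs i).
Proof. by rewrite gs_seqE big_map -(big_mkord predT (fun i => F (gs i))) /index_iota subn0. Qed.

(** This form of being a unit vector also holds for the null vector, hence for every entry of the
    Gram-Schmidt sequence. *)
Lemma normalize_unit v : b (normalize v) (normalize v) *: normalize v = normalize v.
Proof.
have [v0|v0] := eqVneq (b v v) 0.
  by rewrite /normalize (b_eq0 v0) !scaler0.
rewrite [b _ _](_ : _ = 1) ?scale1r//.
rewrite /normalize bZ bC bZ mulrA -invfM -expr2 sqr_sqrtr ?b_ge0//.
by rewrite mulVf.
Qed.

Lemma gs_unit n : b (gs n) (gs n) *: gs n = gs n.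
Proof. exact: normalize_unit. Qed.

Lemma gs_orthogonal i k : (i < k)%N -> b (gs i) (gs k) = 0.
Proof.
elim/ltn_ind: k i => k ih i ik.
have ort : forall n m, (n < k)%N -> (m < k)%N -> n != m -> b (gs n) (gs m) = 0.
  move=> n m nk mk; rewrite neq_ltn => /orP[nm|mn]; first exact: (ih m mk).
  by rewrite bC; exact: (ih n nk).
suff H : b (d k - \sum_(u <- gs_seq k) b (d k) u *: u) (gs i) = 0.
  by rewrite bC {1}/gs /normalize bZ H mulr0.
rewrite -scaleN1r bD bZ gs_sum bS.
rewrite (bigD1 (Ordinal ik))//= big1 ?addr0 => [|l li]; last first.
  by rewrite bZ ort ?mulr0//; apply: contra_neq li => li; exact/val_inj.
rewrite bZ (_ : b (d k) (gs i) * _ = b (d k) (gs i)); last first.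
  by rewrite mulrC [b (d k) _]bC -bZ gs_unit.
by rewrite mulN1r subrr.
Qed.

Lemma gs_expand n : d n = \sum_(i < n.+1) b (d n) (gs i) *: gs i.
Proof.
rewrite big_ord_recr/=; set v := d n - \sum_(u <- gs_seq n) b (d n) u *: u.
have dv : d n = v + \sum_(i < n) b (d n) (gs i) *: gs i.
  by rewrite /v (gs_sum n (fun u => b (d n) u *: u)) subrK.
have gv : gs n = normalize v by [].
suff -> : b (d n) (gs n) *: gs n = v by rewrite addrC -dv.
have -> : b (d n) (gs n) = b v (gs n).
  rewrite {1}dv bD bS big1 ?addr0// => i _.
  by rewrite bZ gs_orthogonal ?mulr0.
rewrite gv; have [v0|v0] := eqVneq (b v v) 0.
  by rewrite /normalize (b_eq0 v0) !scaler0.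
rewrite /normalize bC bZ scalerA mulrAC -invfM -expr2 sqr_sqrtr ?b_ge0//.
by rewrite mulVf// scale1r.
Qed.

(** The truncated Riesz representer of [phi]: for linear [phi], its b-product with each of the first
    n vectors is the value of [phi] there. *)
Definition gs_comb (phi : V -> R) n : V := \sum_(i < n) phi (gs i) *: gs i.

Lemma gs_comb_coef (phi : V -> R) n k : (k < n)%N -> (forall c x, phi (c *: x) = c * phi x) ->
  b (gs_comb phi n) (gs k) = phi (gs k).
Proof.
move=> kn phiZ; rewrite bS (bigD1 (Ordinal kn))//= big1 ?addr0 => [|l li].
  by rewrite bZ mulrC -phiZ gs_unit.
rewrite bZ; have [h|h|h] := ltngtP l k.
- by rewrite gs_orthogonal ?mulr0.
- by rewrite bC gs_orthogonal ?mulr0.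
- by case/eqP: li; exact/val_inj.
Qed.

Lemma gs_comb_norm (phi psi : V -> R) n : (forall c x, phi (c *: x) = c * phi x) ->
  b (gs_comb phi n) (gs_comb psi n) = \sum_(i < n) phi (gs i) * psi (gs i).
Proof.
move=> phiZ; rewrite bC bS; apply: eq_bigr => i _.
by rewrite bZ bC gs_comb_coef// mulrC.
Qed.

(** Increments of the truncations are measured by increments of a monotone real series, so a bound
    on that series makes the truncations a Cauchy sequence. *)
Lemma gs_comb_diff (phi : V -> R) n m : (n <= m)%N -> (forall c x, phi (c *: x) = c * phi x) ->
  b (gs_comb phi m - gs_comb phi n) (gs_comb phi m - gs_comb phi n) =
  \sum_(i < m) phi (gs i) ^+ 2 - \sum_(i < n) phi (gs i) ^+ 2.
Proof.
move=> nm phiZ.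
have E1 : b (gs_comb phi m) (gs_comb phi n) = \sum_(i < n) phi (gs i) ^+ 2.
  rewrite bC bS; apply: eq_bigr => i _; rewrite bZ bC gs_comb_coef//.
  exact: leq_trans (ltn_ord i) nm.
have E2 k : b (gs_comb phi k) (gs_comb phi k) = \sum_(i < k) phi (gs i) ^+ 2.
  by rewrite gs_comb_norm.
rewrite -scaleN1r bD bZ bC [X in _ + _ * X]bC !(bD, bZ) (bC (gs_comb phi n) (gs_comb phi m)) E1 !E2.
ring.
Qed.

(** [d n] is expanded along the vectors up to index n, and the later ones are orthogonal to
    those. *)
Lemma gs_span n m : (n < m)%N -> d n = gs_comb (b (d n)) m.
Proof.
move=> nm; have dn := gs_expand n.
rewrite -(subnK nm); elim: (m - n.+1)%N => [|k ih]; first by rewrite add0n.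
rewrite addSn /gs_comb big_ord_recr/= -/(gs_comb (b (d n)) (k + n.+1)) -ih.
rewrite {3}dn bS big1 ?scale0r ?addr0// => i _.
by rewrite bZ gs_orthogonal ?mulr0// (leq_trans (ltn_ord i))// leq_addl.
Qed.

(* [gs_comb (b x) n] is the b-orthogonal projection of x on the span of the
   first n vectors, which contains y. *)
Lemma gs_best x y n : y = gs_comb (b y) n ->
  b (x - gs_comb (b x) n) (x - gs_comb (b x) n) <= b (x - y) (x - y).
Proof.
have bZr z c u : b z (c *: u) = c * b z u by rewrite bC bZ bC.
have E z : b (z - gs_comb (b z) n) (z - gs_comb (b z) n) = b z z - \sum_(i < n) b z (gs i) ^+ 2.
  rewrite -scaleN1r bD bZ bC [X in _ + _ * X]bC !(bD, bZ) (bC z (gs_comb _ _)).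
  rewrite gs_comb_norm//.
  have -> : b (gs_comb (b z) n) z = \sum_(i < n) b z (gs i) ^+ 2.
    by rewrite bS; apply: eq_bigr => i _; rewrite bZ (bC (gs i)).
  rewrite (_ : \sum_(i < n) _ * _ = \sum_(i < n) b z (gs i) ^+ 2)//; ring.
move=> yE; have -> : x - gs_comb (b x) n = (x - y) - gs_comb (b (x - y)) n.
  rewrite /gs_comb; under [in RHS]eq_bigr do rewrite -scaleN1r bD bZ mulN1r scalerBl.
  by rewrite sumrB -/(gs_comb (b x) n) -/(gs_comb (b y) n) -yE opprB addrA subrK.
by rewrite E gerBl sumr_ge0// => i _; exact: sqr_ge0.
Qed.

End gram_schmidt.

Lemma separable_seq (R : realType) (K : normedModType R) : separable K ->
  exists d : nat -> K, forall x (e : R), 0 < e -> exists n, `|x - d n| < e.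
Proof.
move=> [D [cD dD]].
have dense_ball x (e : R) : 0 < e -> exists2 y, D y & `|x - y| < e.
  move=> e0; have [|y [xy Dy]] := dD (ball x e) _ (ball_open x e).
    by exists x; exact: ballxx.
  by exists y => //; move: xy; rewrite -ball_normE.
have [y0 Dy0 _] := dense_ball 0 1 ltr01.
have [D0|[f]] := pfcard_geP cD.
  by move: Dy0; rewrite D0.
exists f => x e e0; have [y Dy xy] := dense_ball x e e0.
have [n _ fn] := 'surj_f Dy; by exists n; rewrite fn.
Qed.

Section hilbert_expansion.
Context (R : realType) (K : hilbertType R).
Variable (d : nat -> K).
Hypothesis (dense_d : forall x (e : R), 0 < e -> exists n, `|x - d n| < e).

Let nC (x y : K) : inner x y = inner y x := innerC x y.
Let nl c (x y z : K) : inner (c *: x + y) z = c * inner x z + inner y z := inner_linearl c x y z.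
Let nge0 (x : K) : 0 <= inner x x. Proof. by rewrite inner_norm sqr_ge0. Qed.
Let neq0 (x : K) : inner x x = 0 -> x = 0 := @inner_eq0 _ _ x.

(** Partial sums are best approximations from the span, and beyond index n the span contains [d n],
    which may be chosen close to [x]. *)
Lemma hilbert_expansion (x : K) :
  (fun N => \sum_(i < N) inner x (gs inner d i) *: gs inner d i) @ \oo --> x.
Proof.
apply/cvgrPdist_lt => /= e e0; have [n xn] := dense_d x e0.
exists n.+1 => // N /= nN; apply: le_lt_trans xn.
rewrite -(ler_pXn2r (n := 2)) ?nnegrE// -!inner_norm.
apply: (gs_best nC nl nge0 neq0).
exact: (gs_span d nC nl nge0 neq0 nN).
Qed.

End hilbert_expansion.

Section smoothing.
Context (R : realType) (V H : hilbertType R) (j : {linear V -> H}) (Kj : R).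
Hypothesis (jK : forall x, `|j x| <= Kj * `|x|).
Variable (d : nat -> V).
Hypothesis (dense_d : forall x (e : R), 0 < e -> exists n, `|x - d n| < e).
Variables (ep : R) (ep0 : 0 < ep).

(* Testing the equation with a basis orthonormal for b controls the H-norm, and
   the expansion of j x along it converges in V to a smoothing of x that tends
   to x as ep -> 0. *)
Let b (x y : V) : R := inner (j x) (j y) + ep * inner x y.
Let bC x y : b x y = b y x. Proof. by rewrite /b (innerC (j x)) (innerC x). Qed.
Let bl c x y z : b (c *: x + y) z = c * b x z + b y z.
Proof. by rewrite /b linearP !inner_linearl; ring. Qed.
Let bE x : b x x = `|j x| ^+ 2 + ep * `|x| ^+ 2. Proof. by rewrite /b !inner_norm. Qed.
Let b_ge0 x : 0 <= b x x. Proof. by rewrite bE addr_ge0 ?sqr_ge0// mulr_ge0 ?sqr_ge0// ltW. Qed.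
Let b_eq0 x : b x x = 0 -> x = 0.
Proof.
rewrite bE => /eqP; rewrite paddr_eq0 ?sqr_ge0//; last by rewrite mulr_ge0 ?sqr_ge0// ltW.
by move=> /andP[_]; rewrite mulf_eq0 (gt_eqF ep0)/= sqrf_eq0 normr_eq0 => /eqP.
Qed.
Let ip_le_b x : ep * `|x| ^+ 2 <= b x x. Proof. by rewrite bE lerDr sqr_ge0. Qed.
Let jp_le_b x : `|j x| ^+ 2 <= b x x.
Proof. by rewrite bE lerDl mulr_ge0 ?sqr_ge0// ltW. Qed.

Definition smooth_basis : nat -> V := gs b d.
Local Notation f := smooth_basis.

(** The truncated representer, for [b], of the functional x -> <z, j x>. *)
Definition smooth (z : H) N : V := \sum_(i < N) inner z (j (f i)) *: f i.

Let phiZ z c x : inner z (j (c *: x)) = c * inner z (j x).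
Proof. by rewrite linearZ innerZr. Qed.

(** A Bessel inequality in H although the vectors [j (f i)] are not orthonormal there. The sum S
    equals both [b] of the truncation with itself and its pairing with z through j; as [b] dominates
    the H-part, S² <= |z|² S. *)
Lemma sum_smooth_basis_le (z : H) N : \sum_(i < N) (inner z (j (f i))) ^+ 2 <= `|z| ^+ 2.
Proof.
set S := (X in X <= _).
have ES : b (smooth z N) (smooth z N) = S.
  exact: (gs_comb_norm d bC bl b_ge0 b_eq0 (phi := fun x => inner z (j x)) (fun x => inner z (j x)) N (phiZ z)).
have ES2 : inner z (j (smooth z N)) = S.
  rewrite /smooth linear_sum innerC inner_suml; apply: eq_bigr => i _.
  by rewrite linearZ innerZl (innerC (j _)) expr2.
have S0 : 0 <= S by rewrite -ES.
have : S ^+ 2 <= `|z| ^+ 2 * S.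
  rewrite -{1}ES2 -(real_normK (num_real _)) -[X in _ <= _ * X]ES.
  apply: le_trans (_ : (`|z| * `|j (smooth z N)|) ^+ 2 <= _).
    by rewrite ler_pXn2r ?nnegrE ?mulr_ge0// inner_CS.
  by rewrite exprMn ler_wpM2l ?sqr_ge0.
case: (ltrP 0 S) => [Sp|Sn _]; last by rewrite (le_trans Sn) ?sqr_ge0.
by rewrite expr2 ler_pM2r.
Qed.

Lemma norm_smooth_le (z : H) N : ep * `|smooth z N| ^+ 2 <= `|z| ^+ 2.
Proof.
apply: le_trans (ip_le_b _) _.
rewrite (gs_comb_norm d bC bl b_ge0 b_eq0 (phi := fun x => inner z (j x)) (fun x => inner z (j x)) N (phiZ z)).
exact: sum_smooth_basis_le.
Qed.

Lemma cvg_smooth (z : H) : cvgn (smooth z).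
Proof.
pose S N := \sum_(i < N) (inner z (j (f i))) ^+ 2.
have hS : {homo S : n m / (n <= m)%N >-> n <= m}.
  apply/nondecreasing_seqP => n; rewrite /S big_ord_recr/= lerDl; exact: sqr_ge0.
have uS : has_ubound (range S).
  by exists (`|z| ^+ 2) => _ [n _ <-]; exact: sum_smooth_basis_le.
have cS := nondecreasing_cvgn hS uS; set L := sup _ in cS.
apply: (@cvg_of_sq_cauchy _ _ _ (fun n => ep^-1 * (L - S n))).
  rewrite -[X in _ --> X](_ : ep^-1 * (L - L) = _); last by rewrite subrr mulr0.
  by apply: cvgMl_tmp; apply: cvgB => //; exact: cvg_cst.
move=> n m nm; rewrite ler_pdivlMl//.
apply: le_trans (ip_le_b _) _.
rewrite (gs_comb_diff d bC bl b_ge0 b_eq0 (phi := fun x => inner z (j x)) nm (phiZ z)) lerB//.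
by apply: ub_le_sup => //; exists m.
Qed.

(** This is (j'j + ep)^-1 j'j x, where j' is the adjoint of j, as [smoothing_eq] expresses. *)
Definition smoothing (x : V) : V := lim (smooth (j x) @ \oo).

Let b_bound x y : `|b x y| <= (Kj ^+ 2 + ep) * `|x| * `|y|.
Proof.
have Kj2 : `|j x| * `|j y| <= Kj ^+ 2 * (`|x| * `|y|).
  by rewrite expr2 mulrACA ler_pM.
rewrite /b; apply: le_trans (ler_normD _ _) _; rewrite normrM (gtr0_norm ep0).
have h1 := inner_CS (j x) (j y).
have h2 : ep * `|inner x y| <= ep * (`|x| * `|y|) by rewrite ler_pM2l// inner_CS.
by rewrite -!mulrA mulrDl; lra.
Qed.

(** On a basis vector the coefficients of the truncations are eventually constant, which gives the
    identity; it extends to each [d n] by linearity and to every [y] by density and boundedness. *)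
Lemma smoothing_eq x y : b (x - smoothing x) y = ep * inner x y.
Proof.
have cR : smooth (j x) @ \oo --> smoothing x by exact: cvg_smooth.
have bBl u v w : b (u - v) w = b u w - b v w.
  by rewrite -scaleN1r addrC bl mulN1r addrC.
have blin w : linear ((fun u => b u w) : V -> R^o) by move=> c u v; rewrite bl.
have Hk k : b (x - smoothing x) (f k) = ep * inner x (f k).
  suff bR : b (smoothing x) (f k) = inner (j x) (j (f k)) by rewrite bBl bR /b addrAC subrr add0r.
  have c1 : (fun N => b (smooth (j x) N) (f k)) @ \oo --> b (smoothing x) (f k).
    apply: (@cvg_linear _ _ _ (fun u => b u (f k) : R^o) ((Kj ^+ 2 + ep) * `|f k|) _ _ (blin _) _ cR).
    by move=> u; apply: le_trans (b_bound _ _) _; rewrite mulrAC.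
  apply: (cvg_unique (@norm_hausdorff _ R^o) c1).
  apply: cvg_near_cst; exists k.+1 => // N /= kN.
  exact: (gs_comb_coef d bC bl b_ge0 b_eq0 (phi := fun u => inner (j x) (j u)) kN (phiZ (j x))).
pose g z := b (x - smoothing x) z - ep * inner x z.
have gl c u v : g (c *: u + v) = c * g u + g v.
  by rewrite /g bC bl innerDr innerZr [b u _]bC [b v _]bC; ring.
have g0 : g 0 = 0.
  by have := gl 1 0 0; rewrite scaler0 addr0 mul1r => /eqP; rewrite -subr_eq subrr => /eqP.
have gd n : g (d n) = 0.
  rewrite (gs_span d bC bl b_ge0 b_eq0 (ltnSn n)) /gs_comb.
  elim/big_ind : _ => [//|u v gu gv|i _]; first by rewrite -[u]scale1r gl gu gv mulr0 addr0.
  by rewrite -[_ *: _]addr0 gl g0 addr0 /g Hk subrr mulr0.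
pose K := (Kj ^+ 2 + ep) * `|x - smoothing x| + ep * `|x|.
have gK z : `|g z| <= K * `|z|.
  rewrite /g (le_trans (ler_normB _ _))// /K mulrDl lerD// normrM (gtr0_norm ep0) -mulrA.
  by rewrite ler_pM2l// inner_CS.
have K0 : 0 <= K.
  by rewrite addr_ge0// ?mulr_ge0// ?(ltW ep0)// addr_ge0 ?sqr_ge0// ltW.
suff : g y = 0 by move=> /eqP; rewrite subr_eq0 => /eqP.
apply/eqP; rewrite -normr_eq0; apply/eqP/le_anti; rewrite normr_ge0 andbT.
apply/ler_addgt0Pr => e e0; rewrite add0r.
have K1 : 0 < K + 1 by rewrite ltr_wpDl.
have [n yn] := dense_d y (divr_gt0 e0 K1).
have -> : g y = g (y - d n) by rewrite addrC -scaleN1r gl gd; ring.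
apply: le_trans (gK _) _; apply: le_trans (_ : (K + 1) * `|y - d n| <= _).
  by rewrite ler_wpM2r// lerDl.
by rewrite mulrC -ler_pdivlMr// ltW.
Qed.

Let b_smoothing x : b (x - smoothing x) (x - smoothing x) <= ep * (`|x| * `|x - smoothing x|).
Proof. by rewrite smoothing_eq ler_pM2l// (le_trans (ler_norm _))// inner_CS. Qed.

(** [smoothing_eq] is tested with the error itself: ep times its squared norm is at most ep <x,
    error>. *)
Lemma smoothing_norm x : `|x - smoothing x| <= `|x|.
Proof.
have := le_trans (ip_le_b _) (b_smoothing x).
rewrite ler_pM2l// expr2.
have [->|xn0] := eqVneq `|x - smoothing x| 0; first by rewrite normr_ge0.
by rewrite ler_pM2r// lt_def xn0 normr_ge0.
Qed.

Lemma smoothing_normj x : `|j (x - smoothing x)| ^+ 2 <= ep * `|x| ^+ 2.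
Proof.
apply: le_trans (jp_le_b _) _; apply: le_trans (b_smoothing x) _.
by rewrite ler_pM2l// expr2 ler_wpM2l// smoothing_norm.
Qed.

Lemma cvg_smoothing x : smooth (j x) @ \oo --> smoothing x.
Proof. exact: cvg_smooth. Qed.

End smoothing.

(** Density of the range of j and boundedness of j make the [j (dn n)] dense in H, and |y|² = <y, y
    - j (dn n)> is at most |y| times an arbitrarily small number. *)
Lemma orthogonal_dense_eq0 (R : realType) (V H : hilbertType R) (j : {linear V -> H}) (K : R)
    (dn : nat -> V) (y : H) : dense (range j) -> 0 <= K -> (forall x, `|j x| <= K * `|x|) ->
  (forall x (e : R), 0 < e -> exists n, `|x - dn n| < e) ->
  (forall n, inner y (j (dn n)) = 0) -> y = 0.
Proof.
move=> j_dense K0 jK dense_dn yn; apply/eqP; rewrite -normr_eq0; apply/eqP/le_anti; rewrite normr_ge0 andbT.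
apply/ler_addgt0Pr => e e0; rewrite add0r.
have K1 : 0 < K + 1 by rewrite ltr_wpDl.
have e1 : 0 < e / (K + 1) by rewrite divr_gt0.
have [y' [/= Dy [x _ xy]]] : (ball y (e / (K + 1)) `&` range j) !=set0.
  by apply: j_dense; [exists y; exact: ballxx|exact: ball_open].
have [n xdn] := dense_dn x _ e1.
have yn' : `|y - j (dn n)| <= e.
  have -> : y - j (dn n) = (y - y') + j (x - dn n) by rewrite linearB -xy addrA subrK.
  apply: le_trans (ler_normD _ _) _; apply: (@le_trans _ _ (e / (K + 1) + K * (e / (K + 1)))).
    by rewrite lerD//; [move: Dy; rewrite -ball_normE => /ltW|rewrite (le_trans (jK _))// ler_wpM2l// ltW].
  by rewrite -[X in X + _]mul1r -mulrDl addrC mulrC divfK// gt_eqF.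
have [->|D0] := eqVneq `|y| 0; first exact: ltW.
have Dp : 0 < `|y| by rewrite lt_def D0 normr_ge0.
rewrite -(ler_pM2l Dp) -expr2 -inner_norm.
have -> : inner y y = inner y (y - j (dn n)) by rewrite innerBr yn subr0.
by rewrite (le_trans (ler_norm _))// (le_trans (inner_CS _ _))// ler_wpM2l.
Qed.

(** * Borel measurability in separable spaces *)

Section borel_maps.
Context d (S : measurableType d) (D : set S).
Hypothesis mD : measurable D.

Lemma measurable_wrt_open (X : topologicalType) (f : S -> X) :
  (forall O, open O -> measurable (D `&` f @^-1` O)) -> measurable_wrt measurable D f.
Proof.
move=> fO B; apply: (@smallest_sub _ _ _ [set B | measurable (D `&` f @^-1` B)]) => //.
split => /=.
- by rewrite preimage_set0 setI0.
- move=> A mA; rewrite (_ : D `&` _ = D `\` (D `&` f @^-1` A)); first exact: measurableD.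
  by apply/seteqP; split => p /= [Dp]; [move=> [_ nA]; split=> // -[] | move=> nA; split=> //; split=> // fA; apply: nA].
- move=> A mA; rewrite preimage_bigcup setI_bigcupr; exact: bigcup_measurable.
Qed.

(** Continuity of [g] is only relative to [E], as for coefficients given on [0, T] and U; the
    preimage of an open set is then the trace on E of an open set, which suffices because [f] stays
    in E. *)
Lemma measurable_wrt_comp (X Y : topologicalType) (E : set X) (f : S -> X) (g : X -> Y) :
  measurable_wrt measurable D f -> (forall p, D p -> E (f p)) ->
  {within E, continuous g} -> measurable_wrt measurable D (g \o f).
Proof.
move=> mf DE /continuousP cg; apply: measurable_wrt_open => O oO.
have /open_subspaceP [W oW EW] := cg _ oO.
rewrite (_ : _ `&` _ = D `&` f @^-1` W); first by apply: mf; exact: sub_sigma_algebra.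
have Wg p : D p -> O (g (f p)) <-> W (f p).
  move=> Dp; have := DE _ Dp; have [h1 h2] : (W `&` E) (f p) <-> (g @^-1` O `&` E) (f p) by rewrite EW.
  by move=> Ep; split=> hp; [have [] := h2 (conj hp Ep)|have [] := h1 (conj hp Ep)].
by apply/seteqP; split => p [Dp] Op; split => //; exact/(Wg p Dp).
Qed.

Lemma measurable_wrtP (R : realType) (f : S -> R) :
  measurable_wrt measurable D f <-> measurable_fun D f.
Proof.
split=> [mf _ B|mf B]; first by rewrite measurable_borel => mB; exact: mf.
by rewrite -measurable_borel => mB; exact: mf.
Qed.

End borel_maps.

Section dense_sequences.
Context (R : realType).

Definition has_dense_seq (X : pseudoMetricType R) :=
  exists d : nat -> X, forall x (e : R), 0 < e -> exists n, ball x e (d n).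

Lemma has_dense_seq_prod (X Y : pseudoMetricType R) :
  has_dense_seq X -> has_dense_seq Y -> has_dense_seq (X * Y)%type.
Proof.
move=> [dX hX] [dY hY].
(* [odflt] supplies a point for the numbers that code no pair. *)
exists (fun n => let k := odflt (0, 0)%N (unpickle n) in (dX k.1, dY k.2)) => -[x y] e e0.
have [n xn] := hX x e e0; have [m ym] := hY y e e0.
by exists (pickle (n, m)); rewrite pickleK; split.
Qed.

Lemma has_dense_seq_R : has_dense_seq R.
Proof.
exists (fun n => ratr (odflt 0 (unpickle n))) => x e e0.
have /rat_in_itvoo[q /itvP qx] : x < x + e by rewrite ltrDl.
exists (pickle q); rewrite pickleK /= /ball/= ltr_distlC.
by rewrite qx andbT (lt_trans _ (_ : x < _)) ?qx// gtrBl.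
Qed.

Lemma has_dense_seq_separable (K : normedModType R) : separable K -> has_dense_seq K.
Proof.
move=> /separable_seq[d hd]; exists d => x e /(hd x)[n xn]; exists n.
by rewrite -ball_normE.
Qed.

(** In separable spaces an open set of the product is a countable union of boxes, so the Borel sets
    of the product are reached from rectangles. *)
Lemma measurable_wrt_pair d (S : measurableType d) (D : set S) (X Y : pseudoMetricType R)
    (f : S -> X) (g : S -> Y) : measurable D -> has_dense_seq X -> has_dense_seq Y ->
  measurable_wrt measurable D f -> measurable_wrt measurable D g ->
  measurable_wrt measurable D (fun p => (f p, g p)).
Proof.
move=> mD [dX hX] [dY hY] mf mg; apply: measurable_wrt_open => // O oO.
pose box (q : (nat * nat) * nat) : set (X * Y) :=
  (* Interiors are taken because balls of a pseudometric space need not be open. *)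
  (ball (dX q.1.1) (q.2.+1%:R^-1 : R))° `*` (ball (dY q.1.2) (q.2.+1%:R^-1 : R))°.
pose I := [set q | box q `<=` O].
have -> : D `&` (fun p => (f p, g p)) @^-1` O =
    \bigcup_(q in I) ((D `&` f @^-1` (ball (dX q.1.1) (q.2.+1%:R^-1 : R))°) `&`
                      (D `&` g @^-1` (ball (dY q.1.2) (q.2.+1%:R^-1 : R))°)).
  apply/seteqP; split => p /=; last first.
    by move=> [q Iq [[Dp fp] [_ gp]]]; split => //; apply: (Iq (f p, g p)).
  move=> [Dp Op]; have := oO; rewrite openE => /(_ _ Op)/nbhs_ballP[e /= e0 eO].
  (* A box of radius 1/(m+1) whose centre is within half of that radius of the point stays in the
     ball of radius [e]. *)
  have [m me] : exists m, m.+1%:R^-1 < e / 2 :> R.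
    have e2 : 0 < e / 2 by rewrite divr_gt0.
    by have [m _ /(_ m (leqnn m)) mm] := near_infty_natSinv_lt (PosNum e2); exists m.
  have m0 : 0 < m.+1%:R^-1 / 2 :> R by rewrite divr_gt0.
  have [n xn] := hX (f p) _ m0; have [n' yn] := hY (g p) _ m0.
  have hm : m.+1%:R^-1 / 2 + m.+1%:R^-1 <= e by move: m0 me; set z := _^-1; lra.
  exists ((n, n'), m).
    move=> [x y] [/= /interior_subset bx /interior_subset bby]; apply: eO; split => /=.
      apply: (le_ball hm).
      exact: ball_triangle xn bx.
    apply: (le_ball hm).
    exact: ball_triangle yn bby.
  have half (Z : pseudoMetricType R) (z c : Z) : ball z (m.+1%:R^-1 / 2) c -> (ball c m.+1%:R^-1)° z.
    move=> zc; rewrite /interior/=; apply/nbhs_ballP; exists (m.+1%:R^-1 / 2) => //= y zy.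
    by rewrite [m.+1%:R^-1]splitr; apply: ball_triangle zy; exact: ball_sym.
  by split; split=> //; exact: half.
rewrite bigcup_mkcond; apply: countable_bigcupT_measurable => // q.
case: ifP => // _; apply: measurableI; [apply: mf|apply: mg]; apply: sub_sigma_algebra; exact: open_interior.
Qed.

End dense_sequences.

Section linear_forms.
Context d (S : measurableType d) (R : realType) (K : hilbertType R).
Hypothesis sK : separable K.

(* Carathéodory: the value of the form is the limit of sums of products of
   coordinates in an orthonormal basis. *)
Lemma measurable_linear_form (l : S -> K -> R) (x : S -> K) :
  (forall p, linear (l p : K -> R^o)) ->
  (forall p, exists C, forall v, `|l p v| <= C * `|v|) ->
  (forall v, measurable_fun setT (fun p => l p v)) ->
  (forall v, measurable_fun setT (fun p => inner (x p) v)) ->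
  measurable_fun setT (fun p => l p (x p)).
Proof.
move=> ll lb ml mx; have [dn dense_d] := separable_seq sK.
pose e := gs inner dn.
pose h N p := l p (\sum_(i < N) inner (x p) (e i) *: e i).
apply: (@measurable_fun_cvg _ _ _ _ h) => [N|p _].
  have -> : h N = fun p => \sum_(i < N) inner (x p) (e i) * l p (e i).
    apply/funext => p; rewrite /h.
    have l0 : l p 0 = 0 by have := ll p 1 0 0; rewrite !scale1r addr0 => /eqP; rewrite -subr_eq subrr => /eqP.
    elim: N => [|N ih]; first by rewrite !big_ord0 l0.
    by rewrite !big_ord_recr/= addrC ll ih addrC.
  by apply: measurable_sum => i; exact: measurable_funM.
have [C lC] := lb p.
have H := hilbert_expansion dense_d (x := x p).
have H2 := @cvg_linear _ _ _ (l p : K -> R^o) C _ _ (ll p) lC H.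
exact: H2.
Qed.

Lemma measurable_normH (x : S -> K) : (forall v, measurable_fun setT (fun p => inner (x p) v)) ->
  measurable_fun setT (fun p => `|x p|).
Proof.
move=> mx; have -> : (fun p => `|x p|) = fun p => Num.sqrt (inner (x p) (x p)).
  by apply/funext => p; rewrite inner_norm sqrtr_sqr normr_id.
apply: (measurableT_comp (continuous_measurable_fun (@sqrt_continuous R))).
apply: (@measurable_linear_form (fun p => inner (x p))) => //.
- by move=> p c u v; rewrite innerDr innerZr.
- by move=> p; exists `|x p| => v; exact: inner_CS.
Qed.

End linear_forms.

Section time_integral_linearity.
Context (R : realType) (d : measure_display) (Om : measurableType d).
Context (P : probability Om R) (T : R) (w : R -> Om -> R).
Hypothesis w_bm : brownian_motion P T w.
Local Notation mu := (@lebesgue_measure R).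
Local Notation M := (mu \x P)%E.

Lemma integrable_slice_cut s t (f : R -> Om -> R) : sqint M (cut s t f) ->
  {ae P, forall om, mu.-integrable setT (EFin \o fun r => cut s t f (r, om))}.
Proof. by move=> sf; apply: ae_mono (ae_integrable2 (integrable_cut sf)). Qed.

Lemma tint_lin s t (f g : R -> Om -> R) c om :
  mu.-integrable setT (EFin \o fun r => cut s t f (r, om)) ->
  mu.-integrable setT (EFin \o fun r => cut s t g (r, om)) ->
  tint s t (fun r om => f r om + c * g r om) om = tint s t f om + c * tint s t g om.
Proof.
move=> iF ig; rewrite !tintE -RintegralZl// -RintegralD//; last exact: (integrableZl measurableT c ig).
by apply: eq_Rintegral => r _; rewrite cut_lin.
Qed.

Lemma tint_ae s t (f g : R -> Om -> R) om :
  mu.-integrable setT (EFin \o fun r => cut s t f (r, om)) ->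
  mu.-integrable setT (EFin \o fun r => cut s t g (r, om)) ->
  {ae mu, forall r, s <= r <= t -> f r om = g r om} -> tint s t f om = tint s t g om.
Proof.
move=> iF ig fg; rewrite !tintE; apply: Rintegral_ae => //.
apply: ae_mono fg => r; rewrite /cut/= indicE mem_setE in_itv/=.
by case: (s <= r <= t) => [->//|_]; rewrite !mul0r.
Qed.

Lemma ito_ae s t (f g : R -> Om -> R) J : s <= t -> t <= T -> ito P w s t f J ->
  sqint M (cut s t g) ->
  {ae M, forall p, cut s t f p = cut s t g p} -> ito P w s t g J.
Proof.
move=> st tT [sJ sf [l [vl cl cJ]]] sg fg; split => //; exists l; split => //.
have sl k := sqint_eval w_bm tT (vl k).
apply: cvg_trans cl; apply: near_eq_cvg; apply: nearW => k.
apply: ip_ae; try exact: sqintB.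
by apply: ae_mono fg => p ->.
Qed.

End time_integral_linearity.

(** * Uniqueness for the linear state equation *)

Section dominated.
Context d (S : measurableType d) (R : realType) (m : {measure set S -> \bar R}).

Lemma sqint_aeeq (f g : S -> R) : measurable_fun setT f -> sqint m g ->
  {ae m, forall x, f x = g x} -> sqint m f.
Proof.
move=> mf [mg goo] fg; split => //; apply: le_lt_trans goo.
rewrite le_eqVlt; apply/orP; left; apply/eqP; apply: ae_eq_integral => //.
- by apply/measurable_EFinP; exact: measurable_funX.
- by apply/measurable_EFinP; exact: measurable_funX.
- by apply: filterS fg => p + _ => ->.
Qed.

Lemma Rintegral_dominated_ae (f_ : nat -> S -> R) (f g : S -> R) :
  (forall n, measurable_fun setT (f_ n)) -> measurable_fun setT f ->
  {ae m, forall x, f_ ^~ x @ \oo --> f x} ->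
  m.-integrable setT (EFin \o g) -> (forall n x, `|f_ n x| <= g x) ->
  m.-integrable setT (EFin \o f) /\
  (fun n => \int[m]_x f_ n x) @ \oo --> \int[m]_x f x.
Proof.
move=> mf mf' cf ig fg.
have [] := @dominated_convergence _ _ _ m setT measurableT (fun n => EFin \o f_ n) (EFin \o f) (EFin \o g).
- by move=> n; exact/measurable_EFinP.
- exact/measurable_EFinP.
- by apply: ae_mono cf => x cfx _; apply: cvg_EFin; [exact: nearW|exact: cfx].
- exact: ig.
- by apply: aeW => x n _; rewrite /= lee_fin.
move=> if' _ c; split => //.
by apply: fine_cvg; rewrite /Rintegral fineK ?integrable_fin_num.
Qed.

Lemma Rintegral_dominated (f_ : nat -> S -> R) (f g : S -> R) :
  (forall n, measurable_fun setT (f_ n)) -> (forall x, f_ ^~ x @ \oo --> f x) ->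
  m.-integrable setT (EFin \o g) -> (forall n x, `|f_ n x| <= g x) ->
  m.-integrable setT (EFin \o f) /\
  (fun n => \int[m]_x f_ n x) @ \oo --> \int[m]_x f x.
Proof.
move=> mf cf ig fg; apply: (Rintegral_dominated_ae mf _ _ ig fg); last exact: aeW.
by apply: (@measurable_fun_cvg _ _ _ _ f_) => // x _; exact: cf.
Qed.

Lemma sum_Rintegral N (F : nat -> S -> R) : (forall n, m.-integrable setT (EFin \o F n)) ->
  m.-integrable setT (EFin \o fun x => \sum_(i < N) F i x) /\
  \int[m]_x (\sum_(i < N) F i x) = \sum_(i < N) \int[m]_x F i x.
Proof.
move=> iF; elim: N => [|N [ih1 ih2]].
  split.
    by have := integrable0 m setT; apply: eq_integrable => // x _ /=; rewrite big_ord0.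
  rewrite big_ord0; under eq_Rintegral do rewrite big_ord0.
  by rewrite /Rintegral integral0.
split.
  have := integrableD measurableT ih1 (iF N).
  by apply: eq_integrable => // x _ /=; rewrite big_ord_recr.
rewrite big_ord_recr/= -ih2 -RintegralD//.
by apply: eq_Rintegral => x _; rewrite big_ord_recr.
Qed.

End dominated.

Lemma linear_sumE (R : realType) (V : lmodType R) (L : V -> R) N (c : nat -> R) (f : nat -> V) :
  linear (L : V -> R^o) -> L (\sum_(i < N) c i *: f i) = \sum_(i < N) c i * L (f i).
Proof.
move=> lL; have L0 : L 0 = 0.
  by have := lL 1 0 0; rewrite !scale1r addr0 => /eqP; rewrite -subr_eq subrr => /eqP.
elim: N => [|N ih]; first by rewrite !big_ord0.
by rewrite !big_ord_recr/= addrC lL ih addrC.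
Qed.

(** * The pointwise energy inequality *)

Section energy.
Context (R : realType) (V H : hilbertType R) (j : {linear V -> H}) (dn : nat -> V).
Variables (ep : R) (ep0 : 0 < ep).
Local Notation f := (smooth_basis j dn ep).

(** In order: coercivity; the square of [bx]; the square of [j x] in 2<ax, jx> <= |ax|² + |jx|²; the
    cross term 2|Bx||bx|, absorbed by de |x|²; the square of [ax]. *)
Definition energy_cst (de K : R) := K + K ^+ 2 + 1 + K ^+ 2 ^+ 2 / de + K ^+ 2.

(** Coercivity is available for [x], not for its truncated smoothing. It is therefore used at x, and
    the price is the error [L (smooth ... - x)] on the right. *)
Lemma energy_bound (L : V -> R) (x : V) (Bx ax bx : H) (de K : R) N :
  linear (L : V -> R^o) -> 0 < de -> 0 <= K ->
  2 * L x + `|Bx| ^+ 2 <= - de * `|x| ^+ 2 + K * `|j x| ^+ 2 ->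
  `|Bx| <= K * `|x| -> `|ax| <= K * `|j x| -> `|bx| <= K * `|j x| ->
  \sum_(i < N) (2 * ((L (f i) + inner ax (j (f i))) * inner (j x) (j (f i))) +
    inner (Bx + bx) (j (f i)) * inner (Bx + bx) (j (f i))) <=
  2 * L (smooth j dn ep (j x) N - x) + energy_cst de K * `|j x| ^+ 2.
Proof.
move=> lL de0 K0 coer Bb ab bb.
have -> : L (smooth j dn ep (j x) N - x) = \sum_(i < N) inner (j x) (j (f i)) * L (f i) - L x.
  by rewrite addrC -scaleN1r lL (linear_sumE N (fun i => inner (j x) (j (f i))) f lL) /GRing.scale/=; ring.
set S1 := \sum_(i < N) inner (j x) (j (f i)) * L (f i).
have S2 := sum_smooth_basis_le j dn ep0 ax N.
have S3 := sum_smooth_basis_le j dn ep0 (j x) N.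
have S4 := sum_smooth_basis_le j dn ep0 (Bx + bx) N.
have step : \sum_(i < N) (2 * ((L (f i) + inner ax (j (f i))) * inner (j x) (j (f i))) +
    inner (Bx + bx) (j (f i)) * inner (Bx + bx) (j (f i))) <=
    2 * S1 + (\sum_(i < N) inner ax (j (f i)) ^+ 2 + \sum_(i < N) inner (j x) (j (f i)) ^+ 2) +
    \sum_(i < N) inner (Bx + bx) (j (f i)) ^+ 2.
  rewrite /S1 mulr_sumr -!big_split/=; apply: ler_sum => i _.
  have := sqr_ge0 (inner ax (j (f i)) - inner (j x) (j (f i))); nra.
apply: (le_trans step).
have q1 : `|Bx + bx| ^+ 2 <= `|Bx| ^+ 2 + 2 * (`|Bx| * `|bx|) + `|bx| ^+ 2.
  have := ler_normD Bx bx; have := normr_ge0 (Bx + bx); have := normr_ge0 Bx; have := normr_ge0 bx; nra.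
have q2 : `|Bx| * `|bx| <= (K * `|x|) * (K * `|j x|) by exact: ler_pM.
have q3 : 2 * ((K * `|x|) * (K * `|j x|)) <= de * `|x| ^+ 2 + K ^+ 2 ^+ 2 / de * `|j x| ^+ 2.
  rewrite -subr_ge0 (_ : _ - _ = (de * `|x| - K ^+ 2 * `|j x|) ^+ 2 / de).
    by rewrite divr_ge0 ?sqr_ge0// ltW.
  by field; rewrite gt_eqF.
have q4 : `|bx| ^+ 2 <= K ^+ 2 * `|j x| ^+ 2.
  by rewrite -exprMn ler_pXn2r ?nnegrE ?mulr_ge0.
have q5 : `|ax| ^+ 2 <= K ^+ 2 * `|j x| ^+ 2.
  by rewrite -exprMn ler_pXn2r ?nnegrE ?mulr_ge0.
rewrite /energy_cst; set k4 := _ / de in q3 *.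
rewrite !mulrDl mul1r; lra.
Qed.

End energy.

Lemma integrable_indic_itv (R : realType) (s u : R) :
  (@lebesgue_measure R).-integrable setT (EFin \o \1_`[s, u]).
Proof.
have h := @sqint_indic R s u; have := sqint_integrableM h h.
by apply: eq_integrable => // r _ /=; rewrite indicM.
Qed.

Lemma Rintegral_indic_itv (R : realType) (s u : R) : s <= u ->
  \int[@lebesgue_measure R]_r \1_`[s, u] r = u - s.
Proof.
move=> su; rewrite /Rintegral integral_indic// setIT.
transitivity (fine ((@lebesgue_measure R) [set` `[s, u]%R])) => //.
rewrite lebesgue_measure_itv/= lte_fin.
by have [//|us] := ltP s u; rewrite (le_anti (_ : s <= u <= s)) ?su// subrr.
Qed.

(** * A solution of the homogeneous equation with zero initial datum vanishes *)

Section homogeneous_equation.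
Context (R : realType) (d : measure_display) (Om : measurableType d).
Context (P : probability Om R) (T : R) (w : R -> Om -> R).
Hypothesis w_bm : brownian_motion P T w.
Local Notation mu := (@lebesgue_measure R).
Local Notation M := (mu \x P)%E.
Context (V H : hilbertType R) (j : {linear V -> H}).
Hypothesis (sV : separable V) (j_dense : dense (range j)).
Hypothesis j_inj : forall x, j x = 0 -> x = 0.
Variables (t de K : R).
Hypotheses (t0 : 0 <= t) (tT : t <= T) (de0 : 0 < de) (K0 : 0 <= K).
Hypothesis jK : forall x, `|j x| <= K * `|x|.
Variables (a2 : R -> V -> V -> R) (B : R -> V -> H) (a b : R -> H -> H).
Hypothesis a2l : forall r x, linear (a2 r x : V -> R^o).
Hypothesis a2r : forall r y, linear (a2 r ^~ y : V -> R^o).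
Hypothesis a2b : forall r x y, `|a2 r x y| <= K * `|x| * `|y|.
Hypothesis Bl : forall r, linear (B r).
Hypothesis Bb : forall r x, `|B r x| <= K * `|x|.
Hypothesis al : forall r, linear (a r).
Hypothesis ab : forall r x, `|a r x| <= K * `|x|.
Hypothesis bl : forall r, linear (b r).
Hypothesis bb : forall r x, `|b r x| <= K * `|x|.
Hypothesis ma2 : forall x y, measurable_fun setT (fun r => a2 r x y).
Hypothesis mB : forall x y, measurable_fun setT (fun r => inner (B r x) y).
Hypothesis ma : forall x y, measurable_fun setT (fun r => inner (a r x) y).
Hypothesis mb : forall x y, measurable_fun setT (fun r => inner (b r x) y).
Hypothesis coer : forall r x, t <= r <= T ->
  2 * a2 r x x + `|B r x| ^+ 2 <= - de * `|x| ^+ 2 + K * `|j x| ^+ 2.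

Variables (z : R -> Om -> V) (D : R -> Om -> H).
Local Notation Z p := (z p.1 p.2).
Hypothesis z0 : forall r om, ~~ (t <= r <= T) -> z r om = 0.
Hypothesis mz : forall y, measurable_fun setT (fun p : R * Om => inner (Z p) y).
Hypothesis Fmz : forall r y, t <= r <= T -> Fm P w r (fun om => inner (z r om) y).
Hypothesis sz : sqint M (fun p => `|Z p|).
Hypothesis sD : forall r phi, t <= r <= T -> sqint P (fun om => inner (D r om) (j phi)).
Hypothesis mD : forall phi, measurable_fun setT (cut t T (fun r om => inner (D r om) (j phi))).
Hypothesis Dz : forall phi, {ae M, forall p,
  cut t T (fun r om => inner (D r om) (j phi)) p = inner (j (Z p)) (j phi)}.

Let alpha phi r om := a2 r (z r om) phi + inner (a r (j (z r om))) (j phi).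
Let beta phi r om := inner (B r (z r om) + b r (j (z r om))) (j phi).
(** The coefficients [alpha'], [beta'] may be computed along the H-valued states, which agree with
    [j z] only almost everywhere; hence the separate processes and the almost-everywhere links. *)
Hypothesis Deq : forall phi, exists alpha' beta' : R -> Om -> R,
  [/\ sqint M (cut t T alpha'),
   {ae P, forall om, {ae mu, forall r, t <= r <= T -> alpha' r om = alpha phi r om}},
   {ae M, forall p, cut t T beta' p = cut t T (beta phi) p} &
   forall s, t <= s <= T -> exists2 J, ito P w t s beta' J &
     {ae P, forall om, inner (D s om) (j phi) = tint t s alpha' om + J om}].

Let l_alpha phi r v := a2 r v phi + inner (a r (j v)) (j phi).
Let l_beta phi r v := inner (B r v + b r (j v)) (j phi).

Let l_alpha_lin phi r : linear (l_alpha phi r : V -> R^o).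
Proof.
move=> c x y; rewrite /l_alpha linearP al a2r innerDl innerZl /GRing.scale/=; ring.
Qed.

Let l_beta_lin phi r : linear (l_beta phi r : V -> R^o).
Proof.
move=> c x y; rewrite /l_beta linearP bl Bl !(innerDl, innerZl) /GRing.scale/=; ring.
Qed.

Let K2 := K * K.
Let l_alpha_bound phi r v : `|l_alpha phi r v| <= (K * `|phi| + K2 * `|j phi|) * `|v|.
Proof.
rewrite /l_alpha (le_trans (ler_normD _ _))// mulrDl lerD//.
  by apply: le_trans (a2b _ _ _) _; rewrite mulrAC.
apply: le_trans (inner_CS _ _) _; rewrite mulrAC ler_wpM2r// (le_trans (ab _ _))//.
by rewrite -mulrA ler_wpM2l.
Qed.

Let l_beta_bound phi r v : `|l_beta phi r v| <= (K * `|j phi| + K2 * `|j phi|) * `|v|.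
Proof.
rewrite /l_beta (le_trans (inner_CS _ _))// -mulrDl mulrAC ler_wpM2r//.
rewrite mulrDl (le_trans (ler_normD _ _))// lerD// (le_trans (bb _ _))//.
by rewrite -mulrA ler_wpM2l.
Qed.

Let l_alpha_meas phi v : measurable_fun setT (fun r => l_alpha phi r v).
Proof. by apply: measurable_funD. Qed.

Let l_beta_meas phi v : measurable_fun setT (fun r => l_beta phi r v).
Proof.
have -> : (fun r => l_beta phi r v) = fun r => inner (B r v) (j phi) + inner (b r (j v)) (j phi).
  by apply/funext => r; rewrite /l_beta innerDl.
exact: measurable_funD.
Qed.

Let meas_form (l : R -> V -> R) C : (forall r, linear (l r : V -> R^o)) ->
  (forall r v, `|l r v| <= C * `|v|) -> (forall v, measurable_fun setT (l ^~ v)) ->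
  sqint M (fun p => l p.1 (Z p)).
Proof.
move=> ll lb lm; apply: sqint_le (sqintZ C sz) => [|p].
  apply: (@measurable_linear_form _ _ _ _ sV (fun p : R * Om => l p.1) (fun p => Z p)) => //.
  - by move=> p; exists C.
  - by move=> v; apply: (measurableT_comp (lm v)).
by rewrite normrM normr_id (le_trans (lb _ _))// ler_wpM2r// ler_norm.
Qed.

Let sqint_alpha phi : sqint M (fun p => alpha phi p.1 p.2).
Proof. exact: (meas_form (@l_alpha_lin phi) (l_alpha_bound phi) (@l_alpha_meas phi)). Qed.

Let sqint_beta phi : sqint M (fun p => beta phi p.1 p.2).
Proof. exact: (meas_form (@l_beta_lin phi) (l_beta_bound phi) (@l_beta_meas phi)). Qed.

Let sqint_jz phi : sqint M (fun p => inner (j (Z p)) (j phi)).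
Proof.
apply: (@meas_form (fun _ v => inner (j v) (j phi)) (K * `|j phi|)).
- by move=> _ c x y; rewrite linearP innerDl innerZl.
- by move=> _ v; rewrite (le_trans (inner_CS _ _))// mulrAC ler_wpM2r.
- by move=> v; exact: measurable_cst.
Qed.

Let sqint_normj : sqint M (fun p => `|j (Z p)|).
Proof.
apply: sqint_le (sqintZ K sz) => [|p]; last by rewrite !normr_id normrM normr_id ger0_norm.
have -> : (fun p => `|j (Z p)|) = fun p => Num.sqrt (inner (j (Z p)) (j (Z p))).
  by apply/funext => p; rewrite inner_norm sqrtr_sqr normr_id.
apply: (measurableT_comp (continuous_measurable_fun (@sqrt_continuous R))).
apply: (@measurable_linear_form _ _ _ _ sV (fun p v => inner (j (Z p)) (j v)) (fun p => Z p)) => //.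
- by move=> p c x y; rewrite linearP innerDr innerZr.
- move=> p; exists (`|j (Z p)| * K) => v; rewrite (le_trans (inner_CS _ _))// -mulrA ler_wpM2l//.
- by move=> v; case: (sqint_jz v).
Qed.

Let sqint_cutT s u (g : R -> Om -> R) : sqint M (fun p => g p.1 p.2) -> sqint M (cut s u g).
Proof.
apply: (@sqint_mull _ _ _ _ _ _ 1).
  by apply: (measurableT_comp (f := \1_`[s, u] : R -> R)) => //; exact: measurable_indic.
by move=> x; rewrite indicE; case: (_ \in _); rewrite ?normr1 ?normr0.
Qed.

Let integrable_cut2 s u :
  M.-integrable setT (EFin \o cut s u (fun r om => `|j (z r om)| ^+ 2)).
Proof.
have h := @sqint_cutT s u (fun r om => `|j (z r om)|) sqint_normj.
have := sqint_integrableM h h; apply: eq_integrable => // p _ /=; congr EFin.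
by rewrite cutM; congr cut.
Qed.

Let Fm_alpha phi r : t <= r <= T -> Fm P w r (alpha phi r).
Proof.
move=> rT; apply: (@measurable_linear_form _ (filtType P w r) _ _ sV (fun=> l_alpha phi r) (z r)) => //.
- by move=> _; exists (K * `|phi| + K2 * `|j phi|); exact: l_alpha_bound.
- by move=> y; exact: Fmz.
Qed.

Let xi phi r om := inner (D r om) (j phi).

Let sqint_xi phi : sqint M (cut t T (xi phi)).
Proof.
by apply: (@sqint_aeeq _ _ _ M _ _ _ (sqint_jz phi)); [exact: mD|exact: Dz].
Qed.

Let Deq' phi s : t <= s <= T -> exists2 J, ito P w t s (beta phi) J &
  {ae P, forall om, xi phi s om = tint t s (alpha phi) om + J om}.
Proof.
have [al' [be' [sal aal abe eqs]]] := Deq phi.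
move=> sT; have [J iJ eqJ] := eqs s sT; case/andP: sT => ts sT; exists J.
  apply: (ito_ae w_bm ts sT iJ); first exact: sqint_cutT.
  by apply: ae_mono abe => p; rewrite !(cut_sub t _ _ sT) => ->.
have i1 := integrable_slice_cut (sqint_cut_sub sT sal).
have i2 := integrable_slice_cut (sqint_cutT t s (sqint_alpha phi)).
apply: ae_mono (filterI eqJ (filterI aal (filterI i1 i2))) => om [eom [aom [iom1 iom2]]].
rewrite /xi eom; congr (_ + _); apply: tint_ae => //.
by apply: ae_mono aom => r ar /andP[tr rs]; apply: ar; rewrite tr (le_trans rs).
Qed.

(** At the fixed time s the coordinate is that of [D], which is meaningful at every time; under the
    time integral it is exchanged for that of [j z]. *)
Let product_formula phi s : t <= s <= T ->
  ip P (xi phi s) (xi phi s) =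
  2 * ip M (cut t s (alpha phi)) (cut t s (fun r om => inner (j (z r om)) (j phi))) +
  ip M (cut t s (beta phi)) (cut t s (beta phi)).
Proof.
move=> /andP[ts sT]; have rs r : t <= r <= s -> t <= r <= T.
  by move=> /andP[-> rs]; rewrite (le_trans rs).
rewrite (ito_product_formula w_bm (xi := xi phi) (alpha := alpha phi) (beta := beta phi) t0 ts sT).
- congr (2 * _ + _); apply: ip_ae.
  + exact: sqint_cutT.
  + exact: (sqint_cut_sub sT (sqint_xi phi)).
  + exact: sqint_cutT.
  + exact: (sqint_cutT t s (sqint_jz phi)).
  + apply: ae_mono (Dz phi) => p Dp; congr (_ * _).
    rewrite (cut_sub _ _ _ sT) (cut_sub t _ _ sT); congr (_ * _).
    by rewrite Dp /cut -/(Z p) -Dp /cut mulrA indicM.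
- by move=> r /rs; exact: sD.
- by move=> r /rs; exact: Deq'.
- exact: (sqint_cut_sub sT (sqint_xi phi)).
- exact: sqint_cutT.
- by move=> r /rs; exact: Fm_alpha.
Qed.

Variable dn : nat -> V.
Hypothesis dense_dn : forall x (e : R), 0 < e -> exists n, `|x - dn n| < e.

Section fixed_parameter.
Variables (ep : R) (ep0 : 0 < ep).
Local Notation f := (smooth_basis j dn ep).

(** The error of [energy_bound] for the bilinear form at [Z p]. *)
Let eN N p := a2 p.1 (Z p) (smooth j dn ep (j (Z p)) N - Z p).

Let sqint_a2 phi : sqint M (fun p => a2 p.1 (Z p) phi).
Proof.
apply: (@meas_form (fun r v => a2 r v phi) (K * `|phi|)) => [r|r v|v].
- exact: a2r.
- by rewrite mulrAC.
- exact: ma2.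
Qed.

Let measurable_eN N : measurable_fun setT (eN N).
Proof.
have -> : eN N = fun p => \sum_(i < N) inner (j (Z p)) (j (f i)) * a2 p.1 (Z p) (f i) - a2 p.1 (Z p) (Z p).
  apply/funext => p; rewrite /eN addrC -scaleN1r a2l.
  rewrite (linear_sumE N (fun i => inner (j (Z p)) (j (f i))) f (@a2l p.1 (Z p))) /GRing.scale/=; ring.
apply: measurable_funB.
  apply: measurable_sum => i; apply: measurable_funM.
    by case: (sqint_jz (f i)).
  by case: (sqint_a2 (f i)).
apply: (@measurable_linear_form _ _ _ _ sV (fun p => a2 p.1 (Z p)) (fun p => Z p)) => //.
- by move=> p; exists (K * `|Z p|) => v.
- by move=> v; case: (sqint_a2 v).
Qed.

(** Uniform in [N] for fixed ep, which permits dominated convergence; the factor sqrt(1/ep) K comes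
    from [norm_smooth_le] and |j z| <= K |z|. It blows up with ep, so this bound is of no help in
    the later limit. *)
Let eN_bound N p : `|eN N p| <= K * (Num.sqrt ep^-1 * K + 1) * `|Z p| ^+ 2.
Proof.
apply: le_trans (a2b _ _ _) _; rewrite -mulrA -[X in _ <= X]mulrA ler_wpM2l// expr2 mulrCA ler_wpM2l//.
rewrite mulrDl mul1r (le_trans (ler_normB _ _))// lerD2r.
have h := norm_smooth_le j dn ep0 (j (Z p)) N.
rewrite -(ler_pXn2r (n := 2)) ?nnegrE ?mulr_ge0 ?sqrtr_ge0//.
rewrite !exprMn sqr_sqrtr ?invr_ge0 ?(ltW ep0)// -mulrA ler_pdivlMl//.
by apply: le_trans h _; rewrite -exprMn ler_pXn2r ?nnegrE ?mulr_ge0.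
Qed.

Let integrable_Z2 C : M.-integrable setT (EFin \o fun p => C * `|Z p| ^+ 2).
Proof.
exact: (integrableZl measurableT C (sqint_integrable2 sz)).
Qed.

Let integrable_eN N : M.-integrable setT (EFin \o fun p => `|eN N p|).
Proof.
apply: (le_integrable measurableT _ _ (integrable_Z2 (K * (Num.sqrt ep^-1 * K + 1)))).
  by apply/measurable_EFinP; apply: (measurableT_comp _ (measurable_eN N)).
by move=> p _ /=; rewrite lee_fin normr_id (le_trans (eN_bound N p)) ?ler_norm.
Qed.

(** Once the product formula is summed over the first N basis vectors, [energy_bound] applies
    pointwise to the integrand. *)
Let energy s N : t <= s <= T ->
  \sum_(i < N) ip P (xi (f i) s) (xi (f i) s) <=
  energy_cst de K * \int[M]_p (cut t s (fun r om => `|j (z r om)| ^+ 2) p) +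
  2 * \int[M]_p `|eN N p|.
Proof.
move=> tsT.
pose G i p := 2 * (cut t s (alpha (f i)) p * cut t s (fun r om => inner (j (z r om)) (j (f i))) p) +
  cut t s (beta (f i)) p * cut t s (beta (f i)) p.
have i1 i : M.-integrable setT (EFin \o fun p => cut t s (alpha (f i)) p *
    cut t s (fun r om => inner (j (z r om)) (j (f i))) p).
  by apply: sqint_integrableM; [exact: sqint_cutT|exact: (sqint_cutT t s (sqint_jz (f i)))].
have i12 i := integrableZl measurableT 2 (i1 i).
have i2 i : M.-integrable setT (EFin \o fun p => cut t s (beta (f i)) p * cut t s (beta (f i)) p).
  by apply: sqint_integrableM; exact: sqint_cutT.
have iG i : M.-integrable setT (EFin \o G i) by exact: (integrableD measurableT (i12 i) (i2 i)).
have [iSG ESG] := sum_Rintegral N iG.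
have -> : \sum_(i < N) ip P (xi (f i) s) (xi (f i) s) = \int[M]_p \sum_(i < N) G i p.
  rewrite ESG; apply: eq_bigr => i _; rewrite product_formula//.
  by rewrite /G (RintegralD measurableT (i12 i) (i2 i)) (RintegralZl 2 measurableT (i1 i)).
have i3 := integrableZl measurableT (energy_cst de K) (integrable_cut2 t s).
have i4 := integrableZl measurableT 2 (integrable_eN N).
rewrite -RintegralZl ?integrable_cut2// -RintegralZl// -RintegralD//.
apply: le_Rintegral => //; first exact: (integrableD measurableT i3 i4).
move=> p _; rewrite /G /cut indicE; case: (boolP (_ \in _)) => [|_]; last first.
  rewrite !mul0r mulr0 add0r big1 ?mulr_ge0// => i _; by rewrite !mul0r mulr0 addr0.
rewrite inE/= in_itv/= => /andP[tp ps]; rewrite !mul1r.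
under eq_bigr do rewrite !mul1r.
apply: le_trans (energy_bound (Bx := B p.1 (Z p)) (ax := a p.1 (j (Z p))) (bx := b p.1 (j (Z p))) dn ep0 N (@a2l p.1 (Z p)) de0 K0 _ _ _ _) _ => //.
  by apply: coer; rewrite tp (le_trans ps)//; case/andP : tsT.
by rewrite addrC lerD2l ler_pM2l// ler_norm.
Qed.

(** [energy] at a fixed time is integrated over [s, u]; [Dz] turns coordinates of [D] into those of
    [j z], and the energy up to an intermediate time is enlarged to the one up to u. *)
Let slice_le s u N : t <= s -> s <= u -> u <= T ->
  \sum_(i < N) ip M (cut s u (fun r om => inner (j (z r om)) (j (f i))))
                   (cut s u (fun r om => inner (j (z r om)) (j (f i)))) <=
  (u - s) * (energy_cst de K * \int[M]_p (cut t u (fun r om => `|j (z r om)| ^+ 2) p) +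
  2 * \int[M]_p `|eN N p|).
Proof.
move=> ts su uT; pose g phi r om := cut t T (xi phi) (r, om).
have sg phi : sqint M (cut s u (g phi)).
  apply: sqint_cutT; have := sqint_xi phi; congr sqint; apply/funext => -[r om]//.
have q i : ip M (cut s u (fun r om => inner (j (z r om)) (j (f i))))
     (cut s u (fun r om => inner (j (z r om)) (j (f i)))) =
   \int[mu]_r (\1_`[s, u] r * ip P (xi (f i) r) (xi (f i) r)).
  transitivity (ip M (cut s u (g (f i))) (cut s u (g (f i)))).
    have s1 := @sqint_cutT s u (fun r om => inner (j (z r om)) (j (f i))) (sqint_jz (f i)).
    apply: (ip_ae s1 s1 (sg _) (sg _)); apply: ae_mono (Dz (f i)) => -[r om] Dp.
    by rewrite /cut/= /g Dp.
  rewrite ip_slices//; apply: eq_Rintegral => r _.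
  rewrite ip_slice_cut ipC ip_slice_cut mulrA indicM.
  rewrite indicE; case: (boolP (_ \in _)) => [|_]; last by rewrite !mul0r.
  rewrite inE/= in_itv/= => /andP[sr ru]; rewrite !mul1r.
  rewrite ip_slice_cut ipC ip_slice_cut mulrA indicM indicE mem_set ?mul1r//=.
  by rewrite in_itv/= (le_trans ts sr) (le_trans ru uT).
under eq_bigr do rewrite q.
have iq i : mu.-integrable setT (EFin \o fun r => \1_`[s, u] r * ip P (xi (f i) r) (xi (f i) r)).
  have := integrable_slices (sg (f i)) (sg (f i)); apply: eq_integrable => // r _ /=; congr EFin.
  rewrite ip_slice_cut ipC ip_slice_cut mulrA indicM.
  rewrite indicE; case: (boolP (_ \in _)) => [|_]; last by rewrite !mul0r.
  rewrite inE/= in_itv/= => /andP[sr ru]; rewrite !mul1r.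
  rewrite ip_slice_cut ipC ip_slice_cut mulrA indicM indicE mem_set ?mul1r//=.
  by rewrite in_itv/= (le_trans ts sr) (le_trans ru uT).
have [i1 <-] := sum_Rintegral N iq.
set C := (X in _ <= _ * X).
rewrite -(Rintegral_indic_itv su) mulrC -RintegralZl ?integrable_indic_itv//.
apply: le_Rintegral => //.
  exact: (integrableZl measurableT C (integrable_indic_itv s u)).
move=> r _; rewrite indicE; case: (boolP (_ \in _)) => [|_]; last first.
  by rewrite mulr0 big1// => i _; rewrite mul0r.
rewrite inE/= in_itv/= => /andP[sr ru]; rewrite mulr1.
under eq_bigr do rewrite mul1r.
apply: le_trans (energy _ _) _; first by rewrite (le_trans ts sr) (le_trans ru uT).
rewrite lerD2r ler_wpM2l//; first by rewrite /energy_cst !addr_ge0// ?divr_ge0// ?sqr_ge0// ?ltW.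
apply: le_Rintegral => //; try exact: integrable_cut2.
move=> p _; rewrite (cut_sub _ _ _ ru) ler_piMl//.
  by rewrite /cut mulr_ge0 ?sqr_ge0// indicE.
by rewrite lern1 leq_b1.
Qed.

(** The limit N -> infinity of [slice_le]: the sum of squared coordinates is <j z, j (smooth ...)>,
    bounded by |j z|², and both sides converge by domination. *)
Lemma smoothed_energy s u : t <= s -> s <= u -> u <= T ->
  [/\ M.-integrable setT (EFin \o fun p => `|a2 p.1 (Z p) (smoothing j dn ep (Z p) - Z p)|),
   M.-integrable setT (EFin \o cut s u (fun r om => inner (j (z r om)) (j (smoothing j dn ep (z r om))))) &
  \int[M]_p (cut s u (fun r om => inner (j (z r om)) (j (smoothing j dn ep (z r om)))) p) <=
  (u - s) * (energy_cst de K * \int[M]_p (cut t u (fun r om => `|j (z r om)| ^+ 2) p) +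
  2 * \int[M]_p `|a2 p.1 (Z p) (smoothing j dn ep (Z p) - Z p)|)].
Proof.
move=> ts su uT.
have jl : linear j by move=> c x y; rewrite linearP.
have ce p : (fun N => `|eN N p|) @ \oo --> `|a2 p.1 (Z p) (smoothing j dn ep (Z p) - Z p)|.
  apply: cvg_norm; apply: (@cvg_linear _ V R^o (a2 p.1 (Z p)) (K * `|Z p|) _ _ (@a2l _ _)) => //.
  by apply: cvgB; [exact: cvg_smoothing|exact: cvg_cst].
have me N : measurable_fun setT (fun p => `|eN N p|) by exact: measurableT_comp (measurable_eN N).
have be N p : `| `|eN N p| | <= K * (Num.sqrt ep^-1 * K + 1) * `|Z p| ^+ 2 by rewrite normr_id.
have [i1 c1] := @Rintegral_dominated _ _ _ M _ _ _ me ce (integrable_Z2 _) be.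
pose F N p := cut s u (fun r om => \sum_(i < N) inner (j (z r om)) (j (f i)) ^+ 2) p.
have iF i : M.-integrable setT (EFin \o fun p => cut s u (fun r om => inner (j (z r om)) (j (f i))) p *
    cut s u (fun r om => inner (j (z r om)) (j (f i))) p).
  by have s1 := @sqint_cutT s u (fun r om => inner (j (z r om)) (j (f i))) (sqint_jz (f i)); exact: sqint_integrableM.
have FE N p : F N p = \sum_(i < N) (cut s u (fun r om => inner (j (z r om)) (j (f i))) p *
    cut s u (fun r om => inner (j (z r om)) (j (f i))) p).
  by rewrite /F /cut mulr_sumr; apply: eq_bigr => i _; rewrite mulrACA indicM expr2.
have mF N : measurable_fun setT (F N).
  have [/(@measurable_int _ _ _ _ _ _)/measurable_EFinP + _] := sum_Rintegral N iF.
  by apply: eq_measurable_fun => p _; rewrite FE.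
have cF p : F ^~ p @ \oo --> cut s u (fun r om => inner (j (z r om)) (j (smoothing j dn ep (z r om)))) p.
  rewrite /F /cut; apply: cvgMl_tmp.
  have -> : (fun N => \sum_(i < N) inner (j (Z p)) (j (f i)) ^+ 2) =
      fun N => inner (j (Z p)) (j (smooth j dn ep (j (Z p)) N)).
    apply/funext => N; rewrite /smooth linear_sum innerC inner_suml; apply: eq_bigr => i _.
    have -> : j (inner (j (Z p)) (j (f i)) *: f i) = inner (j (Z p)) (j (f i)) *: j (f i) by rewrite linearZ.
    by rewrite innerZl (innerC (j (f i))) expr2.
  have h1 : (fun N => j (smooth j dn ep (j (Z p)) N)) @ \oo --> j (smoothing j dn ep (Z p)).
    exact: (@cvg_linear _ V H j K _ _ jl jK (cvg_smoothing ep0 (x := Z p))).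
  apply: (@cvg_linear _ H R^o (fun y => inner (j (Z p)) y) `|j (Z p)| _ _ _ _ h1).
    by move=> c x y; rewrite innerDr innerZr.
  by move=> y; exact: inner_CS.
have bF N p : `|F N p| <= cut s u (fun r om => `|j (z r om)| ^+ 2) p.
  rewrite /F /cut normrM ger0_norm ?indicE// ler_wpM2l// ger0_norm ?sumr_ge0//.
    exact: sum_smooth_basis_le.
  by move=> i _; exact: sqr_ge0.
have [i2 c2] := @Rintegral_dominated _ _ _ M _ _ _ mF cF (integrable_cut2 s u) bF.
split => //.
  set I := \int[M]_p (cut t u _ p).
  have c3 : (fun N => (u - s) * (energy_cst de K * I + 2 * \int[M]_p `|eN N p|)) @ \oo -->
      (u - s) * (energy_cst de K * I + 2 * \int[M]_p `|a2 p.1 (Z p) (smoothing j dn ep (Z p) - Z p)|).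
    by apply: cvgMl_tmp; apply: cvgD; [exact: cvg_cst|exact: cvgMl_tmp].
  apply: (ler_cvg_to c2 c3); apply: nearW => N; apply: le_trans (slice_le N ts su uT).
  have [_ <-] := sum_Rintegral N iF.
  by rewrite le_eqVlt; apply/orP; left; apply/eqP; apply: eq_Rintegral => p _; rewrite FE.
Qed.

End fixed_parameter.

Let ep m : R := m.+1%:R^-1.
Let ep0 m : 0 < ep m. Proof. by rewrite invr_gt0. Qed.
Let S m x := smoothing j dn (ep m) x.

Let cvg_jS x : (fun m => `|j (x - S m x)|) @ \oo --> (0 : R).
Proof.
have c2 : (fun m => `|j (x - S m x)| ^+ 2) @ \oo --> (0 : R).
  apply: (@cvg0_le _ (fun m => ep m * `|x| ^+ 2)).
    by move=> m; rewrite sqr_ge0/= (smoothing_normj jK dense_dn (ep0 m)).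
  rewrite -[X in _ --> X](mul0r (`|x| ^+ 2)); apply: cvgMr_tmp; exact: cvg_harmonic.
have -> : (fun m => `|j (x - S m x)|) = fun m => Num.sqrt (`|j (x - S m x)| ^+ 2).
  by apply/funext => m /=; rewrite sqrtr_sqr normr_id.
by rewrite -[X in _ --> X](@sqrtr0 R); apply: (continuous_cvg _ _ c2); exact: sqrt_continuous.
Qed.

(* The smoothing parameter has been sent to 0 by the weak limit argument; what
   remains is the Gronwall inequality of the energy. *)
Let energy_step s u : t <= s -> s <= u -> u <= T ->
  \int[M]_p (cut s u (fun r om => `|j (z r om)| ^+ 2) p) <=
  (u - s) * (energy_cst de K * \int[M]_p (cut t u (fun r om => `|j (z r om)| ^+ 2) p)).
Proof.
move=> ts su uT.
pose G m p := `|a2 p.1 (Z p) (S m (Z p) - Z p)|.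
pose F m := cut s u (fun r om => inner (j (z r om)) (j (S m (z r om)))).
have iGFle m := smoothed_energy (ep0 m) ts su uT.
have mG m : measurable_fun setT (G m).
  by have [/(@measurable_int _ _ _ _ _ _)/measurable_EFinP + _ _] := iGFle m.
have mF m : measurable_fun setT (F m).
  by have [_ /(@measurable_int _ _ _ _ _ _)/measurable_EFinP + _] := iGFle m.
have Sx m x : `|S m x - x| <= `|x| by rewrite distrC (smoothing_norm jK dense_dn (ep0 m)).
have bG m p : `|G m p| <= K * `|Z p| ^+ 2.
  by rewrite normr_id (le_trans (a2b _ _ _))// -mulrA ler_wpM2l// expr2 ler_wpM2l.
have bF m p : `|F m p| <= cut s u (fun r om => (K * K + K * K) * `|z r om| ^+ 2) p.
  rewrite /F /cut normrM ger0_norm ?indicE// ler_wpM2l//.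
  rewrite (le_trans (inner_CS _ _))// expr2 [X in _ <= X](_ : _ = (K * `|Z p|) * (K * (`|Z p| + `|Z p|))); last by ring.
  apply: ler_pM => //; rewrite (le_trans (jK _))// ler_wpM2l//.
  by rewrite -[S m _](subrK (Z p)) (le_trans (ler_normD _ _))// lerD2r.
(* [S m (Z p) - Z p] is bounded by |Z p| in V and tends to 0 in H, which is the situation of
   [small_on_weakly_null]. *)
have cG p : G ^~ p @ \oo --> (0 : R).
  apply/cvgr0Pnorm_lt => c c0.
  have [k k0 Hk] := small_on_weakly_null (j := j) (f := a2 p.1 (Z p)) (linearP j) jK j_inj (@a2l _ _) (a2b p.1 (Z p)) `|Z p| c0.
  have /cvgr0Pnorm_lt/(_ _ k0) := cvg_jS (Z p); apply: filterS => m.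
  rewrite normr_id -normrN -linearN opprB => /ltW jk.
  by rewrite normr_id; apply: Hk.
have cF p : F ^~ p @ \oo --> cut s u (fun r om => `|j (z r om)| ^+ 2) p.
  apply: cvgMl_tmp; rewrite -inner_norm.
  apply: (@cvg_linear _ H R^o (fun y => inner (j (Z p)) y) `|j (Z p)| (fun m => j (S m (Z p)))).
  - by move=> c x y; rewrite innerDr innerZr.
  - by move=> y; exact: inner_CS.
  - apply/cvgrPdist_lt => c c0; have /cvgr0Pnorm_lt/(_ _ c0) := cvg_jS (Z p).
    by apply: filterS => m; rewrite normr_id linearB.
have iZ2 := integrableZl measurableT K (sqint_integrable2 sz).
have [_ c1] := @Rintegral_dominated _ _ _ M _ _ _ mG cG iZ2 bG.
have iz2 : M.-integrable setT (EFin \o cut s u (fun r om => (K * K + K * K) * `|z r om| ^+ 2)).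
  have s1 := @sqint_cutT s u (fun r om => `|z r om|) sz.
  have := integrableZl measurableT (K * K + K * K) (sqint_integrableM s1 s1).
  by apply: eq_integrable => // p _ /=; congr EFin; rewrite cutM /cut expr2; ring.
have [_ c2] := @Rintegral_dominated _ _ _ M _ _ _ mF cF iz2 bF.
set I := \int[M]_p (cut t u _ p).
have c3 : (fun m => (u - s) * (energy_cst de K * I + 2 * \int[M]_p G m p)) @ \oo -->
    (u - s) * (energy_cst de K * I).
  apply: cvgMl_tmp; rewrite -[Y in _ --> Y]addr0; apply: cvgD; first exact: cvg_cst.
  rewrite -[Y in _ --> Y](mulr0 2); apply: cvgMl_tmp.
  by move: c1; rewrite /Rintegral integral0.
by apply: (ler_cvg_to c2 c3); apply: nearW => m; have [] := iGFle m.
Qed.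

Let I u := \int[M]_p (cut t u (fun r om => `|j (z r om)| ^+ 2) p).

(** On a short interval the Gronwall inequality reads I u <= I s + I u / 2. *)
Let energy_vanishes s u : t <= s -> s <= u -> u <= T ->
  (u - s) * energy_cst de K <= 2^-1 -> I s = 0 -> I u = 0.
Proof.
move=> ts su uT h Is.
have I0 : 0 <= I u.
  by apply: Rintegral_ge0 => p _; rewrite /cut mulr_ge0 ?sqr_ge0// indicE.
have h1 : I u <= I s + \int[M]_p (cut s u (fun r om => `|j (z r om)| ^+ 2) p).
  rewrite -RintegralD ?integrable_cut2//; apply: le_Rintegral => //.
  - exact: (integrableD measurableT (integrable_cut2 t s) (integrable_cut2 s u)).
  - move=> p _; rewrite /cut -mulrDl ler_wpM2r ?sqr_ge0// !indicE !mem_setE !in_itv/=.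
    have := le_total p.1 s; case: (lerP p.1 s) => ps; case: (lerP p.1 u) => pu; case: (lerP t p.1) => tp;
    case: (lerP s p.1) => sp //=; rewrite ?addr0 ?add0r ?lerDl//; lra.
have h2 := energy_step ts su uT; rewrite -/(I u) in h2.
apply: le_anti; rewrite I0 andbT.
have h3 : (u - s) * (energy_cst de K * I u) <= 2^-1 * I u by rewrite mulrA ler_wpM2r.
lra.
Qed.

Let energy0 : I T = 0.
Proof.
(* With n + 1 equal steps each one is short enough for [energy_vanishes]. *)
have [n nP] : exists n : nat, (T - t) * energy_cst de K <= 2^-1 * n.+1%:R.
  have [n /ltW nP] : exists n : nat, 2 * ((T - t) * energy_cst de K) < n%:R.
    by exists (Num.truncn (2 * ((T - t) * energy_cst de K))).+1; exact: truncnS_gt.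
  by exists n; rewrite -ler_pdivrMl// invrK (le_trans nP)// ler_nat.
pose h := (T - t) / n.+1%:R.
have h0 : 0 <= h by rewrite divr_ge0// subr_ge0.
suff : forall i, (i <= n.+1)%N -> I (t + i%:R * h) = 0.
  by move=> /(_ n.+1 (leqnn _)); rewrite /h mulrC divfK ?pnatr_eq0// addrC subrK.
elim=> [_|i ih ilt].
  rewrite mul0r addr0; apply: le_anti; rewrite /I.
  (* On the degenerate interval [t, t] the factor u - s is 0, which starts the induction. *)
  have := energy_step (lexx t) (lexx t) tT; rewrite subrr mul0r => ->/=.
  by apply: Rintegral_ge0 => p _; rewrite /cut mulr_ge0 ?sqr_ge0// indicE.
have ih' x : x <= n.+1%:R -> t + x * h <= T.
  move=> xn; rewrite -lerBrDl (le_trans (ler_wpM2r h0 xn))// /h mulrC divfK// pnatr_eq0//.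
apply: (energy_vanishes _ _ _ _ (ih (ltnW ilt))).
- by rewrite lerDl mulr_ge0.
- by rewrite lerD2l ler_wpM2r// ler_nat.
- by apply: ih'; rewrite ler_nat.
- rewrite opprD addrACA subrr add0r -mulrBl -natrB// subSnn mul1r /h mulrAC ler_pdivrMr//.
Qed.

Lemma homogeneous_state_ae0 : {ae M, forall p, Z p = 0}.
Proof.
have : ip M (cut t T (fun r om => `|j (z r om)|)) (cut t T (fun r om => `|j (z r om)|)) = 0.
  rewrite -[RHS]energy0; apply: eq_Rintegral => p _.
  by rewrite cutM /cut expr2.
move/(ip_eq0 (@sqint_cutT t T (fun r om => `|j (z r om)|) sqint_normj)).
apply: ae_mono => p; rewrite /cut indicE mem_setE in_itv/=.
have [pT|pT] := boolP (t <= p.1 <= T); last by rewrite z0.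
by rewrite mul1r => /eqP; rewrite normr_eq0 => /eqP/j_inj.
Qed.

(** The product formula at the fixed time s has both terms zero because [z] vanishes almost
    everywhere; so every coordinate of [D s] vanishes almost surely, and countably many coordinates
    determine it. *)
Lemma homogeneous_state_eq0 s : t <= s <= T -> {ae P, forall om, D s om = 0}.
Proof.
move=> sT; have Z0 := homogeneous_state_ae0.
have xi0 phi : {ae P, forall om, xi phi s om = 0}.
  apply: ip_eq0; first exact: sD.
  rewrite product_formula//.
  have s1 := @sqint_cutT t s (fun r om => inner (j (z r om)) (j phi)) (sqint_jz phi).
  have s2 := sqint_cutT t s (sqint_alpha phi).
  have s3 := sqint_cutT t s (sqint_beta phi).
  have az : {ae M, forall p, cut t s (alpha phi) p = 0}.
    apply: ae_mono Z0 => p Zp; have := l_alpha_bound phi p.1 (Z p).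
    by rewrite /cut /alpha [in X in _ <= X]Zp normr0 mulr0 normr_le0 => /eqP; rewrite /l_alpha => ->; rewrite mulr0.
  have bz : {ae M, forall p, cut t s (beta phi) p = 0}.
    apply: ae_mono Z0 => p Zp; have := l_beta_bound phi p.1 (Z p).
    by rewrite /cut /beta [in X in _ <= X]Zp normr0 mulr0 normr_le0 => /eqP; rewrite /l_beta => ->; rewrite mulr0.
  rewrite (ip_ae0 s3 bz) addr0 (ip_ae s2 s1 (sqint0 _) s1 (f' := fun=> 0)) ?ip0l ?mulr0//.
  by apply: ae_mono az => p ->.
have : {ae P, forall om, forall n, xi (dn n) s om = 0} by apply/ae_foralln => n; exact: xi0.
by apply: ae_mono => om; exact: orthogonal_dense_eq0 j_dense K0 jK dense_dn.
Qed.

End homogeneous_equation.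

(** * The state is affine in the initial datum and the control *)

Lemma sqint_ae_le d (S : measurableType d) (R : realType) (m : {measure set S -> \bar R})
    (f g : S -> R) : measurable_fun setT f -> sqint m g ->
  {ae m, forall x, `|f x| <= `|g x|} -> sqint m f.
Proof.
move=> mf [mg goo] fg; split => //; apply: le_lt_trans goo.
apply: ae_ge0_le_integral => //.
- by move=> x _; rewrite lee_fin sqr_ge0.
- by apply/measurable_EFinP; exact: measurable_funX.
- by move=> x _; rewrite lee_fin sqr_ge0.
- by apply/measurable_EFinP; exact: measurable_funX.
- apply: ae_mono fg => x h _; rewrite lee_fin -(real_normK (num_real (f x))).
  by rewrite -(real_normK (num_real (g x))) ler_pXn2r ?nnegrE.
Qed.

Lemma measurable_fun_indic_restrict d (S : measurableType d) (R : realType) (D : set S) (f : S -> R) :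
  measurable D -> measurable_fun D f -> measurable_fun setT (fun p => \1_D p * f p).
Proof.
move=> mD mf; have -> : (fun p => \1_D p * f p) = f \_ D.
  by apply/funext => p; rewrite patchE indicE; case: (_ \in _); rewrite ?mul1r ?mul0r.
exact/(measurable_restrictT _ mD).
Qed.

Lemma measurable_wrt_cst d (S : measurableType d) (D : set S) (X : topologicalType) (x : X) :
  measurable D -> measurable_wrt measurable D (fun=> x).
Proof.
move=> mD; apply: measurable_wrt_open => // O _; have [Ox|Ox] := pselect (O x).
  by rewrite (_ : _ `&` _ = D)//; apply/seteqP; split => p /=; tauto.
by rewrite (_ : _ `&` _ = set0)//; apply/seteqP; split => p /=; tauto.
Qed.

Lemma inner_continuous (R : realType) (K : hilbertType R) (y : K) : continuous (fun x => inner x y).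
Proof.
move=> x; apply/cvgrPdist_lt => e e0.
have y1 : 0 < `|y| + 1 by rewrite ltr_wpDl.
near=> z; rewrite -innerBl (le_lt_trans (inner_CS _ _))//.
apply: le_lt_trans (_ : `|x - z| * (`|y| + 1) < _); first by rewrite ler_wpM2l// lerDl.
rewrite -ltr_pdivlMr//; near: z; apply: cvgr_dist_lt; rewrite ?divr_gt0//.
Unshelve. all: by end_near. Qed.

(** By Tonelli the integral of |g| vanishes. This passes from statements for almost every path and
    almost every time to statements on the product. *)
Lemma ae_prod d1 d2 (T1 : measurableType d1) (T2 : measurableType d2) (R : realType)
    (m1 : {sigma_finite_measure set T1 -> \bar R})
    (m2 : {sigma_finite_measure set T2 -> \bar R}) (g : T1 * T2 -> R) : measurable_fun setT g ->
  {ae m2, forall y, {ae m1, forall x, g (x, y) = 0}} -> {ae (m1 \x m2)%E, forall p, g p = 0}.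
Proof.
move=> mg g0.
have mg1 : measurable_fun setT (fun p => `|(g p)%:E|%E) by apply: measurableT_comp => //; exact/measurable_EFinP.
have g1 p : (0 <= `|(g p)%:E|)%E by [].
have : (\int[(m1 \x m2)%E]_p `|(g p)%:E| = 0)%E.
  rewrite fubini_tonelli1// fubini_tonelli//.
  transitivity (\int[m2]_y (0 : \bar R))%E; last by rewrite integral0.
  apply: ae_eq_integral => //.
    exact: (measurable_fun_fubini_tonelli_G _ mg1 g1).
  apply: ae_mono g0 => y gy _; rewrite /fubini_F.
  transitivity (\int[m1]_x (0 : \bar R))%E; last by rewrite integral0.
  apply: ae_eq_integral => //; first exact: (measurableT_comp mg1 (measurable_pair2 y)).
  by apply: ae_mono gy => x -> _; rewrite abse0.
move/(ae_eq_integral_abs _ measurableT) => gae.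
have /gae : measurable_fun setT (fun p => (g p)%:E) by exact/measurable_EFinP.
by apply: ae_mono => p /(_ I)[].
Qed.

Section processes.
Context (R : realType) (d : measure_display) (Om : measurableType d).
Context (P : probability Om R) (T : R) (w : R -> Om -> R).
Hypothesis w_bm : brownian_motion P T w.
Local Notation mu := (@lebesgue_measure R).
Local Notation M := (mu \x P)%E.
Local Notation F := (augmented_filtration P w).

(** The sets whose section at time r lies in [F r] form a sigma-algebra that contains the
    rectangles. *)
Lemma progressive_adapted (X : topologicalType) (f : R -> Om -> X) t s r :
  progressive F t s f -> t <= r -> r <= s ->
  measurable_wrt (measurable : set (set (filtType P w r))) setT (f r : filtType P w r -> X).
Proof.
move=> pf tr rs B mB; have := pf r; rewrite tr rs => /(_ isT B mB).
set E := (X in _ X -> _) => EG.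
have -> : setT `&` f r @^-1` B = [set om | E (r, om)].
  rewrite setTI; apply/seteqP; split => om /=; rewrite /E/=; last by case.
  by move=> h; split => //; split => //=; rewrite in_itv/= tr lexx.
apply: (@smallest_sub _ _ _ [set E : set (R * Om) | measurable ([set om | E (r, om)] : set (filtType P w r))]) EG.
  split => /=.
  - exact: measurable0.
  - move=> A mA; rewrite (_ : [set _ | _] = ~` [set om | A (r, om)]); first exact: measurableC.
    by apply/seteqP; split => om /=; tauto.
  - move=> A mA; rewrite (_ : [set _ | _] = \bigcup_i [set om | A i (r, om)]).
      exact: bigcupT_measurable.
    by apply/seteqP; split => om /= [i _ h]; exists i.
move=> _ [I mI [A FA <-]] /=; have [Ir|Ir] := pselect (I r).
  by rewrite (_ : [set om | I r /\ A om] = A)//; apply/seteqP; split => om /=; tauto.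
by rewrite (_ : [set om | I r /\ A om] = set0)//; apply/seteqP; split => om /=; tauto.
Qed.

Lemma progressive_measurable_wrt (X : topologicalType) (f : R -> Om -> X) t s :
  t <= s -> s <= T -> progressive F t s f ->
  measurable_wrt measurable (`[t, s]%classic `*` [set: Om]) (fun p : R * Om => f p.1 p.2).
Proof. by move=> ts sT pf B mB; exact: (progressive_measurable w_bm ts sT pf). Qed.

Lemma measurable_cut (f : R -> Om -> R) (t s : R) :
  measurable_fun (`[t, s]%classic `*` setT) (fun p : R * Om => f p.1 p.2) ->
  measurable_fun setT (cut t s f).
Proof.
move=> mf; have mD : measurable (`[t, s]%classic `*` [set: Om]) by exact: measurableX.
have := measurable_fun_indic_restrict mD mf; apply: eq_measurable_fun => p _.
rewrite /cut; congr (_ * _); rewrite !indicE; congr (_%:R); congr nat_of_bool.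
by apply/idP/idP; rewrite !inE /=; [case|].
Qed.

End processes.

Section pairing.
Context (R : realType) (V H Vs : hilbertType R) (j : {linear V -> H})
  (pair : Vs -> {linear V -> R^o}).
Hypothesis triple : gelfand_triple j pair.

Lemma pairing_bound f v : `|pair f v| <= `|f| * `|v|.
Proof.
have [C C0 pC] := continuous_linearP (@gelfand_pair_continuous _ _ _ _ _ _ triple f).
have [->|v0] := eqVneq v 0; first by rewrite linear0 !normr0 mulr0.
have vp : 0 < `|v| by rewrite normr_gt0.
rewrite (gelfand_pair_norm triple) -ler_pdivrMr//; apply: ub_le_sup.
  exists C => _ [x /= x1 <-]; rewrite (le_trans (pC x))// ler_piMr// ltW//.
exists (`|v|^-1 *: v); first by rewrite /= normrZ normfV normr_id mulVf// gt_eqF.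
by rewrite linearZ/= normrZ normfV normr_id mulrC.
Qed.

Lemma pairing_linear v : linear (pair ^~ v : Vs -> R^o).
Proof. by move=> c f g; rewrite (gelfand_pair_linearl triple). Qed.

Lemma pairing_continuous v : continuous (pair ^~ v : Vs -> R).
Proof.
move=> f; apply/cvgrPdist_lt => e e0.
have v1 : 0 < `|v| + 1 by rewrite ltr_wpDl.
near=> g.
have -> : pair f v - pair g v = pair (f - g) v.
  by rewrite addrC [f - g]addrC -[- g]scaleN1r (gelfand_pair_linearl triple) mulN1r.
rewrite (le_lt_trans (pairing_bound _ _))//.
apply: le_lt_trans (_ : `|f - g| * (`|v| + 1) < _); first by rewrite ler_wpM2l// lerDl.
rewrite -ltr_pdivlMr//; near: g; apply: cvgr_dist_lt; rewrite ?divr_gt0//.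
Unshelve. all: by end_near. Qed.

Lemma embedding_bound : exists2 K, 0 < K & forall x, `|j x| <= K * `|x|.
Proof. exact: continuous_linearP (gelfand_continuous triple). Qed.

End pairing.

Section coefficient.
Context (R : realType) (T : R) (H H1 : hilbertType R) (U : set H1) (v0 : H1) (Uv0 : U v0).
Hypotheses (sH : separable H) (sH1 : separable H1).
Variables (c : R -> H -> H1 -> H) (L : R).
Hypothesis c_lin : linear_coefficient T U c.
Hypothesis c_cont : {within [set p : R * H * H1 | 0 <= p.1.1 <= T /\ U p.2],
    continuous (fun p => c p.1.1 p.1.2 p.2)}.
Hypothesis c_lip : forall t x1 x2 v, 0 <= t <= T -> U v ->
  `|c t x1 v - c t x2 v| <= L * `|x1 - x2|.

(** The part linear in the state, written with [c] at the control [v0] and not with the linear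
    extension: continuity and Lipschitz bounds are given for [c] on U, whereas the extension is only
    known to be linear. *)
Definition hom_part t x := c t x v0 - c t 0 v0.

Lemma coefficient_linear t : 0 <= t <= T -> exists f : H * H1 -> H,
  [/\ linear f, forall x u, U u -> c t x u = f (x, u) & forall x, hom_part t x = f (x, 0)].
Proof.
move=> tT; have [c' [lc' cc']] := c_lin.
have {}lc' := lc' t tT; pose f (p : H * H1) := c' t p.1 p.2.
have fl k p q : f (k *: p + q) = k *: f p + f q by exact: lc'.
exists f; split => //; first by move=> x u Uu; rewrite cc'.
move=> x; rewrite /hom_part !cc'// -[c' t x v0]/(f (x, v0)) -[c' t 0 v0]/(f (0, v0)).
rewrite -scaleN1r addrC -fl; congr f; congr pair; rewrite /= ?scaler0 ?add0r//.
by rewrite scaleN1r addNr.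
Qed.

Lemma hom_part_linear t : 0 <= t <= T -> linear (hom_part t).
Proof.
move=> /coefficient_linear[f [fl _ hf]] k x y; rewrite !hf -fl; congr f; congr pair.
by rewrite /= scaler0 addr0.
Qed.

Lemma hom_partE t l x1 x2 x3 u1 u2 u3 : 0 <= t <= T -> U u1 -> U u2 -> U u3 ->
  u3 = l *: u1 + (1 - l) *: u2 ->
  c t x3 u3 + (- l) *: c t x1 u1 + (- (1 - l)) *: c t x2 u2 =
  hom_part t (x3 + (- l) *: x1 + (- (1 - l)) *: x2).
Proof.
move=> tT U1 U2 U3 u3E; have [f [fl cf hf]] := coefficient_linear tT.
have fD k p q : f p + k *: f q = f (p + k *: q) by rewrite addrC -fl addrC.
rewrite hf !cf// !fD; congr f; congr pair; rewrite /= u3E !scaleNr.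
by rewrite [l *: u1 + _]addrC addrK subrr.
Qed.

Lemma measurable_coefficient d (S : measurableType d) (D : set S) (r : S -> R) (X : S -> H) (u : S -> H1) y :
  measurable D -> measurable_fun D r -> measurable_wrt measurable D X -> measurable_wrt measurable D u ->
  (forall p, D p -> 0 <= r p <= T) -> (forall p, D p -> U (u p)) ->
  measurable_fun D (fun p => inner (c (r p) (X p) (u p)) y).
Proof.
move=> mD mr mX mu rT Uu.
apply/(measurable_wrtP mD).
have m3 : measurable_wrt measurable D (fun p => ((r p, X p), u p)).
  apply: measurable_wrt_pair => //.
  - by apply: has_dense_seq_prod; [exact: has_dense_seq_R|exact: has_dense_seq_separable].
  - exact: has_dense_seq_separable.
  - apply: measurable_wrt_pair => //.
    + exact: has_dense_seq_R.
    + exact: has_dense_seq_separable.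
    + exact/measurable_wrtP.
have h1 : measurable_wrt measurable D (fun p => c (r p) (X p) (u p)).
  apply: (measurable_wrt_comp mD m3 _ c_cont).
  by move=> p Dp /=; split; [exact: rT|exact: Uu].
apply: (measurable_wrt_comp (E := setT) (g := fun x => inner x y) mD h1) => //.
by apply: continuous_subspaceT; exact: inner_continuous.
Qed.

Lemma measurable_hom_part x y :
  measurable_fun `[0, T]%classic (fun r => inner (hom_part r x) y).
Proof.
have mD : measurable (`[0, T]%classic : set R) by [].
have -> : (fun r => inner (hom_part r x) y) = fun r => inner (c r x v0) y - inner (c r 0 v0) y.
  by apply/funext => r; rewrite innerBl.
by apply: measurable_funB; apply: measurable_coefficient => //;
  try exact: measurable_wrt_cst; move=> r; rewrite /= in_itv.
Qed.

End coefficient.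

Section progressive_processes.
Context (R : realType) (d : measure_display) (Om : measurableType d).
Context (P : probability Om R) (T : R) (w : R -> Om -> R).
Hypothesis w_bm : brownian_motion P T w.
Local Notation mu := (@lebesgue_measure R).
Local Notation M := (mu \x P)%E.
Local Notation F := (augmented_filtration P w).

Lemma progressive_comp_cut (X : topologicalType) (f : R -> Om -> X) (g : X -> R) t :
  t <= T -> progressive F t T f -> continuous g ->
  measurable_fun setT (cut t T (fun r om => g (f r om))).
Proof.
move=> tT pf cg; apply: measurable_cut.
have mD : measurable (`[t, T]%classic `*` [set: Om]) by exact: measurableX.
apply/(measurable_wrtP mD).
apply: (measurable_wrt_comp (E := setT) (g := g) mD (progressive_measurable_wrt w_bm tT (lexx T) pf)) => //.
exact: continuous_subspaceT.
Qed.

Lemma progressive_comp_Fm (X : topologicalType) (f : R -> Om -> X) (g : X -> R) t r :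
  progressive F t T f -> continuous g -> t <= r <= T -> Fm P w r (fun om => g (f r om)).
Proof.
move=> pf cg /andP[tr rT]; apply/(measurable_wrtP (@measurableT _ (filtType P w r))).
apply: (measurable_wrt_comp (E := setT) (g := g) measurableT (progressive_adapted pf tr rT)) => //.
exact: continuous_subspaceT.
Qed.

Lemma square_integrable_sqint (K : normedModType R) (f : R -> Om -> K) t :
  t <= T -> progressive F t T f -> square_integrable P t T f -> sqint M (cut t T (fun r om => `|f r om|)).
Proof.
move=> tT pf sf.
have mf := progressive_comp_cut tT pf (@norm_continuous _ _).
by split; [exact: mf|rewrite (integral_M_cut P mf)].
Qed.

Lemma square_integrable_sup_sqint (K : normedModType R) (f : R -> Om -> K) (g : K -> R) t C r :
  progressive F t T f -> square_integrable_sup P t T f -> continuous g ->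
  (forall x, `|g x| <= C * `|x|) -> t <= r <= T -> sqint P (fun om => g (f r om)).
Proof.
move=> pf [B [mB B2 fB]] cg gC rT.
have mg := Fm_measurable w_bm (proj2 (andP rT)) (progressive_comp_Fm pf cg rT).
apply: (@sqint_ae_le _ _ _ P _ (fun om => `|C| * B om) mg); first by apply: sqintZ.
apply: ae_mono fB => om /(_ r rT) h; rewrite (le_trans (gC _))// normrM normr_id.
apply: (@le_trans _ _ (`|C| * `|f r om|)); first by rewrite ler_wpM2r// ler_norm.
by rewrite ler_wpM2l// (le_trans h)// ler_norm.
Qed.

End progressive_processes.

Section state_processes.
Context (R : realType) (d : measure_display) (Om : measurableType d).
Context (P : probability Om R) (T : R) (w : R -> Om -> R).
Hypothesis w_bm : brownian_motion P T w.
Local Notation mu := (@lebesgue_measure R).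
Local Notation M := (mu \x P)%E.
Local Notation F := (augmented_filtration P w).
Context (V H Vs H1 : hilbertType R) (sH1 : separable H1).
Context (j : {linear V -> H}) (pair : Vs -> {linear V -> R^o}).
Hypothesis triple : gelfand_triple j pair.
Context (A : R -> {linear V -> Vs}) (B : R -> {linear V -> H}).
Context (U : set H1) (v0 : H1).
Context (a b : R -> H -> H1 -> H) (k : R -> H -> R -> R -> H1 -> R) (h : H -> R).
Hypothesis oc : operator_condition T j pair A B.
Hypothesis lc : lipschitz_condition T U v0 a b k h.

Let sV := gelfand_separableV triple.
Let sH := gelfand_separableH triple.

Lemma state_constants : exists de K, [/\ 0 < de, 0 <= K, forall x, `|j x| <= K * `|x|,
  forall r x, 0 <= r <= T ->
   [/\ forall y, `|pair (A r x) y| <= K * `|x| * `|y|, `|B r x| <= K * `|x| &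
       2 * pair (A r x) x + `|B r x| ^+ 2 <= - de * `|x| ^+ 2 + K * `|j x| ^+ 2] &
  forall r v, 0 <= r <= T -> U v ->
   [/\ forall x1 x2, `|a r x1 v - a r x2 v| <= K * `|x1 - x2|,
       forall x1 x2, `|b r x1 v - b r x2 v| <= K * `|x1 - x2| & `|a r 0 v| <= K]].
Proof.
have [Kj Kj0 jK] := embedding_bound triple.
have [de [K1 [de0 K10 ocb]]] := oc_bounds oc.
have [L3 [L4 [L5 [[L30 L40 L50] _ _ lcb]]]] := lc_bounds lc.
(* A bound for [B] is extracted from coercivity: |Bx|² <= 2|<Ax, x>| + K1 |jx|² <= (2 K1 + K1 Kj²)
   |x|². The summand 1 makes CB <= CB². *)
have [CB CBE] : exists CB, CB = 1 + 2 * K1 + K1 * Kj ^+ 2 by eexists.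
have KK0 : 0 <= K1 * Kj ^+ 2 by rewrite mulr_ge0// sqr_ge0.
have CB0 : 0 <= CB by rewrite CBE; lra.
exists de, (Kj + K1 + CB + L3 + L5).
have K0 : 0 <= Kj + K1 + CB + L3 + L5 by lra.
split => //.
- move=> x; rewrite (le_trans (jK x))// ler_wpM2r//; lra.
- move=> r x rT; have [c1 c2 _] := ocb r x rT.
  have pA y : `|pair (A r x) y| <= K1 * `|x| * `|y|.
    by rewrite (le_trans (pairing_bound triple _ _))// ler_wpM2r.
  split.
  + move=> y; rewrite (le_trans (pA y))// ler_wpM2r// ler_wpM2r//; lra.
  + apply: le_trans (_ : CB * `|x| <= _); last by rewrite ler_wpM2r//; lra.
    rewrite -(ler_pXn2r (n := 2)) ?nnegrE ?mulr_ge0// exprMn.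
    have h1 := le_trans (ler_norm _) (le_trans (eq_ind_r (fun z => z <= _) (pA x) (normrN _)) (lexx _)).
    have h2 : `|j x| ^+ 2 <= Kj ^+ 2 * `|x| ^+ 2.
      by rewrite -exprMn ler_pXn2r ?nnegrE ?mulr_ge0// ltW.
    have h3 : `|x| ^+ 2 * CB <= `|x| ^+ 2 * CB ^+ 2.
      by rewrite ler_wpM2l ?sqr_ge0// expr2 ler_peMr//; lra.
    have h4 : K1 * `|j x| ^+ 2 <= K1 * (Kj ^+ 2 * `|x| ^+ 2) by rewrite ler_wpM2l.
    have h5 : 0 <= de * `|x| ^+ 2 by rewrite mulr_ge0 ?sqr_ge0// ltW.
    have h6 : `|x| ^+ 2 * CB = `|x| ^+ 2 + 2 * K1 * `|x| ^+ 2 + K1 * (Kj ^+ 2 * `|x| ^+ 2) by rewrite CBE; ring.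
    have h7 : 0 <= `|x| ^+ 2 by exact: sqr_ge0.
    rewrite -mulrA -expr2 in h1.
    rewrite [CB ^+ 2 * _]mulrC; lra.
  + apply: le_trans c1 _; rewrite lerD2l ler_wpM2r ?sqr_ge0//; lra.
- move=> r v rT Uv; have [l1 _ _ _ [l2 _ _]] := lcb r v rT Uv; split.
  + move=> x1 x2; have := l1 x1 x2; have := normr_ge0 (b r x1 v - b r x2 v) => ? ?.
    apply: le_trans (_ : L3 * `|x1 - x2| <= _); first lra.
    by rewrite ler_wpM2r//; lra.
  + move=> x1 x2; have := l1 x1 x2; have := normr_ge0 (a r x1 v - a r x2 v) => ? ?.
    apply: le_trans (_ : L3 * `|x1 - x2| <= _); first lra.
    by rewrite ler_wpM2r//; lra.
  + by apply: le_trans l2 _; lra.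
Qed.

Definition drift (u : R -> Om -> H1) X XV phi r om : R :=
  pair (A r (XV r om)) phi + inner (a r (X r om) (u r om)) (j phi).

Definition diffusion (u : R -> Om -> H1) X XV phi r om : R :=
  inner (B r (XV r om) + b r (X r om) (u r om)) (j phi).

Record state_data t x (u : R -> Om -> H1) (X : R -> Om -> H) (XV : R -> Om -> V) : Prop := {
  sd_mV : forall y, measurable_fun setT (cut t T (fun r om => inner (XV r om) y));
  sd_FV : forall r y, t <= r <= T -> Fm P w r (fun om => inner (XV r om) y);
  sd_mX : forall y, measurable_fun setT (cut t T (fun r om => inner (X r om) y));
  sd_sV : sqint M (cut t T (fun r om => `|XV r om|));
  sd_sX : forall r y, t <= r <= T -> sqint P (fun om => inner (X r om) y);
  sd_XV : {ae P, forall om, {ae mu, forall s, t <= s <= T -> j (XV s om) = X s om}};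
  sd_drift : forall phi, sqint M (cut t T (drift u X XV phi));
  sd_eq : forall s phi, t <= s <= T ->
    exists2 J, ito P w t s (diffusion u X XV phi) J &
    {ae P, forall om, inner (X s om) (j phi) =
      inner x (j phi) + tint t s (drift u X XV phi) om + J om} }.

Lemma measurable_pairing t x y : 0 <= t ->
  measurable_fun setT (fun r => \1_`[t, T] r * pair (A r x) y).
Proof.
move=> t0; apply: measurable_fun_indic_restrict => //.
apply: (@measurable_funS _ _ _ _ `[0, T]) => //.
  by move=> r /=; rewrite !in_itv/= => /andP[tr ->]; rewrite (le_trans t0 tr).
apply/measurable_wrtP => //.
apply: (measurable_wrt_comp (E := setT) (g := pair ^~ y) _ (oc_A_measurable oc x)) => //.
by apply: continuous_subspaceT; exact: (pairing_continuous triple).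
Qed.

Lemma measurable_Bcoef t x y : 0 <= t ->
  measurable_fun setT (fun r => \1_`[t, T] r * inner (B r x) y).
Proof.
move=> t0; apply: measurable_fun_indic_restrict => //.
apply: (@measurable_funS _ _ _ _ `[0, T]) => //.
  by move=> r /=; rewrite !in_itv/= => /andP[tr ->]; rewrite (le_trans t0 tr).
apply/measurable_wrtP => //.
apply: (measurable_wrt_comp (E := setT) (g := fun z => inner z y) _ (oc_B_measurable oc x)) => //.
by apply: continuous_subspaceT; exact: inner_continuous.
Qed.

Lemma state_equation_data t x u X : 0 <= t <= T ->
  (forall s om, t <= s <= T -> U (u s om)) -> progressive F t T u ->
  state_equation P T w j pair A B a b t x u X -> exists XV, state_data t x u X XV.
Proof.
move=> /andP[t0 tT] Uu pu [pX _ supX [XV [pXV sXV XVX eqX]]]; exists XV.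
have [de [K [de0 K0 jK oK cK]]] := state_constants.
have mV y := progressive_comp_cut w_bm tT pXV (@inner_continuous _ _ y).
have mX y := progressive_comp_cut w_bm tT pX (@inner_continuous _ _ y).
have sXV' := square_integrable_sqint w_bm tT pXV sXV.
have cj : continuous (fun v => `|j v|).
  move=> v; apply: (@continuous_comp _ _ _ j) => //; last exact: norm_continuous.
  exact: (@gelfand_continuous _ _ _ _ _ _ triple v).
have mjV := progressive_comp_cut w_bm tT pXV cj.
have mnX := progressive_comp_cut w_bm tT pX (@norm_continuous _ _).
have sjV : sqint M (cut t T (fun r om => `|j (XV r om)|)).
  apply: (@sqint_le _ _ _ M _ _ mjV _ (sqintZ K sXV')) => p.
  rewrite /cut mulrCA !normrM !normr_id ler_wpM2l//.
  by rewrite (le_trans (jK _))// ler_wpM2r// ler_norm.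
(* Square integrability in time is inherited from [j (XV ...)], whose norm is the same almost
   everywhere. *)
have snX : sqint M (cut t T (fun r om => `|X r om|)).
  apply: (@sqint_aeeq _ _ _ M _ _ mnX sjV).
  have : {ae M, forall p, cut t T (fun r om => `|X r om|) p - cut t T (fun r om => `|j (XV r om)|) p = 0}.
    apply: ae_prod; first exact: measurable_funB.
    apply: ae_mono XVX => om; apply: ae_mono => s sXV0; rewrite /cut/= indicE mem_setE in_itv/=.
    by case: (boolP (t <= s <= T)) => [/sXV0 ->|_]; rewrite ?mul0r ?subrr.
  by apply: ae_mono => p /eqP; rewrite subr_eq0 => /eqP.
split => //.
- by move=> r y rT; exact: progressive_comp_Fm pXV (@inner_continuous _ _ y) rT.
- move=> r y rT; apply: (square_integrable_sup_sqint w_bm (C := `|y|) pX supX (@inner_continuous _ _ y) _ rT).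
  by move=> z; rewrite mulrC inner_CS.
- move=> phi.
  have m1 : measurable_fun setT (cut t T (fun r om => pair (A r (XV r om)) phi)).
    (* The indicator is put both outside and inside [A]: the form is then bounded at every time, and
       its argument has measurable coordinates on the whole line. *)
    have -> : cut t T (fun r om => pair (A r (XV r om)) phi) =
        fun p => \1_`[t, T] p.1 * pair (A p.1 (\1_`[t, T] p.1 *: XV p.1 p.2)) phi.
      apply/funext => p; rewrite /cut linearZ.
      have := pairing_linear triple phi (\1_`[t, T] p.1) (A p.1 (XV p.1 p.2)) 0.
      rewrite addr0 => ->; have -> : pair 0 phi = 0.
        by have := pairing_bound triple 0 phi; rewrite normr0 mul0r normr_le0 => /eqP.
      by rewrite addr0 /GRing.scale/= mulrA indicM.
    apply: (@measurable_linear_form _ _ _ _ sV (fun p v => \1_`[t, T] p.1 * pair (A p.1 v) phi)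
       (fun p => \1_`[t, T] p.1 *: XV p.1 p.2)).
    + by move=> p c y z; rewrite linearP (pairing_linear triple) /GRing.scale/=; ring.
    + move=> p; exists (K * `|phi|) => v; rewrite normrM indicE mem_setE in_itv/=.
      have [rT|_] := boolP (t <= p.1 <= T); last by rewrite normr0 mul0r !mulr_ge0.
      have [|pA _ _] := oK p.1 v; first by case/andP: rT => tr ->; rewrite (le_trans t0 tr).
      by rewrite normr1 mul1r mulrAC.
    + by move=> v; apply: (measurableT_comp (measurable_pairing v phi t0)).
    + move=> v; have := mV v; congr measurable_fun; apply/funext => p.
      by rewrite /cut innerZl.
  have m2 : measurable_fun setT (cut t T (fun r om => inner (a r (X r om) (u r om)) (j phi))).
    apply: measurable_cut; apply: (measurable_coefficient sH sH1 (lc_a_continuous lc)).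
    + exact: measurableX.
    + exact: measurable_funS measurable_fst.
    + exact: (progressive_measurable_wrt w_bm tT (lexx T) pX).
    + exact: (progressive_measurable_wrt w_bm tT (lexx T) pu).
    + by move=> p [/= + _]; rewrite in_itv/= => /andP[tp ->]; rewrite (le_trans t0 tp).
    + by move=> p [/= + _]; rewrite in_itv/= => tp; exact: Uu.
  have s1 := sqintZ (K * `|phi|) sXV'.
  have s2 := sqintZ (K * `|j phi|) snX.
  have s3 := sqintZ (K * `|j phi|) (sqint_cst t T (sqint1 P)).
  have md : measurable_fun setT (cut t T (drift u X XV phi)).
    have := measurable_funD m1 m2; apply: eq_measurable_fun => p _.
    by rewrite /cut /drift mulrDr.
  apply: (@sqint_le _ _ _ M _ _ md _ (sqintD (sqintD s1 s2) s3)) => p.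
  rewrite /cut; rewrite indicE mem_setE in_itv/=.
  have [rT|_] := boolP (t <= p.1 <= T); last by rewrite !mul0r !mulr0 !addr0.
  have rT0 : 0 <= p.1 <= T by case/andP: rT => tr ->; rewrite (le_trans t0 tr).
  rewrite !mul1r mulr1 [X in _ <= X]ger0_norm ?addr_ge0 ?mulr_ge0//.
  have [pA _ _] := oK p.1 (XV p.1 p.2) rT0.
  have [la _ a0] := cK p.1 (u p.1 p.2) rT0 (Uu _ _ rT).
  rewrite /drift (le_trans (ler_normD _ _))// -addrA lerD//; first by rewrite mulrAC.
  rewrite (le_trans (inner_CS _ _))// [_ * _ * `|X p.1 p.2|]mulrAC -mulrDl ler_wpM2r//.
  rewrite -[a _ _ _](subrK (a p.1 0 (u p.1 p.2))) (le_trans (ler_normD _ _))// lerD//.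
  by rewrite (le_trans (la _ _))// subr0.
- move=> s phi sT; have [J iJ eqJ] := eqX s phi sT.
  by case/andP: sT => ts sT; exists J => //; exact: (ito_integral_ito w_bm t0 ts sT iJ).
Qed.

End state_processes.

Lemma ae_and d (S : measurableType d) (R : realType) (m : {measure set S -> \bar R})
    (A B : S -> Prop) : {ae m, forall x, A x} -> {ae m, forall x, B x} ->
  {ae m, forall x, A x /\ B x}.
Proof. by move=> hA hB; apply: filterI. Qed.

Section state_affine.
Context (R : realType) (d : measure_display) (Om : measurableType d).
Context (P : probability Om R) (T : R) (w : R -> Om -> R).
Hypothesis w_bm : brownian_motion P T w.
Local Notation mu := (@lebesgue_measure R).
Local Notation M := (mu \x P)%E.
Context (V H Vs H1 : hilbertType R) (sH1 : separable H1).
Context (j : {linear V -> H}) (pair : Vs -> {linear V -> R^o}).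
Hypothesis triple : gelfand_triple j pair.
Context (A : R -> {linear V -> Vs}) (B : R -> {linear V -> H}).
Context (U : set H1) (v0 : H1) (Uv0 : U v0).
Context (a b : R -> H -> H1 -> H) (k : R -> H -> R -> R -> H1 -> R) (h : H -> R).
Hypothesis oc : operator_condition T j pair A B.
Hypothesis lc : lipschitz_condition T U v0 a b k h.
Hypotheses (a_lin : linear_coefficient T U a) (b_lin : linear_coefficient T U b).
Variables (t l : R) (t0 : 0 <= t) (tT : t <= T).
Variables (x1 x2 x3 : H) (u1 u2 u3 : R -> Om -> H1) (X1 X2 X3 : R -> Om -> H)
  (V1 V2 V3 : R -> Om -> V).
Hypothesis x3E : x3 = l *: x1 + (1 - l) *: x2.
Hypothesis u3E : forall r om, t <= r <= T -> u3 r om = l *: u1 r om + (1 - l) *: u2 r om.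
Hypothesis Uu1 : forall r om, t <= r <= T -> U (u1 r om).
Hypothesis Uu2 : forall r om, t <= r <= T -> U (u2 r om).
Hypothesis Uu3 : forall r om, t <= r <= T -> U (u3 r om).
Local Notation state_data := (state_data P T w j pair A B a b).
Local Notation drift := (drift j pair A a).
Local Notation diffusion := (diffusion j B b).
Hypothesis S1 : state_data t x1 u1 X1 V1.
Hypothesis S2 : state_data t x2 u2 X2 V2.
Hypothesis S3 : state_data t x3 u3 X3 V3.

Let sV := gelfand_separableV triple.
Let sH := gelfand_separableH triple.
Let comb (K : lmodType R) (y3 y1 y2 : K) := y3 + (- l) *: y1 + (- (1 - l)) *: y2.
Let rcomb (y3 y1 y2 : R) := y3 + (- l) * y1 + (- (1 - l)) * y2.
Let D r om : H := comb (X3 r om) (X1 r om) (X2 r om).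
Let DV r om : V := comb (V3 r om) (V1 r om) (V2 r om).
Let ind r : R := \1_`[t, T] r.
Let z r om : V := ind r *: DV r om.
Local Notation Z p := (z p.1 p.2).

Let ind1 r : t <= r <= T -> ind r = 1.
Proof. by move=> rT; rewrite /ind indicE mem_setE in_itv/= rT. Qed.
Let ind0 r : ~~ (t <= r <= T) -> ind r = 0.
Proof. by move=> rT; rewrite /ind indicE mem_setE in_itv/= (negbTE rT). Qed.
Let in0T r : t <= r <= T -> 0 <= r <= T.
Proof. by move=> /andP[tr ->]; rewrite (le_trans t0 tr). Qed.

Let inner_comb (K : hilbertType R) (y3 y1 y2 y : K) :
  inner (comb y3 y1 y2) y = rcomb (inner y3 y) (inner y1 y) (inner y2 y).
Proof. by rewrite /comb !innerDl !innerZl. Qed.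

Let z0 r om : ~~ (t <= r <= T) -> z r om = 0.
Proof. by move=> rT; rewrite /z ind0// scale0r. Qed.

Let mz y : measurable_fun setT (fun p : R * Om => inner (Z p) y).
Proof.
have := measurable_funD (measurable_funD (sd_mV S3 y) (measurable_funM (measurable_cst (- l)) (sd_mV S1 y)))
  (measurable_funM (measurable_cst (- (1 - l))) (sd_mV S2 y)).
by apply: eq_measurable_fun => p _; rewrite /z innerZl inner_comb /rcomb /cut /ind/=; ring.
Qed.

Let Fmz r y : t <= r <= T -> Fm P w r (fun om => inner (z r om) y).
Proof.
move=> rT.
have := measurable_funD (measurable_funD (sd_FV S3 y rT) (measurable_funM (measurable_cst (- l)) (sd_FV S1 y rT)))
  (measurable_funM (measurable_cst (- (1 - l))) (sd_FV S2 y rT)).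
by apply: eq_measurable_fun => om _; rewrite /z innerZl inner_comb /rcomb ind1//= mul1r.
Qed.

Let sz : sqint M (fun p => `|Z p|).
Proof.
have mn := measurable_normH sV mz.
apply: (@sqint_le _ _ _ M _ _ mn _ (sqintD (sqintD (sd_sV S3) (sqintZ `|l| (sd_sV S1))) (sqintZ `|1 - l| (sd_sV S2)))) => p.
rewrite normr_id /cut -/(ind _) /z normrZ.
have i0 : 0 <= ind p.1 by rewrite /ind indicE.
rewrite (ger0_norm i0) ger0_norm ?addr_ge0 ?mulr_ge0//.
rewrite mulrCA [_ * (ind _ * `|V2 _ _|)]mulrCA -!mulrDr ler_wpM2l// /DV /comb.
rewrite (le_trans (ler_normD _ _))// lerD//; last by rewrite normrZ normrN.
by rewrite (le_trans (ler_normD _ _))// normrZ normrN.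
Qed.

Let sD r phi : t <= r <= T -> sqint P (fun om => inner (D r om) (j phi)).
Proof.
move=> rT; have := sqintD (sqintD (sd_sX S3 (j phi) rT) (sqintZ (- l) (sd_sX S1 (j phi) rT))) (sqintZ (- (1 - l)) (sd_sX S2 (j phi) rT)).
by congr sqint; apply/funext => om; rewrite inner_comb.
Qed.

Let mDy y : measurable_fun setT (cut t T (fun r om => inner (D r om) y)).
Proof.
have := measurable_funD (measurable_funD (sd_mX S3 y) (measurable_funM (measurable_cst (- l)) (sd_mX S1 y)))
  (measurable_funM (measurable_cst (- (1 - l))) (sd_mX S2 y)).
by apply: eq_measurable_fun => p _; rewrite /cut inner_comb /rcomb /=; ring.
Qed.

Let DjZ_slices : {ae P, forall om, {ae mu, forall r, t <= r <= T -> D r om = j (z r om)}}.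
Proof.
have hS := ae_and (sd_XV S1) (ae_and (sd_XV S2) (sd_XV S3)).
apply: ae_mono hS => om [h1 [h2 h3]]; apply: ae_mono (ae_and h1 (ae_and h2 h3)).
move=> r [e1 [e2 e3]] rT; rewrite /z ind1// scale1r /DV /comb 2!(linearD j) 2!(linearZ_LR j).
by rewrite e1// e2// e3.
Qed.

Let DjZ : {ae M, forall p, t <= p.1 <= T -> D p.1 p.2 = j (Z p)}.
Proof.
have [de [K [de0 K0 jK oK cK]]] := state_constants triple oc lc.
have mjZ y : measurable_fun setT (fun p : R * Om => inner (j (Z p)) y).
  apply: (@measurable_linear_form _ _ _ _ sV (fun _ v => inner (j v) y) (fun p => Z p)) => //.
  - by move=> p c u v; rewrite linearP innerDl innerZl.
  - by move=> p; exists (K * `|y|) => v; rewrite (le_trans (inner_CS _ _))// mulrAC ler_wpM2r.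
have : {ae M, forall p, `|ind p.1 *: D p.1 p.2 - j (Z p)| = 0}.
  apply: ae_prod.
    apply: (measurable_normH sH) => y.
    have := measurable_funB (mDy y) (mjZ y); apply: eq_measurable_fun => p _.
    by rewrite innerBl innerZl.
  apply: ae_mono DjZ_slices => om; apply: ae_mono => r /= Dr.
  have [rT|rT] := boolP (t <= r <= T); first by rewrite -Dr// ind1// scale1r subrr normr0.
  by rewrite ind0// z0// scale0r linear0 subrr normr0.
apply: ae_mono => p + pT; rewrite ind1// scale1r => /eqP; rewrite normr_eq0 subr_eq0.
by move=> /eqP.
Qed.

Let combE (f : R -> V -> R) r : (forall c x y, f r (c *: x + y) = c * f r x + f r y) ->
  forall om, f r (DV r om) = rcomb (f r (V3 r om)) (f r (V1 r om)) (f r (V2 r om)).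
Proof.
by move=> lf om; rewrite /DV /comb addrC lf [V3 r om + _]addrC lf /rcomb; ring.
Qed.

(** The coefficients are cut off by [ind] because their bounds are available only for times in
    [0, T], while the uniqueness argument asks for bounded forms at all times. *)
Let a2 r x y := ind r * pair (A r x) y.
Let B' r x := ind r *: B r x.
Let hom (c : R -> H -> H1 -> H) r x := ind r *: hom_part v0 c r x.

Let pair_lin r y c (x x' : V) :
  pair (A r (c *: x + x')) y = c * pair (A r x) y + pair (A r x') y.
Proof. by rewrite linearP (pairing_linear triple). Qed.

Let drift_comb phi r om : t <= r <= T -> D r om = j (z r om) ->
  rcomb (drift u3 X3 V3 phi r om) (drift u1 X1 V1 phi r om) (drift u2 X2 V2 phi r om) =
  a2 r (z r om) phi + inner (hom a r (j (z r om))) (j phi).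
Proof.
move=> rT DjZr; have rT0 := in0T rT.
rewrite -DjZr /a2 /hom ind1// mul1r scale1r /z ind1// scale1r.
rewrite (@combE (fun r x => pair (A r x) phi) r (pair_lin r phi)).
rewrite -(hom_partE Uv0 a_lin _ _ _ rT0 (Uu1 om rT) (Uu2 om rT) (Uu3 om rT) (u3E om rT)).
by rewrite inner_comb /drift /rcomb; ring.
Qed.

Let diffusion_comb phi r om : t <= r <= T -> D r om = j (z r om) ->
  rcomb (diffusion u3 X3 V3 phi r om) (diffusion u1 X1 V1 phi r om) (diffusion u2 X2 V2 phi r om) =
  inner (B' r (z r om) + hom b r (j (z r om))) (j phi).
Proof.
move=> rT DjZr; have rT0 := in0T rT.
rewrite -DjZr /B' /hom ind1// !scale1r /z ind1// scale1r innerDl.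
have Bl c x x' : inner (B r (c *: x + x')) (j phi) = c * inner (B r x) (j phi) + inner (B r x') (j phi).
  by rewrite linearP innerDl innerZl.
rewrite (@combE (fun r x => inner (B r x) (j phi)) r Bl).
rewrite -(hom_partE Uv0 b_lin _ _ _ rT0 (Uu1 om rT) (Uu2 om rT) (Uu3 om rT) (u3E om rT)).
by rewrite inner_comb /diffusion /rcomb !innerDl; ring.
Qed.

Let equation phi : exists alpha' beta' : R -> Om -> R,
  [/\ sqint M (cut t T alpha'),
   {ae P, forall om, {ae mu, forall r, t <= r <= T ->
      alpha' r om = a2 r (z r om) phi + inner (hom a r (j (z r om))) (j phi)}},
   {ae M, forall p, cut t T beta' p =
      cut t T (fun r om => inner (B' r (z r om) + hom b r (j (z r om))) (j phi)) p} &
   forall s, t <= s <= T -> exists2 J, ito P w t s beta' J &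
     {ae P, forall om, inner (D s om) (j phi) = tint t s alpha' om + J om}].
Proof.
exists (fun r om => rcomb (drift u3 X3 V3 phi r om) (drift u1 X1 V1 phi r om) (drift u2 X2 V2 phi r om)).
exists (fun r om => rcomb (diffusion u3 X3 V3 phi r om) (diffusion u1 X1 V1 phi r om) (diffusion u2 X2 V2 phi r om)).
have s1 := sd_drift S1 phi; have s2 := sd_drift S2 phi; have s3 := sd_drift S3 phi.
split.
- have := sqintD (sqintD s3 (sqintZ (- l) s1)) (sqintZ (- (1 - l)) s2).
  by congr sqint; apply/funext => p; rewrite /cut /rcomb; ring.
- apply: ae_mono DjZ_slices => om; apply: ae_mono => r Dr rT.
  by apply: drift_comb => //; exact: Dr.
- apply: ae_mono DjZ => p Dp; rewrite /cut -/(ind _).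
  have [rT|rT] := boolP (t <= p.1 <= T); last by rewrite ind0// !mul0r.
  by congr (_ * _); apply: diffusion_comb => //; exact: Dp.
move=> s sT; have [J1 i1 e1] := sd_eq S1 phi sT; have [J2 i2 e2] := sd_eq S2 phi sT.
have [J3 i3 e3] := sd_eq S3 phi sT; have [ts sT'] := andP sT.
exists (fun om => J3 om + (- l) * J1 om + (- (1 - l)) * J2 om).
  by apply: (ito_lin w_bm _ t0 sT'); first exact: (ito_lin w_bm _ t0 sT').
have q1 := integrable_slice_cut (sqint_cut_sub sT' s1).
have q2 := integrable_slice_cut (sqint_cut_sub sT' s2).
have q3 := integrable_slice_cut (sqint_cut_sub sT' s3).
apply: ae_mono (ae_and (ae_and e1 (ae_and e2 e3)) (ae_and q1 (ae_and q2 q3))).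
move=> om [[{}e1 [{}e2 {}e3]] [{}q1 [{}q2 {}q3]]].
rewrite inner_comb /rcomb e1 e2 e3 (tint_lin (f := fun r om => drift u3 X3 V3 phi r om + - l * drift u1 X1 V1 phi r om))//.
  rewrite tint_lin// x3E innerDl !innerZl; ring.
have := integrableD measurableT q3 (integrableZl measurableT (- l) q1).
by apply: eq_integrable => // r _ /=; rewrite cut_lin.
Qed.

Let sub0T : `[t, T]%classic `<=` `[0, T]%classic.
Proof. by move=> r /=; rewrite !in_itv; exact: in0T. Qed.

Let measurable_hom c : {within [set p : R * H * H1 | 0 <= p.1.1 <= T /\ U p.2],
    continuous (fun p => c p.1.1 p.1.2 p.2)} ->
  forall x y, measurable_fun setT (fun r => inner (hom c r x) y).
Proof.
move=> cc x y; have -> : (fun r => inner (hom c r x) y) = fun r => \1_`[t, T] r * inner (hom_part v0 c r x) y.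
  by apply/funext => r; rewrite /hom innerZl.
apply: measurable_fun_indic_restrict => //; apply: measurable_funS (sub0T) (measurable_hom_part Uv0 sH sH1 cc x y) => //.
Qed.

Let hom_linear c : linear_coefficient T U c -> forall r, linear (hom c r).
Proof.
move=> cl r k' x y; have [rT|rT] := boolP (t <= r <= T); last by rewrite /hom ind0// !scale0r scaler0 addr0.
by rewrite /hom ind1// !scale1r (hom_part_linear Uv0 cl (in0T rT)).
Qed.

Let hom_bound c K : 0 <= K -> (forall r v, 0 <= r <= T -> U v ->
    forall x y, `|c r x v - c r y v| <= K * `|x - y|) -> forall r x, `|hom c r x| <= K * `|x|.
Proof.
move=> K0 cK r x; rewrite /hom normrZ; have [rT|rT] := boolP (t <= r <= T); last by rewrite ind0// normr0 mul0r mulr_ge0.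
by rewrite ind1// normr1 mul1r -[x in _ * `|x|]subr0; apply: cK => //; exact: in0T.
Qed.

(** The defect [D] has initial value 0 and, by [hom_partE], solves the homogeneous equation. The
    fixed-time conclusion serves the terminal cost, the almost-everywhere one the running cost. *)
Theorem state_affine :
  (forall s, t <= s <= T -> {ae P, forall om, X3 s om = l *: X1 s om + (1 - l) *: X2 s om}) /\
  {ae M, forall p, t <= p.1 <= T ->
    X3 p.1 p.2 = l *: X1 p.1 p.2 + (1 - l) *: X2 p.1 p.2}.
Proof.
have [de [K [de0 K0 jK oK cK]]] := state_constants triple oc lc.
have j_inj x : j x = 0 -> x = 0.
  by rewrite -[in X in X -> _](linear0 j); apply: gelfand_injective triple _ _.
have [dn dense_dn] := separable_seq sV.
have a2l r x : linear (a2 r x : V -> R^o).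
  by move=> c y y'; rewrite /a2 linearP /GRing.scale/=; ring.
have a2r r y : linear ((a2 r)^~ y : V -> R^o).
  by move=> c x x'; rewrite /a2 pair_lin /GRing.scale/=; ring.
have a2b r x y : `|a2 r x y| <= K * `|x| * `|y|.
  rewrite /a2 normrM; have [rT|rT] := boolP (t <= r <= T); last by rewrite ind0// normr0 mul0r !mulr_ge0.
  by rewrite ind1// normr1 mul1r; have [] := oK r x (in0T rT).
have Bl r : linear (B' r).
  by move=> c x y; rewrite /B' linearP scalerDr !scalerA mulrC.
have Bb r x : `|B' r x| <= K * `|x|.
  rewrite /B' normrZ; have [rT|rT] := boolP (t <= r <= T); last by rewrite ind0// normr0 mul0r !mulr_ge0.
  by rewrite ind1// normr1 mul1r; have [] := oK r x (in0T rT).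
have al := hom_linear a_lin; have bl := hom_linear b_lin.
have ab : forall r x, `|hom a r x| <= K * `|x|.
  by apply: hom_bound => // r v rT Uv; have [] := cK r v rT Uv.
have bb : forall r x, `|hom b r x| <= K * `|x|.
  by apply: hom_bound => // r v rT Uv; have [] := cK r v rT Uv.
have ma2 x y : measurable_fun setT (fun r => a2 r x y) by exact: (measurable_pairing triple oc x y t0).
have mB x y : measurable_fun setT (fun r => inner (B' r x) y).
  have -> : (fun r => inner (B' r x) y) = fun r => \1_`[t, T] r * inner (B r x) y.
    by apply/funext => r; rewrite /B' innerZl.
  exact: (measurable_Bcoef oc x y t0).
have ma := measurable_hom (lc_a_continuous lc).
have mb := measurable_hom (lc_b_continuous lc).
have coer r x : t <= r <= T ->
    2 * a2 r x x + `|B' r x| ^+ 2 <= - de * `|x| ^+ 2 + K * `|j x| ^+ 2.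
  by move=> rT; rewrite /a2 /B' ind1// mul1r scale1r; have [] := oK r x (in0T rT).
have Dz phi : {ae M, forall p, cut t T (fun r om => inner (D r om) (j phi)) p = inner (j (Z p)) (j phi)}.
  apply: ae_mono DjZ => p Dp; rewrite /cut -/(ind _).
  have [rT|rT] := boolP (t <= p.1 <= T); first by rewrite ind1// mul1r Dp.
  by rewrite ind0// mul0r z0// linear0 inner0l.
have DE r om : D r om = 0 -> X3 r om = l *: X1 r om + (1 - l) *: X2 r om.
  by rewrite /D /comb !scaleNr -addrA -opprD => /eqP; rewrite subr_eq0 => /eqP.
split=> [s sT|].
  have sD0 := homogeneous_state_eq0 w_bm sV (gelfand_dense triple) j_inj t0 tT de0 K0 jK a2l a2r a2b Bl Bb al ab bl bb
    ma2 mB ma mb coer z0 mz Fmz sz sD (fun phi => mDy (j phi)) Dz equation dense_dn sT.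
  by apply: ae_mono sD0 => om; exact: DE.
have h' := homogeneous_state_ae0 w_bm sV j_inj t0 tT de0 K0 jK a2l a2r a2b Bl Bb al ab bl bb
    ma2 mB ma mb coer z0 mz Fmz sz sD (fun phi => mDy (j phi)) Dz equation dense_dn.
apply: ae_mono (ae_and DjZ h') => p [Dp Zp] pT; apply: DE.
by rewrite Dp// Zp linear0.
Qed.

End state_affine.

(** * Comparison for linear backward equations *)

(** [m] is the exponential of the integral of [al] from t. It is delivered as a solution of an
    integral equation, the form in which the multiplication argument uses it. *)
Lemma integrating_factor (R : realType) (t T : R) (al : R -> R) : t <= T -> continuous al ->
  exists m : R -> R, [/\ {within `[t, T], continuous m}, forall r, 0 <= m r &
    forall s, t <= s <= T -> m s = 1 + \int[@lebesgue_measure R]_(r in `[t, s]) (al r * m r)].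
Proof.
move=> tT cal.
(* The lower limit t - 1 makes t an interior point, so that [I] is differentiable at t too. *)
pose I x := \int[@lebesgue_measure R]_(r in `[t - 1, x]) (al r).
have I' x : t - 1 < x -> is_derive x 1 I (al x).
  move=> tx; have [||dI <-] := @continuous_FTC1_closed R al (t - 1) x (x + 1) _ _ tx (cal x).
  - by rewrite ltrDl.
  - apply: continuous_compact_integrable; first exact: segment_compact.
    exact: continuous_subspaceT.
  - by rewrite derive1E; exact: derivableP.
pose m x := expR (I x - I t).
have m' x : t - 1 < x -> is_derive x 1 m (al x * m x).
  move=> /I' dI; rewrite /m mulrC.
  have dB : is_derive x 1 (fun y => I y - I t) (al x).
    by apply: is_derive_eq; rewrite subr0.
  have := @is_derive1_comp R expR (fun y => I y - I t) x _ _ (is_derive_expR _) dB.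
  by [].
have dm x : t - 1 < x -> derivable m x 1 by move=> /m'[].
have cm : {within `[t, T], continuous m}.
  apply: derivable_within_continuous => x; rewrite in_itv/= => /andP[tx _].
  by apply: dm; rewrite (lt_le_trans _ tx)// gtrBl.
exists m; split => //; first by move=> r; exact: expR_ge0.
move=> s /andP[ts sT]; have mt : m t = 1 by rewrite /m subrr expR0.
move: ts; rewrite le_eqVlt => /predU1P[<-|ts].
  rewrite mt set_itv1 /Rintegral integral_set1/= ?addr0//.
have c1 : {within `[t, s], continuous (fun r => al r * m r)}.
  have cm1 : {within `[t, s], continuous m}.
    by apply: continuous_subspaceW cm => r /=; rewrite !in_itv/= => /andP[-> rs]; rewrite (le_trans rs).
  by move=> x; apply: cvgM; [exact: continuous_subspaceT|exact: cm1].
have near_cont x : t <= x -> m @ x --> m x.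
  move=> tx; apply: differentiable_continuous; apply/derivable1_diffP; apply: dm.
  by rewrite (lt_le_trans _ tx)// gtrBl.
have := continuous_FTC2 ts c1 (F := m).
rewrite /Rintegral => ->.
- by rewrite -EFinB /= mt addrC subrK.
- split.
  + move=> x; rewrite in_itv/= => /andP[tx _]; apply: dm.
    by rewrite (lt_trans _ tx)// gtrBl.
  + by apply: cvg_at_right_filter; exact: near_cont.
  + by apply: cvg_at_left_filter; apply: near_cont; exact: ltW.
- move=> x; rewrite in_itv/= => /andP[tx _]; rewrite derive1E.
  have t1 : t - 1 < x by rewrite (lt_trans _ tx)// gtrBl.
  by have [_ ->] := m' x t1.
Qed.

(* m solves m' = al m, m(t) = 1; multiplying the backward equation by m and
   exchanging integrals replaces the explicit solution of y' = - al y - f. *)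
Section volterra.
Context (R : realType).
Local Notation mu := (@lebesgue_measure R).
Variables (t T A C : R) (al m y phi f : R -> R).
Hypothesis tT : t <= T.
Hypothesis mC : forall r, t <= r <= T -> `|m r| <= C.
Hypothesis m_meas : measurable_fun setT (fun r => \1_`[t, T] r * m r).
Hypothesis ig : mu.-integrable setT (EFin \o fun r => \1_`[t, T] r * (al r * m r)).
Hypothesis mE : forall q, t <= q <= T -> m q = 1 + \int[mu]_r (\1_`[t, q] r * (al r * m r)).
Hypothesis iphi : mu.-integrable setT (EFin \o phi).
Hypothesis phi0 : forall r, ~~ (t <= r <= T) -> phi r = 0.
Hypothesis yE : forall r, t <= r <= T -> y r = A + \int[mu]_q (\1_`[r, T] q * phi q).
Hypothesis if_ : mu.-integrable setT (EFin \o fun r => \1_`[t, T] r * f r).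
Hypothesis phiE : {ae mu, forall r, t <= r <= T -> phi r = f r + al r * y r}.

Let g r := \1_`[t, T] r * (al r * m r).
Let mm r := \1_`[t, T] r * m r.

Let ind1 r : t <= r <= T -> \1_`[t, T] r = 1 :> R.
Proof. by move=> rT; rewrite indicE mem_setE in_itv/= rT. Qed.
Let ind0 r : ~~ (t <= r <= T) -> \1_`[t, T] r = 0 :> R.
Proof. by move=> rT; rewrite indicE mem_setE in_itv/= (negbTE rT). Qed.

Let C0 : 0 <= C.
Proof. by apply: le_trans (mC (_ : t <= t <= T)); rewrite // lexx tT. Qed.

Let integrable_mm (F : R -> R) : mu.-integrable setT (EFin \o F) ->
  mu.-integrable setT (EFin \o fun r => mm r * F r).
Proof.
move=> iF; apply: (le_integrable measurableT _ _ (integrableZl measurableT C iF)).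
  apply/measurable_EFinP; apply: measurable_funM => //.
  by apply/measurable_EFinP; exact: measurable_int iF.
move=> r _ /=; rewrite lee_fin !normrM (ger0_norm C0) ler_wpM2r// /mm.
have [rT|rT] := boolP (t <= r <= T); first by rewrite ind1// normr1 mul1r mC.
by rewrite ind0// normr0 mul0r.
Qed.

Let iK : (mu \x mu)%E.-integrable setT
  (EFin \o fun p : R * R => (p.1 <= p.2)%R%:R * (g p.1 * phi p.2)).
Proof.
have mA : measurable [set x : R * R | x.1 <= x.2].
  have := @measurable_fun_ler _ (R * R)%type R setT fst snd measurable_fst measurable_snd.
  by move=> /(_ measurableT [set true] I); rewrite setTI.
have := @integrable_indicM _ _ _ (mu \x mu)%E _ _ mA (integrable_tensor ig iphi).
by apply: eq_integrable => // p _ /=; congr EFin; rewrite indicE mem_setE.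
Qed.

Lemma volterra : y t = A * m T + \int[mu]_q (mm q * f q).
Proof.
have yt : y t = A + \int[mu]_q phi q.
  rewrite yE ?lexx ?tT//; congr (_ + _); apply: eq_Rintegral => q _.
  have [qT|qT] := boolP (t <= q <= T); first by rewrite ind1// mul1r.
  by rewrite phi0// mulr0.
have mT : \int[mu]_r g r = m T - 1 by rewrite mE ?lexx ?tT// addrC addKr.
(* The integral of [phi] over [r, T] is y r - A. *)
have inner1 r : \int[mu]_q ((r <= q)%R%:R * (g r * phi q)) = g r * (y r - A).
  have [rT|rT] := boolP (t <= r <= T); last first.
    rewrite /g ind0// !mul0r; under eq_Rintegral do rewrite mul0r mulr0.
    by rewrite /Rintegral integral0.
  under eq_Rintegral do rewrite mulrCA.
  rewrite RintegralZl//; last first.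
    have := @integrable_indicM _ _ _ mu `[r, +oo[%classic phi (measurable_itv _) iphi.
    by apply: eq_integrable => // q _ /=; congr EFin; rewrite indicE mem_setE in_itv/= andbT.
  congr (_ * _); rewrite yE// addrC addKr; apply: eq_Rintegral => q _.
  rewrite indicE mem_setE in_itv/=; have [qT|qT] := boolP (t <= q <= T).
    by case/andP: qT => _ ->; rewrite andbT.
  by rewrite phi0// !mulr0.
(* After the exchange of integrals, the integral of [g] up to q is m q - 1. *)
have swap : \int[mu]_r (g r * (y r - A)) = \int[mu]_q (mm q * phi q - phi q).
  under eq_Rintegral do rewrite -inner1.
  transitivity (\int[mu]_q \int[mu]_r ((r <= q)%R%:R * (g r * phi q))).
    by rewrite -(Rintegral_fubini1 iK) (Rintegral_fubini2 iK).
  apply: eq_Rintegral => q _; have [qT|qT] := boolP (t <= q <= T); last first.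
    rewrite phi0// mulr0 subr0; under eq_Rintegral do rewrite !mulr0.
    by rewrite /Rintegral integral0.
  under eq_Rintegral do rewrite mulrA.
  rewrite RintegralZr//; last first.
    have := @integrable_indicM _ _ _ mu `]-oo, q]%classic g (measurable_itv _) ig.
    by apply: eq_integrable => // r _ /=; congr EFin; rewrite indicE mem_setE in_itv/=.
  rewrite /mm ind1// mul1r -[X in _ - X]mul1r -mulrBl; congr (_ * _).
  rewrite mE// [X in _ = X]addrC addKr; apply: eq_Rintegral => r _.
  rewrite /g !indicE !mem_setE !in_itv/= mulrA -natrM mulnb; congr (_%:R * _); congr nat_of_bool.
  by case/andP: qT => tq qT; case: (lerP r q) => rq; rewrite ?andbF//= ?andbT (le_trans rq qT) andbT.
have imphi := integrable_mm iphi; have imf := integrable_mm if_.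
have igA := integrableZl measurableT A ig.
have igy : mu.-integrable setT (EFin \o fun r => g r * (y r - A)).
  by have := integrable_Rfubini1 iK; apply: eq_integrable => // r _ /=; rewrite inner1.
have i1 := integrableB measurableT imphi imf.
(* On [t, T] [g] is [mm] times [al], so [phiE] turns g y into mm (phi - f). *)
have split_f : \int[mu]_r (g r * (y r - A)) =
    \int[mu]_r (mm r * phi r) - \int[mu]_r (mm r * (\1_`[t, T] r * f r)) - A * \int[mu]_r g r.
  rewrite -RintegralZl// -RintegralB// -RintegralB//; apply: Rintegral_ae => //.
    exact: (integrableB measurableT i1 igA).
  apply: ae_mono phiE => r; have [rT|rT _] := boolP (t <= r <= T).
    by move=> /(_ isT) ->; rewrite /g /mm ind1//; ring.
  by rewrite /g /mm ind0//; ring.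
have mf : \int[mu]_r (mm r * (\1_`[t, T] r * f r)) = \int[mu]_r (mm r * f r).
  by apply: eq_Rintegral => r _; rewrite /mm mulrACA indicM mulrA.
move: swap; rewrite split_f mf RintegralB// mT yt; lra.
Qed.

End volterra.

(** * Exponential weights with piecewise constant drift *)

Section girsanov.
Context (R : realType) (d : measure_display) (Om : measurableType d).
Context (P : probability Om R) (T : R) (w : R -> Om -> R).
Hypothesis w_bm : brownian_motion P T w.
Local Notation mu := (@lebesgue_measure R).
Local Notation M := (mu \x P)%E.
Local Notation Fm := (Fm P w).
Local Notation dw := (increment w).

Definition adapted_int s (z : Om -> R) := Fm s z /\ P.-integrable setT (EFin \o z).

Lemma adapted_intM s z y : s <= T -> adapted_int s z -> Fm s y -> bounded_rv y ->
  adapted_int s (fun om => z om * y om).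
Proof.
move=> sT [mz iz] my [K yK]; split; first exact: FmM.
have K0 : 0 <= K by apply: le_trans (yK point).
apply: (le_integrable measurableT _ _ (integrableZl measurableT K iz)).
  by apply/measurable_EFinP; apply: (Fm_measurable w_bm sT); exact: FmM.
by move=> om _ /=; rewrite lee_fin !normrM (ger0_norm K0) mulrC ler_wpM2r.
Qed.

(** The stochastic exponential of c w over [a, b], of mean 1. *)
Definition dexp c a b om := expR (c * dw a b om - c ^+ 2 * (b - a) / 2).

Lemma dexp_ge0 c a b om : 0 <= dexp c a b om. Proof. exact: expR_ge0. Qed.

Lemma dexpD c a b b' om : dexp c a b om * dexp c b b' om = dexp c a b' om.
Proof. by rewrite /dexp -expRD /increment; congr expR; ring. Qed.

Lemma dexpE c a b om : dexp c a b om = expR (c * dw a b om) * expR (- (c ^+ 2 * (b - a) / 2)).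
Proof. by rewrite -expRD. Qed.

Lemma dexpxx c a om : dexp c a a om = 1.
Proof. by rewrite /dexp dwxx subrr !mulr0 mul0r subrr expR0. Qed.

Lemma Fm_dexp c a b : 0 <= a -> a <= b -> Fm b (dexp c a b).
Proof.
move=> a0 ab; have md : Fm b (dw a b) by exact: Fm_dw.
apply: (measurableT_comp (f := expR : R -> R)) => //.
by apply: measurable_funB => //; exact: measurable_funM.
Qed.

Lemma adapted_int_dexp c a b z : 0 <= a -> a <= b -> b <= T -> adapted_int a z ->
  adapted_int b (fun om => z om * dexp c a b om) /\
  \int[P]_om (z om * dexp c a b om) = \int[P]_om z om.
Proof.
move=> a0; rewrite le_eqVlt => /predU1P[<- aT az|ab bT [mz iz]].
  have -> : (fun om => z om * dexp c a a om) = z.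
    by apply/funext => om; rewrite dexpxx mulr1.
  by [].
set k := expR (- (c ^+ 2 * (b - a) / 2)).
have E : (fun om => z om * dexp c a b om) = fun om => k * (z om * expR (c * dw a b om)).
  by apply/funext => om; rewrite dexpE mulrA mulrC.
have h := integrable_z_expdw w_bm a0 ab bT mz iz c.
split; last by rewrite E RintegralZl// (Rintegral_z_expdw w_bm a0 ab bT mz iz) mulrA -expRD addNr expR0 mul1r.
split; first by apply: FmM; [exact: Fm_le (ltW ab) mz|exact: Fm_dexp (ltW ab)].
by rewrite E; exact: (integrableZl measurableT k h).
Qed.

(** Girsanov on one interval with constant drift: under the density the increment has mean c (b -
    a). *)
Lemma adapted_int_dw_dexp c a b z : 0 <= a -> a <= b -> b <= T -> adapted_int a z ->
  adapted_int b (fun om => z om * (dw a b om * dexp c a b om)) /\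
  \int[P]_om (z om * (dw a b om * dexp c a b om)) = c * (b - a) * \int[P]_om z om.
Proof.
move=> a0; rewrite le_eqVlt => /predU1P[<- aT az|ab bT [mz iz]].
  have -> : (fun om => z om * (dw a a om * dexp c a a om)) = fun=> 0.
    by apply/funext => om; rewrite dwxx mul0r mulr0.
  rewrite subrr mulr0 mul0r; split; last by rewrite /Rintegral integral0.
  by split; [exact: measurable_cst|exact: integrable0].
set k := expR (- (c ^+ 2 * (b - a) / 2)).
have E : (fun om => z om * (dw a b om * dexp c a b om)) =
    fun om => k * (z om * (dw a b om * expR (c * dw a b om))).
  by apply/funext => om; rewrite dexpE -/k; ring.
have h := integrable_z_dw_expdw w_bm a0 ab bT mz iz c.
split.
  split.
    apply: FmM; first exact: Fm_le (ltW ab) mz.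
    by apply: FmM; [by apply: Fm_dw => //; exact: ltW|exact: Fm_dexp (ltW ab)].
  by rewrite E; exact: (integrableZl measurableT k h).
rewrite E RintegralZl// (Rintegral_z_dw_expdw w_bm a0 ab bT mz iz) !mulrA; congr (_ * _).
have kk : k * expR (c ^+ 2 * (b - a) / 2) = 1 by rewrite -expRD addNr expR0.
have gen (k' e : R) : k' * e = 1 -> k' * c * (b - a) * e = c * (b - a).
  by move=> h'; rewrite -[RHS]mulr1 -h'; ring.
exact: gen.
Qed.

Section grid.
Variables (n : nat) (q : nat -> R) (c : nat -> R) (t : R).
Hypothesis (t0 : 0 <= t) (q0 : q 0%N = t) (qn : q n = T).
Hypothesis q_mono : forall i j, (i <= j)%N -> q i <= q j.

Let qge0 i : 0 <= q i. Proof. by rewrite (le_trans t0)// -q0 q_mono. Qed.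
Let qleT i : (i <= n)%N -> q i <= T. Proof. by move=> ni; rewrite -qn q_mono. Qed.

Definition dexp_prod i j om := \prod_(i <= k < j) dexp (c k) (q k) (q k.+1) om.

Lemma adapted_int_prod i j z : (i <= j)%N -> (j <= n)%N -> adapted_int (q i) z ->
  adapted_int (q j) (fun om => z om * dexp_prod i j om) /\
  \int[P]_om (z om * dexp_prod i j om) = \int[P]_om z om.
Proof.
move=> ij jn az; elim: j ij jn => [|j ih].
  rewrite leqn0 => /eqP i0 _; move: az; rewrite i0 => az.
  have -> : (fun om => z om * dexp_prod 0 0 om) = z.
    by apply/funext => om; rewrite /dexp_prod big_geq// mulr1.
  by [].
rewrite leq_eqVlt => /predU1P[<- _|ij jn].
  have -> : (fun om => z om * dexp_prod i i om) = z.
    by apply/funext => om; rewrite /dexp_prod big_geq// mulr1.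
  by [].
have [az' E'] := ih ij (ltnW jn).
have -> : (fun om => z om * dexp_prod i j.+1 om) =
    fun om => (z om * dexp_prod i j om) * dexp (c j) (q j) (q j.+1) om.
  by apply/funext => om; rewrite /dexp_prod big_nat_recr//= mulrA.
have [h1 h2] := adapted_int_dexp (c j) (qge0 j) (q_mono (leqnSn j)) (qleT jn) az'.
by rewrite h2.
Qed.

Variables (x : Om -> R).
Hypothesis (mx : Fm t x) (bx : bounded_rv x).
(* x times the density of the change of measure that gives w the drift c i on
   the cell ]q i, q i.+1]; the Girsanov theorem is only used through expectations
   against this density. *)
Definition weight om := x om * dexp_prod 0 n om.

Let tT : t <= T. Proof. by rewrite -q0 qleT. Qed.

Let adx : adapted_int (q 0%N) x.
Proof.
rewrite q0; split => //; apply: sqint_integrable; apply: sqint_bounded => //.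
by apply: (Fm_measurable w_bm _ mx).
Qed.

(** The density is split before a, on ]a, b] and after b. Later factors have conditional mean 1, and
    on ]a, b] the increment is replaced by its tilted mean; the same reduction without the increment
    identifies the right-hand side. *)
Lemma integral_weight_cell i p a b y : (i < n)%N -> p <= a -> a <= b ->
  q i <= a -> b <= q i.+1 -> Fm p y -> bounded_rv y ->
  [/\ P.-integrable setT (EFin \o fun om => weight om * y om),
   P.-integrable setT (EFin \o fun om => weight om * (y om * dw a b om)) &
   \int[P]_om (weight om * (y om * dw a b om)) = c i * (b - a) * \int[P]_om (weight om * y om)].
Proof.
move=> ni pa ab qa bq my by_.
have aT : a <= T by rewrite (le_trans ab)// (le_trans bq)// qleT.
have bT : b <= T by rewrite (le_trans bq)// qleT.
have a0 : 0 <= a by rewrite (le_trans (qge0 i)).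
have b0 : 0 <= b by rewrite (le_trans a0).
have [az1 _] := adapted_int_prod (leq0n i) (ltnW ni) adx.
have [az2 _] := adapted_int_dexp (c i) (qge0 i) qa aT az1.
have az3 := adapted_intM aT az2 (Fm_le pa my) by_.
set z := (fun om => _ * y om) in az3.
have [az4 E4] := adapted_int_dw_dexp (c i) a0 ab bT az3.
have [az5 E5] := adapted_int_dexp (c i) b0 bq (qleT ni) az4.
have [az6 E6] := adapted_int_prod ni (leqnn n) az5.
have [az4' E4'] := adapted_int_dexp (c i) a0 ab bT az3.
have [az5' E5'] := adapted_int_dexp (c i) b0 bq (qleT ni) az4'.
have [az6' E6'] := adapted_int_prod ni (leqnn n) az5'.
have wE om : weight om = x om * dexp_prod 0 i om * dexp (c i) (q i) a om *
    dexp (c i) a b om * dexp (c i) b (q i.+1) om * dexp_prod i.+1 n om.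
  rewrite /weight /dexp_prod (big_cat_nat (n := i))//=; last exact: ltnW.
  by rewrite (big_ltn ni) -(dexpD (c i) (q i) a) -(dexpD (c i) a b); ring.
have F1 : (fun om => weight om * (y om * dw a b om)) = fun om =>
   z om * (dw a b om * dexp (c i) a b om) * dexp (c i) b (q i.+1) om * dexp_prod i.+1 n om.
  by apply/funext => om; rewrite wE /z; ring.
have F2 : (fun om => weight om * y om) = fun om =>
   z om * dexp (c i) a b om * dexp (c i) b (q i.+1) om * dexp_prod i.+1 n om.
  by apply/funext => om; rewrite wE /z; ring.
rewrite F1 F2 E6 E5 E4 E6' E5' E4'; split => //.
- exact: az6'.2.
- exact: az6.2.
Qed.

Definition cell_fun r : R := \sum_(i < n) c i * \1_`]q i, q i.+1] r.

(** Grid points projected to [a, b]: consecutive values bound the intersection of a cell with ]a,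
    b]. *)
Let clamp a b i := Num.max a (Num.min b (q i)).

Let clamp_mono a b i : clamp a b i <= clamp a b i.+1.
Proof. by rewrite /clamp ge_max !le_max lexx/= le_min !ge_min lexx (q_mono (leqnSn i)) !orbT. Qed.

Let clamp_cell a b i : clamp a b i = clamp a b i.+1 \/
  q i <= clamp a b i /\ clamp a b i.+1 <= q i.+1.
Proof.
have := q_mono (leqnSn i); rewrite /clamp /Num.max /Num.min.
case: (ltP b (q i)) => h1; case: (ltP b (q i.+1)) => h2; do ?case: ltP => h3;
  do ?case: ltP => h4 => h5; first [by left; lra|by right; split; lra].
Qed.

Let clamp_indic a b i r : a <= b ->
  \1_`]q i, q i.+1] r * \1_`]a, b] r = \1_`]clamp a b i, clamp a b i.+1] r :> R.
Proof.
move=> ab; rewrite !indicE !mem_setE !in_itv/= -natrM mulnb; congr (_%:R); congr nat_of_bool.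
rewrite /clamp gt_max gt_min le_max le_min.
by case: (ltP a r) => ar; case: (leP r b) => rb //=; rewrite ?andbT ?andbF ?orbF//;
  case: (ltP (q i) r).
Qed.

Let clampn a b : t <= a -> a <= b -> b <= T -> clamp a b n = b.
Proof. by move=> ta ab bT; rewrite /clamp qn min_l// max_r. Qed.

Let clamp0 a b : t <= a -> a <= b -> clamp a b 0 = a.
Proof. by move=> ta ab; rewrite /clamp q0 max_l// ge_min ta orbT. Qed.

Let le_clamp a b i : a <= clamp a b i.
Proof. by rewrite le_max lexx. Qed.

Let integral_cell_fun a b : a <= b ->
  mu.-integrable setT (EFin \o fun r => cell_fun r * \1_`]a, b] r) /\
  \int[mu]_r (cell_fun r * \1_`]a, b] r) = \sum_(i < n) c i * (clamp a b i.+1 - clamp a b i).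
Proof.
move=> ab.
have i1 i : mu.-integrable setT (EFin \o (\1_`]clamp a b i, clamp a b i.+1] : R -> R)).
  have s1 : sqint mu (\1_`]clamp a b i, clamp a b i.+1] : R -> R).
    apply: (@sqint_indic_itv R _ (clamp a b i) (clamp a b i.+1)) => r /=.
    by rewrite !in_itv/= => /andP[/ltW -> ->].
  by have := sqint_integrableM s1 s1; apply: eq_integrable => // r _ /=; rewrite indicM.
have iF i : mu.-integrable setT (EFin \o fun r => c i * \1_`]clamp a b i, clamp a b i.+1] r).
  exact: (integrableZl measurableT (c i) (i1 i)).
have E r : cell_fun r * \1_`]a, b] r = \sum_(i < n) c i * \1_`]clamp a b i, clamp a b i.+1] r.
  rewrite /cell_fun mulr_suml; apply: eq_bigr => i _.
  by rewrite -mulrA clamp_indic.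
have [h1 h2] := sum_Rintegral n iF; split.
  by have := h1; apply: eq_integrable => // r _ /=; rewrite E.
transitivity (\int[mu]_r (\sum_(i < n) c i * \1_`]clamp a b i, clamp a b i.+1] r)).
  by apply: eq_Rintegral => r _; exact: E.
rewrite h2; apply: eq_bigr => i _.
rewrite (RintegralZl _ measurableT (i1 i)).
congr (_ * _); rewrite /Rintegral integral_indic// setIT.
transitivity (fine (mu [set` `]clamp a b i, clamp a b i.+1]%R])) => //.
rewrite lebesgue_measure_itv/= lte_fin; have := clamp_mono a b i.
by rewrite le_eqVlt => /predU1P[->|->//]; rewrite ltxx subrr.
Qed.

(** ]a, b] is cut along the grid. Each nonempty piece lies in one cell, where [integral_weight_cell]
    applies, and the increments telescope. *)
Let integral_weight_dw a b y : t <= a -> a <= b -> b <= T -> Fm a y -> bounded_rv y ->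
  \int[P]_om (weight om * (y om * dw a b om)) =
  \int[mu]_r (cell_fun r * \1_`]a, b] r) * \int[P]_om (weight om * y om).
Proof.
move=> ta ab bT my by_.
have [_ ->] := integral_cell_fun ab; rewrite mulr_suml.
have cell i : (i < n)%N ->
   P.-integrable setT (EFin \o fun om => weight om * (y om * dw (clamp a b i) (clamp a b i.+1) om)) /\
   \int[P]_om (weight om * (y om * dw (clamp a b i) (clamp a b i.+1) om)) =
     c i * (clamp a b i.+1 - clamp a b i) * \int[P]_om (weight om * y om).
  move=> ni; have [e|[h1 h2]] := clamp_cell a b i.
    rewrite -e subrr mulr0 mul0r.
    have -> : (fun om => weight om * (y om * dw (clamp a b i) (clamp a b i) om)) = fun=> 0.
      by apply/funext => om; rewrite dwxx !mulr0.
    by split; [exact: integrable0|rewrite /Rintegral integral0].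
  by have [_ ? ?] := integral_weight_cell ni (le_clamp a b i) (clamp_mono a b i) h1 h2 my by_.
have tele m : (m <= n)%N ->
    P.-integrable setT (EFin \o fun om => weight om * (y om * dw (clamp a b 0) (clamp a b m) om)) /\
    \int[P]_om (weight om * (y om * dw (clamp a b 0) (clamp a b m) om)) =
    \sum_(i < m) c i * (clamp a b i.+1 - clamp a b i) * \int[P]_om (weight om * y om).
  elim: m => [_|m ih mn].
    have -> : (fun om => weight om * (y om * dw (clamp a b 0) (clamp a b 0) om)) = fun=> 0.
      by apply/funext => om; rewrite dwxx !mulr0.
    by rewrite big_ord0; split; [exact: integrable0|rewrite /Rintegral integral0].
  have [ih1 ih2] := ih (ltnW mn); have [c1 c2] := cell m mn.
  have -> : (fun om => weight om * (y om * dw (clamp a b 0) (clamp a b m.+1) om)) =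
      fun om => weight om * (y om * dw (clamp a b 0) (clamp a b m) om) +
        weight om * (y om * dw (clamp a b m) (clamp a b m.+1) om).
    by apply/funext => om; rewrite /increment; ring.
  by rewrite big_ord_recr/= -ih2 -c2 RintegralD//; split => //; exact: (integrableD measurableT ih1 c1).
have [_] := tele n (leqnn n); rewrite clamp0// clampn//.
Qed.

Lemma sqint_cell_fun : sqint mu cell_fun.
Proof.
apply: sqint_sum => i; apply: sqintZ; apply: (@sqint_indic_itv R _ (q i) (q i.+1)) => r /=.
by rewrite !in_itv/= => /andP[/ltW -> ->].
Qed.

(** The square of a density factor is e^(c²(b-a)) times the factor with parameter 2c, again of mean
    1. *)
Let square_dexp_prod (L : R) j : (forall i, (i < n)%N -> `|c i| <= L) -> (j <= n)%N ->
  adapted_int (q j) (fun om => dexp_prod 0 j om ^+ 2) /\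
  \int[P]_om (dexp_prod 0 j om ^+ 2) <= expR (L ^+ 2 * (q j - q 0)).
Proof.
move=> cL; elim: j => [_|j ih jn].
  have -> : (fun om => dexp_prod 0 0 om ^+ 2) = fun=> 1.
    by apply/funext => om; rewrite /dexp_prod big_geq// expr1n.
  rewrite subrr mulr0 expR0; split; first split.
  - exact: measurable_cst.
  - by have := sqint_integrable (sqint1 P).
  - rewrite /Rintegral integral_cst//= mul1e.
    by rewrite probability_setT.
have [az le1] := ih (ltnW jn).
have [az' E'] := adapted_int_dexp (2 * c j) (qge0 j) (q_mono (leqnSn j)) (qleT jn) az.
set k := expR (c j ^+ 2 * (q j.+1 - q j)).
have E : (fun om => dexp_prod 0 j.+1 om ^+ 2) =
    fun om => k * (dexp_prod 0 j om ^+ 2 * dexp (2 * c j) (q j) (q j.+1) om).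
  apply/funext => om; rewrite /dexp_prod big_nat_recr//= exprMn [RHS]mulrCA; congr (_ * _).
  by rewrite /dexp /k -expRD expr2 -expRD; congr expR; field.
rewrite E; split.
  by split; [apply: measurable_funM => //; exact: az'.1|exact: (integrableZl measurableT k az'.2)].
rewrite RintegralZl//; last exact: az'.2.
rewrite E' (_ : L ^+ 2 * _ = L ^+ 2 * (q j.+1 - q j) + L ^+ 2 * (q j - q 0%N)); last by ring.
rewrite expRD ler_pM ?expR_ge0//.
  by apply: Rintegral_ge0 => om _; exact: sqr_ge0.
rewrite ler_expR ler_wpM2r ?subr_ge0 ?q_mono//.
by rewrite -(real_normK (num_real (c j))) ler_pXn2r ?nnegrE ?cL// (le_trans _ (cL j jn)).
Qed.

(** The bound depends on the drift only through [L], not on the number of cells, which lets the mesh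
    go to 0. *)
Lemma sqint_weight (L : R) : (forall i, (i < n)%N -> `|c i| <= L) -> (forall om, `|x om| <= 1) ->
  sqint P weight /\ ip P weight weight <= expR (L ^+ 2 * (T - t)).
Proof.
move=> cL x1; have [[mr ir] le1] := square_dexp_prod cL (leqnn n).
have [mw _] := (adapted_int_prod (leq0n n) (leqnn n) adx).1.
have sr : sqint P (dexp_prod 0 n).
  split.
    have ad1 : adapted_int (q 0%N) (fun=> 1).
      by split; [exact: measurable_cst|exact: sqint_integrable (sqint1 P)].
    have [h _] := (adapted_int_prod (leq0n n) (leqnn n) ad1).1.
    have := Fm_measurable w_bm (qleT (leqnn n)) h; congr measurable_fun; apply/funext => om.
    by rewrite mul1r.
  move/integrableP: ir => [_]; congr (_ < _)%E; apply: eq_integral => om _ /=.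
  by rewrite ger0_norm ?sqr_ge0.
have sw : sqint P weight by apply: (sqint_mull _ x1 sr); exact: (Fm_measurable w_bm _ mx).
split => //; rewrite -q0 -qn; apply: le_trans le1; rewrite (_ : \int[P]_om _ = ip P (dexp_prod 0 n) (dexp_prod 0 n)).
  apply: ip_le => // om; rewrite /weight mulrACA -!expr2 ler_piMl ?sqr_ge0//.
  by rewrite -(real_normK (num_real (x om))) expr_le1.
by apply: eq_Rintegral => om _; rewrite expr2.
Qed.

Lemma weight_ge0 om : 0 <= x om -> 0 <= weight om.
Proof. by move=> x0; rewrite mulr_ge0// prodr_ge0// => i _; exact: dexp_ge0. Qed.

(** All density factors belong to times after t, so against variables known at t the product has
    mean 1. *)
Lemma integral_weight y : Fm t y -> P.-integrable setT (EFin \o y) ->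
  \int[P]_om (weight om * y om) = \int[P]_om (x om * y om).
Proof.
move=> my iy.
have ayx : adapted_int (q 0%N) (fun om => y om * x om) by rewrite q0; exact: adapted_intM.
have [_ E] := adapted_int_prod (leq0n n) (leqnn n) ayx.
transitivity (\int[P]_om (y om * x om * dexp_prod 0 n om)).
  by apply: eq_Rintegral => om _; rewrite /weight; ring.
by rewrite E; apply: eq_Rintegral => om _; rewrite mulrC.
Qed.

(** For a single step this is [integral_weight_dw]; the weight being square integrable, both sides
    pass to the L² limit. *)
Lemma girsanov s f J : t <= s -> s <= T -> sqint P weight -> ito P w s T f J ->
  ip P weight J = ip M (fun p => cell_fun p.1 * weight p.2) (cut s T f).
Proof.
move=> ts sT sw [sJ sf [l [vl cl cJ]]].
have s0 : 0 <= s by rewrite (le_trans t0).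
have sl k := sqint_eval w_bm (lexx T) (vl k).
have sI k := sqint_eint w_bm s0 (lexx T) (vl k).
have scw : sqint M (fun p => cell_fun p.1 * weight p.2) by exact: (sqint_tensor sqint_cell_fun sw).
have c1 := L2cvg_ip sI sJ sw cJ; have c2 := L2cvg_ip sl sf scw cl.
rewrite ipC [RHS]ipC; apply: (cvg_unique (@norm_hausdorff _ R^o) c1).
apply: cvg_trans c2; apply: near_eq_cvg; apply: nearW => k.
move: (vl k); elim: (l k) => [_|e l' ih /= [ve vl']].
  by rewrite eint_nil eval_nil !ip0l.
rewrite eint_cons eval_cons !ipDl//; last 4 first.
- exact: (sqint_eint1 w_bm s0 (lexx T) ve).
- exact: (sqint_eint w_bm s0 (lexx T) vl').
- exact: (sqint_eval1 w_bm (lexx T) ve).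
- exact: (sqint_eval w_bm (lexx T) vl').
congr (_ + _); last exact: ih.
have [sp pq qT my by_] := ve.
rewrite [RHS]ipC ipC.
transitivity (\int[P]_om (weight om * (e.1.1 om * dw e.1.2 e.2 om))) => //.
rewrite integral_weight_dw ?(le_trans ts)//.
have [ic _] := integral_cell_fun pq.
rewrite -Rintegral_tensor//; last first.
  have m1 := Fm_measurable w_bm (le_trans pq qT) my.
  exact: sqint_integrableM sw (sqint_bounded P m1 by_).
by apply: eq_Rintegral => p _; rewrite /eval1; ring.
Qed.

End grid.

End girsanov.

Lemma integrable_bounded_mull d (S : measurableType d) (R : realType)
    (m : {measure set S -> \bar R}) (g f : S -> R) K : measurable_fun setT g ->
  (forall x, `|g x| <= K) -> m.-integrable setT (EFin \o f) ->
  m.-integrable setT (EFin \o fun x => g x * f x).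
Proof.
move=> mg gK iF; apply: (le_integrable measurableT _ _ (integrableZl measurableT K iF)).
  apply/measurable_EFinP; apply: measurable_funM => //.
  by apply/measurable_EFinP; exact: measurable_int iF.
move=> x _ /=; rewrite lee_fin !normrM; apply: ler_wpM2r => //.
exact: le_trans (gK x) (ler_norm _).
Qed.

Section slices_tensor.
Context (R : realType) (d : measure_display) (Om : measurableType d).
Context (P : probability Om R).
Local Notation mu := (@lebesgue_measure R).
Local Notation M := (mu \x P)%E.

Lemma integrable_ip_slices s t x (f : R -> Om -> R) : sqint P x -> sqint M (cut s t f) ->
  mu.-integrable setT (EFin \o fun r => \1_`[s, t] r * ip P x (f r)).
Proof.
move=> sx sf; have := integrable_slices (sqint_cst s t sx) sf; apply: eq_integrable => // r _ /=.
by rewrite ip_slice_cut ipC ip_slice_cut mulrA indicM ipC.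
Qed.

Lemma ip_tensor_cut s t g K x (f : R -> Om -> R) : sqint mu g -> (forall r, `|g r| <= K) ->
  sqint P x -> sqint M (cut s t f) ->
  mu.-integrable setT (EFin \o fun r => g r * (\1_`[s, t] r * ip P x (f r))) /\
  ip M (fun p => g p.1 * x p.2) (cut s t f) =
  \int[mu]_r (g r * (\1_`[s, t] r * ip P x (f r))).
Proof.
move=> sg gK sx sf; have sgx : sqint M (fun p => g p.1 * x p.2) by exact: sqint_tensor.
have i1 := integrable_bounded_mull sg.1 gK (integrable_ip_slices sx sf).
split => //; rewrite ip_slices//; apply: Rintegral_ae => //; first exact: (integrable_slices sgx sf).
apply: ae_mono (sqint_slice1 sf) => r sfr.
have -> : ip P (fun om => g r * x om) (fun om => cut s t f (r, om)) = g r * ip P x (fun om => cut s t f (r, om)).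
  exact: ipZl.
by rewrite ipC ip_slice_cut ipC.
Qed.

Lemma sqint_cut_left t s T (g : R -> Om -> R) : t <= s -> sqint M (cut t T g) -> sqint M (cut s T g).
Proof.
move=> ts sg.
have -> : cut s T g = fun p => \1_`[s, T] p.1 * cut t T g p.
  apply/funext => p; rewrite /cut mulrA; congr (_ * _).
  rewrite !indicE !mem_setE !in_itv/= -natrM mulnb; congr (_%:R); congr nat_of_bool.
  by case: (leP s p.1) => //= sp; rewrite (le_trans ts sp) andbb.
apply: (@sqint_mull _ _ _ _ _ _ 1) => //.
  by apply: (measurableT_comp (f := \1_`[s, T] : R -> R)) => //; exact: measurable_indic.
by move=> p; rewrite indicE; case: (_ \in _); rewrite ?normr1 ?normr0.
Qed.

End slices_tensor.

(** * Comparison with deterministic continuous slopes *)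

Section linear_comparison.
Context (R : realType) (d : measure_display) (Om : measurableType d).
Context (P : probability Om R) (T : R) (w : R -> Om -> R).
Hypothesis w_bm : brownian_motion P T w.
Local Notation mu := (@lebesgue_measure R).
Local Notation M := (mu \x P)%E.
Local Notation Fm := (Fm P w).
Variables (t L : R) (t0 : 0 <= t) (tT : t <= T).
Variables (al be : R -> R) (y z f : R -> Om -> R) (C : Om -> R).
Hypotheses (al_cont : continuous al) (be_cont : continuous be).
Hypotheses (alL : forall r, `|al r| <= L) (beL : forall r, `|be r| <= L).
Hypotheses (sy : sqint M (cut t T y)) (sz : sqint M (cut t T z)) (sf : sqint M (cut t T f)).
Hypothesis (syr : forall r, t <= r <= T -> sqint P (y r)).
Hypothesis (Fmy : Fm t (y t)).
Hypotheses (sC : sqint P C) (C_le0 : {ae P, forall om, C om <= 0}).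
Hypothesis f_le : {ae M, forall p, t <= p.1 <= T ->
  f p.1 p.2 <= al p.1 * y p.1 p.2 + be p.1 * z p.1 p.2}.
Hypothesis eq_y : forall s, t <= s <= T -> exists2 J, ito P w s T z J &
  {ae P, forall om, y s om = C om + tint s T f om - J om}.

Let L0 : 0 <= L. Proof. exact: le_trans (alL 0). Qed.
(* The event on which the comparison fails; its weighted expectation of y t is
   shown to be nonpositive. *)
Let x : Om -> R := \1_[set om | 0 < y t om].

Let x01 om : `|x om| <= 1.
Proof. by rewrite /x indicE; case: (_ \in _); rewrite ?normr1 ?normr0. Qed.

Let x_ge0 om : 0 <= x om. Proof. by rewrite /x indicE. Qed.

Let mx : Fm t x.
Proof.
apply: (@measurable_indic _ (filtType P w t)).
have h : measurable_fun (setT : set (filtType P w t)) (fun om => 0 < y t om).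
  by apply: measurable_fun_ltr => //; exact: measurable_cst.
by have := h measurableT [set true] I; rewrite setTI.
Qed.

Section grid_weight.
Variable N : nat.
Let n := N.+1.
Let h := (T - t) / n%:R.
Let q i := t + i%:R * h.
Let c i := be (q i).

Let h0 : 0 <= h. Proof. by rewrite divr_ge0// subr_ge0. Qed.
Let q0 : q 0%N = t. Proof. by rewrite /q mul0r addr0. Qed.
Let qn : q n = T. Proof. by rewrite /q /h mulrC divfK ?pnatr_eq0// addrC subrK. Qed.
Let q_mono i j : (i <= j)%N -> q i <= q j.
Proof. by move=> ij; rewrite lerD2l ler_wpM2r// ler_nat. Qed.

Let cf := cell_fun n q c.

Let sum_cells m r : \sum_(i < m) \1_`]q i, q i.+1] r = \1_`]q 0%N, q m] r :> R.
Proof.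
elim: m => [|m ih]; first by rewrite big_ord0 indicE mem_setE in_itv/= ltNge andNb.
rewrite big_ord_recr/= ih !indicE !mem_setE !in_itv/=.
have h1 := q_mono (leq0n m); have h2 := q_mono (leqnSn m).
case: (ltP (q 0%N) r) => r0 /=; last by rewrite (ltNge (q m)) (le_trans r0 h1) addr0.
by case: (ltP (q m) r) => rm /=; rewrite ?add0r// (le_trans rm h2) addr0.
Qed.

Lemma cf_bound r : `|cf r| <= L.
Proof.
rewrite /cf /cell_fun (le_trans (ler_norm_sum _ _ _))//.
apply: le_trans (_ : \sum_(i < n) L * \1_`]q i, q i.+1] r <= _).
  by apply: ler_sum => i _; rewrite normrM ler_pM// /c ?beL// ger0_norm// indicE.
by rewrite -mulr_sumr sum_cells ler_piMr// indicE; case: (_ \in _).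
Qed.

(** A time in ]t, T] lies in exactly one cell, and the left endpoint, where [be] is sampled, is
    within the mesh [h]. Cells are open on the left, so t itself is in none. *)
Lemma cell_approx r e : t < r <= T -> (forall r', `|r' - r| <= h -> `|be r' - be r| <= e) ->
  `|be r - cf r| <= e.
Proof.
move=> /andP[tr rT] he; have e0 : 0 <= e by apply: le_trans (he r _); rewrite // subrr normr0.
have E : be r - cf r = \sum_(i < n) (be r - c i) * \1_`]q i, q i.+1] r.
  under eq_bigr do rewrite mulrBl.
  rewrite sumrB -mulr_sumr sum_cells indicE mem_setE in_itv/= q0 qn tr rT mulr1//.
rewrite E (le_trans (ler_norm_sum _ _ _))//.
apply: le_trans (_ : \sum_(i < n) e * \1_`]q i, q i.+1] r <= _); last first.
  by rewrite -mulr_sumr sum_cells ler_piMr// indicE; case: (_ \in _).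
apply: ler_sum => i _; rewrite normrM indicE mem_setE in_itv/=.
have [/andP[qr rq]|_] := boolP (q i < r <= q i.+1); last by rewrite normr0 !mulr0.
rewrite normr1 !mulr1 distrC; apply: he; rewrite distrC ger0_norm; last by rewrite subr_ge0 ltW.
by move: rq; rewrite /q -natr1 mulrDl mul1r; lra.
Qed.

Let wt := weight w n q c x.

Let sqint_wt : sqint P wt /\ ip P wt wt <= expR (L ^+ 2 * (T - t)).
Proof.
apply: (sqint_weight w_bm t0 q0 qn q_mono mx _ _ x01).
  by exists 1; exact: x01.
by move=> i _; exact: beL.
Qed.

Variables (m : R -> R) (Cm : R).
Hypotheses (m_cont : {within `[t, T], continuous m}) (m_ge0 : forall r, 0 <= m r).
Hypothesis mC : forall r, t <= r <= T -> m r <= Cm.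
Hypothesis mE : forall s, t <= s <= T -> m s = 1 + \int[mu]_(r in `[t, s]) (al r * m r).

Let ind r : R := \1_`[t, T] r.
Let ind1 r : t <= r <= T -> ind r = 1.
Proof. by move=> rT; rewrite /ind indicE mem_setE in_itv/= rT. Qed.
Let ind0 r : ~~ (t <= r <= T) -> ind r = 0.
Proof. by move=> rT; rewrite /ind indicE mem_setE in_itv/= (negbTE rT). Qed.

Let mm r := ind r * m r.
Let mm_ge0 r : 0 <= mm r. Proof. by rewrite mulr_ge0// /ind indicE. Qed.
Let Cm0 : 0 <= Cm. Proof. by apply: le_trans (m_ge0 t) (mC _); rewrite lexx tT. Qed.
Let mmC r : `|mm r| <= Cm.
Proof.
rewrite ger0_norm// /mm; have [rT|rT] := boolP (t <= r <= T); first by rewrite ind1// mul1r mC.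
by rewrite ind0// mul0r.
Qed.

Let mmm : measurable_fun setT mm.
Proof. by apply: measurable_fun_indic_restrict => //; exact: subspace_continuous_measurable_fun. Qed.

Let smm : sqint mu mm.
Proof.
have := @sqint_mull _ _ _ mu mm ind Cm mmm mmC (sqint_indic t T).
by congr sqint; apply/funext => r; rewrite /mm mulrAC -/(ind r) /ind indicM.
Qed.

Let smull (g : R -> R) (K : R) : measurable_fun setT g -> (forall r, `|g r| <= K) -> sqint mu (fun r => g r * mm r).
Proof. by move=> mg gK; exact: (@sqint_mull _ _ _ mu g mm K mg gK smm). Qed.

Let bmull (g : R -> R) (K : R) r : (forall r, `|g r| <= K) -> `|g r * mm r| <= K * Cm.
Proof. by move=> gK; rewrite normrM ler_pM. Qed.

Let mcf : measurable_fun setT cf. Proof. exact: (sqint_cell_fun n q c).1. Qed.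
Let mal : measurable_fun setT al. Proof. exact: continuous_measurable_fun. Qed.
Let mbe : measurable_fun setT be. Proof. exact: continuous_measurable_fun. Qed.
Let swt : sqint P wt. Proof. by case: sqint_wt. Qed.
Let Y r := ip P wt (y r).
(** Minus the time derivative of [Y], once [girsanov] has turned the stochastic integral into a time
    integral; [ff] is what remains after removing al Y. *)
Let phi r := ind r * ip P wt (f r) - cf r * (ind r * ip P wt (z r)).
Let ff r := phi r - al r * Y r.

Let icz := ip_tensor_cut (sqint_cell_fun n q c) cf_bound swt sz.

Let iphi : mu.-integrable setT (EFin \o phi).
Proof. exact: (integrableB measurableT (integrable_ip_slices swt sf) icz.1). Qed.

Let phi0 r : ~~ (t <= r <= T) -> phi r = 0.
Proof. by move=> rT; rewrite /phi ind0// !mul0r mulr0 subr0. Qed.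

Let yE r : t <= r <= T -> Y r = ip P wt C + \int[mu]_s (\1_`[r, T] s * phi s).
Proof.
move=> rT; have [J iJ eJ] := eq_y rT; have [tr rT'] := andP rT.
have sJ : sqint P J by case: iJ.
have sfr := sqint_cut_left tr sf; have szr := sqint_cut_left tr sz.
have stf := sqint_tint rT' sfr.
rewrite /Y (ip_ae (f' := wt) (g' := fun om => C om + tint r T f om - J om) swt (syr rT) swt); last 2 first.
- by apply: sqintB => //; exact: sqintD.
- by apply: ae_mono eJ => om ->.
rewrite ipBr//; last exact: sqintD.
rewrite ipDr// -addrA; congr (_ + _).
rewrite ip_tint_slices//.
rewrite (girsanov w_bm t0 q0 qn q_mono mx _ tr rT' swt iJ); last by exists 1; exact: x01.
have [i2 ->] := ip_tensor_cut (sqint_cell_fun n q c) cf_bound swt szr.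
rewrite -RintegralB//; last exact: (integrable_ip_slices swt sfr).
apply: eq_Rintegral => s _; rewrite indicE mem_setE in_itv/=.
have [/andP[rs sT]|_] := boolP (r <= s <= T); last by rewrite !mul0r mulr0 subr0.
by rewrite /phi ind1 ?(le_trans tr rs) ?sT// !mul1r.
Qed.

Let iff : mu.-integrable setT (EFin \o fun r => ind r * ff r).
Proof.
have h1 := @integrable_bounded_mull _ _ _ mu _ _ _ mal alL (integrable_ip_slices swt sy).
have := integrableB measurableT iphi h1; apply: eq_integrable => // r _ /=; congr EFin.
rewrite /ff mulrBr [RHS]addrC [LHS]addrC; congr (_ + _); first by rewrite mulrCA.
have [rT|rT] := boolP (t <= r <= T); first by rewrite ind1// mul1r.
by rewrite phi0// mulr0.
Qed.

Let Yt : Y t = ip P wt C * m T + \int[mu]_r (mm r * ff r).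
Proof.
apply: (volterra (C := Cm) (al := al) (phi := phi) tT _ mmm _ _ iphi phi0 yE iff).
- by move=> r rT; rewrite ger0_norm// mC.
- have := sqint_integrableM (sqint_indic t T) (smull mal alL).
  apply: eq_integrable => // r _ /=; congr EFin.
  rewrite /mm; have [rT|rT] := boolP (t <= r <= T); first by rewrite -/(ind r) ind1//; ring.
  by rewrite -/(ind r) ind0//; ring.
- move=> s sT; rewrite mE// Rintegral_mkcond; congr (_ + _); apply: eq_Rintegral => r _.
  by rewrite patchE indicE; case: (_ \in _); rewrite ?mul1r ?mul0r.
- by apply: aeW => r rT; rewrite /ff subrK.
Qed.

Let dbe r := be r - cf r.
Let mdbe : measurable_fun setT dbe. Proof. exact: measurable_funB. Qed.
Let dbeL r : `|dbe r| <= L + L.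
Proof. by rewrite (le_trans (ler_normB _ _))// lerD// cf_bound. Qed.

(** The terminal term is nonpositive, and in the bound [f_le] the term in y is removed by the
    integrating factor and the term in z by the weight, up to the mesh error be - cf. *)
Let Yt_le : Y t <= ip M (fun p => dbe p.1 * mm p.1 * wt p.2) (cut t T z).
Proof.
have s1 : sqint M (fun p => mm p.1 * wt p.2) by exact: sqint_tensor.
have s2 : sqint M (fun p => cf p.1 * mm p.1 * wt p.2) by exact: (sqint_tensor (smull mcf cf_bound) swt).
have s3 : sqint M (fun p => al p.1 * mm p.1 * wt p.2) by exact: (sqint_tensor (smull mal alL) swt).
have s4 : sqint M (fun p => dbe p.1 * mm p.1 * wt p.2) by exact: (sqint_tensor (smull mdbe dbeL) swt).
have [j1 E1] := ip_tensor_cut smm mmC swt sf.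
have [j2 E2] := ip_tensor_cut (smull mcf cf_bound) (fun r => bmull r cf_bound) swt sz.
have [j3 E3] := ip_tensor_cut (smull mal alL) (fun r => bmull r alL) swt sy.
have -> : Y t = ip P wt C * m T + (ip M (fun p => mm p.1 * wt p.2) (cut t T f) -
    ip M (fun p => cf p.1 * mm p.1 * wt p.2) (cut t T z) - ip M (fun p => al p.1 * mm p.1 * wt p.2) (cut t T y)).
  rewrite Yt; congr (_ + _); rewrite E1 E2 E3 -RintegralB// -RintegralB//; last exact: (integrableB measurableT j1 j2).
  apply: eq_Rintegral => r _; rewrite /ff /phi /Y /mm.
  have [rT|rT] := boolP (t <= r <= T); first by rewrite -/(ind r) ind1//; ring.
  by rewrite -/(ind r) ind0//; ring.
have A0 : ip P wt C <= 0.
  rewrite -(ip0l P C); apply: ip_le_ae => //; first exact: sqint0.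
  by apply: ae_mono C_le0 => om C0; rewrite mul0r mulr_ge0_le0// weight_ge0.
have A1 : ip P wt C * m T <= 0 by rewrite mulr_le0_ge0.
rewrite -[X in _ <= X]add0r lerD// -subr_ge0.
have k1 := sqint_integrableM s1 sf; have k2 := sqint_integrableM s2 sz.
have k3 := sqint_integrableM s3 sy; have k4 := sqint_integrableM s4 sz.
have k12 := integrableB measurableT k1 k2.
have k123 := integrableB measurableT k12 k3.
rewrite /ip -RintegralB// -RintegralB// -RintegralB//.
apply: Rintegral_ge0_ae; first exact: (integrableB measurableT k4 k123).
apply: ae_mono f_le => p fp; rewrite /cut -/(ind p.1).
have [pT|pT] := boolP (t <= p.1 <= T); last by rewrite ind0// !(mul0r, mulr0) !subr0.
have w0 : 0 <= wt p.2 by rewrite weight_ge0.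
rewrite ind1// /dbe; set Z1 := wt p.2 in w0 *; set Z2 := mm p.1.
rewrite (_ : _ - _ = Z2 * Z1 * (al p.1 * y p.1 p.2 + be p.1 * z p.1 p.2 - f p.1 p.2)); last by ring.
by apply: mulr_ge0; [apply: mulr_ge0 => //; exact: mm_ge0|rewrite subr_ge0; exact: fp].
Qed.

(** Cauchy-Schwarz in [Yt_le]: the factor with be - cf tends to 0 with the mesh, while the norm of
    the weight is bounded uniformly in the grid. *)
Lemma positive_part_bound : \int[P]_om (x om * y t om) <=
  Cm * Num.sqrt (\int[mu]_r ((ind r * (be r - cf r)) ^+ 2)) *
  (Num.sqrt (expR (L ^+ 2 * (T - t))) * Num.sqrt (ip M (cut t T z) (cut t T z))).
Proof.
have tt : t <= t <= T by rewrite lexx tT.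
have -> : \int[P]_om (x om * y t om) = Y t.
  rewrite /Y /ip (integral_weight w_bm c t0 q0 qn q_mono mx _ Fmy)//; first by exists 1; exact: x01.
  exact: sqint_integrable (syr tt).
apply: (le_trans Yt_le).
have s4 : sqint M (fun p => dbe p.1 * mm p.1 * wt p.2) by exact: (sqint_tensor (smull mdbe dbeL) swt).
apply: le_trans (ler_norm _) _; apply: le_trans (ip_CS_sqrt s4 sz) _.
rewrite mulrA ler_wpM2r ?sqrtr_ge0//.
have sd : sqint mu (fun r => ind r * dbe r).
  have := @sqint_mull _ _ _ mu _ _ _ mdbe dbeL (sqint_indic t T).
  by congr sqint; apply/funext => r; rewrite mulrC.
have sdm := smull mdbe dbeL.
have -> : ip M (fun p => dbe p.1 * mm p.1 * wt p.2) (fun p => dbe p.1 * mm p.1 * wt p.2) =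
    ip mu (fun r => dbe r * mm r) (fun r => dbe r * mm r) * ip P wt wt.
  rewrite -Rintegral_tensor//; [|exact: sqint_integrableM|exact: sqint_integrableM].
  by apply: eq_Rintegral => p _; ring.
rewrite sqrtrM ?ip_ge0// ler_pM ?sqrtr_ge0//; last by rewrite ler_sqrt ?expR_ge0//; case: sqint_wt.
have le1 : ip mu (fun r => dbe r * mm r) (fun r => dbe r * mm r) <=
    Cm ^+ 2 * \int[mu]_r ((ind r * dbe r) ^+ 2).
  rewrite -RintegralZl//; last exact: sqint_integrable2.
  apply: le_Rintegral => //; first exact: sqint_integrableM.
    exact: (integrableZl measurableT (Cm ^+ 2) (sqint_integrable2 sd)).
  move=> r _; rewrite /mm; have [rT|rT] := boolP (t <= r <= T); last by rewrite ind0// !(mul0r, mulr0, expr0n).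
  have := mC rT; have := m_ge0 r; rewrite ind1// !mul1r => m1 m2.
  rewrite -expr2 exprMn mulrC ler_wpM2r ?sqr_ge0// ler_pXn2r// nnegrE//.
rewrite -(ler_sqrt (ip mu _ _)) in le1; last by rewrite mulr_ge0 ?sqr_ge0// Rintegral_ge0// => r _; exact: sqr_ge0.
by move: le1; rewrite sqrtrM ?sqr_ge0// sqrtr_sqr (ger0_norm Cm0).
Qed.

End grid_weight.

Lemma linear_comparison : {ae P, forall om, y t om <= 0}.
Proof.
have [m [m_cont m_ge0 mE]] := integrating_factor tT al_cont.
have [c0 _ mc0] := EVT_max tT m_cont.
have mC r : t <= r <= T -> m r <= m c0 by move=> rT; apply: mc0; rewrite in_itv.
have bnd N := positive_part_bound N m_cont m_ge0 mC mE.
pose qq N i := t + i%:R * ((T - t) / N.+1%:R).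
pose cf N := cell_fun N.+1 (qq N) (fun i => be (qq N i)).
pose e N := \int[mu]_r ((\1_`[t, T] r * (be r - cf N r)) ^+ 2).
have mcf N : measurable_fun setT (cf N) by exact: (sqint_cell_fun _ _ _).1.
(* Continuity of [be] gives the limit at every r > t; the point t that is left out is
   Lebesgue-null. *)
have c1 (r : R) : t < r <= T -> (fun N => be r - cf N r) @ \oo --> 0.
  move=> tr; apply/cvgrPdist_le => ep ep0.
  have /cvgrPdist_le/(_ _ ep0)[dl /= dl0 hd] : be @ r --> be r by exact: be_cont.
  have hN : (fun N => (T - t) / N.+1%:R) @ \oo --> 0.
    rewrite -[X in _ --> X](mulr0 (T - t)); apply: cvgMl_tmp.
    exact: cvg_harmonic.
  move/cvgrPdist_lt: hN => /(_ _ dl0); apply: filterS => N.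
  rewrite !sub0r !normrN ger0_norm ?divr_ge0 ?subr_ge0// => hN.
  apply: (cell_approx tr) => r' hr'; rewrite distrC; apply: hd => /=; rewrite distrC.
  exact: le_lt_trans hr' hN.
have e0 : e @ \oo --> 0.
  have mind : measurable_fun setT (\1_`[t, T] : R -> R) by exact: measurable_indic.
  have [] := @Rintegral_dominated_ae _ _ _ mu (fun N r => (\1_`[t, T] r * (be r - cf N r)) ^+ 2) (fun=> 0)
    (fun r => (L + L) ^+ 2 * (\1_`[t, T] r * \1_`[t, T] r)).
  - move=> N; apply: measurable_funX; apply: measurable_funM => //; apply: measurable_funB => //.
    + exact: continuous_measurable_fun.
    + exact: mcf.
  - exact: measurable_cst.
  - have : mu.-negligible [set t].
      by exists [set t]; split; [exact: measurable_set1|exact: lebesgue_measure_set1|].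
    apply: negligibleS => r /= nr; apply: contrapT => rt; apply: nr.
    have [rT|rT] := boolP (t <= r <= T); last first.
      by under eq_fun do rewrite indicE mem_setE in_itv/= (negbTE rT) mul0r expr0n/=; exact: cvg_cst.
    have tr : t < r <= T.
      by case/andP: rT => tr rT; rewrite rT lt_neqAle tr !andbT eq_sym; apply/eqP.
    rewrite indicE mem_setE in_itv/= rT.
    rewrite (_ : 0 = (1 * 0) ^+ 2); last by rewrite mul1r expr0n.
    by apply: cvgM; apply: cvgMl_tmp; exact: c1.
  - exact: (integrableZl measurableT _ (sqint_integrableM (sqint_indic t T) (sqint_indic t T))).
  - move=> N r; rewrite (ger0_norm (sqr_ge0 _)) exprMn mulrC -expr2 ler_wpM2r ?sqr_ge0//.
    rewrite -[X in X <= _](@real_normK R) ?num_real// ler_pXn2r ?nnegrE ?addr_ge0//.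
    by rewrite (le_trans (ler_normB _ _))// lerD// cf_bound.
  - move=> _; rewrite /e (_ : \int[mu]_x 0 = 0)//.
    by rewrite Rintegral_cst// mul0r.
have i0 : \int[P]_om (x om * y t om) <= 0.
  pose K := m c0 * (Num.sqrt (expR (L ^+ 2 * (T - t))) * Num.sqrt (ip M (cut t T z) (cut t T z))).
  have c2 : (fun N => K * Num.sqrt (e N)) @ \oo --> 0.
    rewrite -[X in _ --> X](mulr0 K) -[X in K * X]sqrtr0; apply: cvgMl_tmp.
    by apply: continuous_cvg _ _ e0; exact: sqrt_continuous.
  apply: (ler_cvg_to (cvg_cst _) c2); apply: nearW => N; apply: le_trans (bnd N) _.
  by rewrite /K -/(cf N) -/(e N) mulrAC.
have tt : t <= t <= T by rewrite lexx tT.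
have g0 om : 0 <= x om * y t om.
  rewrite /x indicE; have [yt|yt] := boolP (om \in _); last by rewrite mul0r.
  by rewrite mul1r; move: yt; rewrite inE => /ltW.
have mg : measurable_fun setT (fun om => x om * y t om).
  by apply: measurable_funM; [exact: (Fm_measurable w_bm tT mx)|exact: (syr tt).1].
have ig : P.-integrable setT (EFin \o fun om => x om * y t om).
  have sx : sqint P x.
    by apply: sqint_bounded; [exact: (Fm_measurable w_bm tT mx)|exists 1; exact: x01].
  exact: (sqint_integrableM sx (syr tt)).
(* The positive part of y t is nonnegative with integral at most 0, hence it vanishes almost
   surely. *)
have /(ae_eq_integral_abs _ measurableT) : measurable_fun setT (EFin \o fun om => x om * y t om).
  exact/measurable_EFinP.
move=> /(_ P) [+ _]; case.
  transitivity ((\int[P]_om (x om * y t om))%:E).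
    rewrite /Rintegral fineK ?(integrable_fin_num measurableT ig)//.
    by apply: eq_integral => om _ /=; rewrite ger0_norm.
  by congr EFin; apply/eqP; rewrite eq_le i0 Rintegral_ge0.
move=> N [mN N0 sN]; exists N; split => // om /= nom; apply: sN => /= om0; apply: nom.
case: (om0 I) => /eqP; rewrite mulf_eq0 /x indicE => /orP[|/eqP->//].
rewrite leNgt; apply: contraTN => yt; rewrite mem_set// oner_eq0//.
Unshelve. all: by end_near.
Qed.

End linear_comparison.

(** * Convexity of the backward component *)

Lemma convex_functionP (R : realType) (K : lmodType R) (D : set K) (f : K -> R) :
  @convex_function R K D f -> forall l x y, 0 <= l <= 1 -> D x -> D y ->
  f (l *: x + (1 - l) *: y) <= l * f x + (1 - l) * f y.
Proof.
move=> cf l x y /andP[l0 l1] Dx Dy.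
by have := cf (Itv01 l0 l1) x y (mem_set Dx) (mem_set Dy).
Qed.

(** Among p, 0 and 1 the middle point is a convex combination of the other two; solving that
    relation for [f p] gives the formula in each of the three orders. *)
Lemma affine_real (R : realType) (f : R -> R) :
  (forall l p q, 0 <= l <= 1 -> f (l * p + (1 - l) * q) = l * f p + (1 - l) * f q) ->
  forall p, f p = f 0 + p * (f 1 - f 0).
Proof.
move=> cf p; have [p0|p0] := ltP p 0.
  have p1 : 1 - p != 0 by rewrite gt_eqF//; lra.
  have l01 : 0 <= (1 - p)^-1 <= 1.
    by rewrite invr_ge0 invf_le1 ?subr_gt0; lra.
  have := cf (1 - p)^-1 p 1 l01.
  have -> : (1 - p)^-1 * p + (1 - (1 - p)^-1) * 1 = 0 by field.
  move=> /(congr1 (fun t => (1 - p) * t)); have -> : (1 - p) * ((1 - p)^-1 * f p + (1 - (1 - p)^-1) * f 1) = f p - p * f 1 by field.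
  by move=> h; rewrite -[f p](subrK (p * f 1)) -h; ring.
have [p1|p1] := leP p 1.
  by have := cf p 1 0; rewrite p0 p1 mulr1 mulr0 addr0 => -> //; ring.
have pn0 : p != 0 by rewrite gt_eqF//; lra.
have l01 : 0 <= p^-1 <= 1 by rewrite invr_ge0 invf_le1; lra.
have := cf p^-1 p 0 l01; rewrite mulVf// mulr0 addr0.
move=> /(congr1 (fun t => p * t)); have -> : p * (p^-1 * f p + (1 - p^-1) * f 0) = f p + (p - 1) * f 0 by field.
by move=> h; rewrite -[f p](addrK ((p - 1) * f 0)) -h; ring.
Qed.

Lemma affine_plane (R : realType) (f : R -> R -> R) :
  (forall l p q p' q', 0 <= l <= 1 ->
    f (l * p + (1 - l) * p') (l * q + (1 - l) * q') = l * f p q + (1 - l) * f p' q') ->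
  forall p q, f p q = f 0 0 + p * (f 1 0 - f 0 0) + q * (f 0 1 - f 0 0).
Proof.
move=> cf p q.
have h1 := @affine_real R (f ^~ 0) _ (2 * p); have h2 := @affine_real R (f 0) _ (2 * q).
have l01 : 0 <= (2^-1 : R) <= 1 by rewrite invr_ge0 ler0n invf_le1// ler1n.
(* (p, q) is the midpoint of (2p, 0) and (0, 2q), which lie on the axes. *)
have := cf _ (2 * p) 0 0 (2 * q) l01; rewrite !mulr0 addr0 add0r.
have -> : 2^-1 * (2 * p) = p by field.
have -> : (1 - 2^-1) * (2 * q) = q by field.
move=> ->; rewrite {}h1; last first.
  by move=> l y y' l1; have := cf l y 0 y' 0 l1; rewrite !mulr0 addr0.
rewrite {}h2; last first.
  by move=> l y y' l1; have := cf l 0 y 0 y' l1; rewrite !mulr0 addr0.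
by field.
Qed.

Lemma le_affine_bound (R : realType) (x y c : R) : (forall n : nat, n%:R * x <= n%:R * y + c) -> x <= y.
Proof.
move=> h; rewrite leNgt; apply/negP => yx.
have [n hn] : exists n : nat, c < n%:R * (x - y).
  exists (Num.bound `|c / (x - y)|); rewrite -ltr_pdivrMr ?subr_gt0//.
  exact: le_lt_trans (ler_norm _) (archi_boundP (normr_ge0 _)).
by have := h n; move: hn; rewrite mulrBr; lra.
Qed.

Section generator.
Context (R : realType) (T : R) (T0 : 0 <= T) (H H1 : hilbertType R).
Context (U : set H1) (v0 : H1) (Uv0 : U v0).
Context (a b : R -> H -> H1 -> H) (k : R -> H -> R -> R -> H1 -> R) (h : H -> R).
Hypothesis lc : lipschitz_condition T U v0 a b k h.
Hypothesis sc : semiconcavity_condition T U k h.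
Hypothesis lcc : linear_convex_condition T U a b k h.

Lemma generator_convex r l x1 x2 y1 y2 z1 z2 v1 v2 : 0 <= l <= 1 -> 0 <= r <= T -> U v1 -> U v2 ->
  k r (l *: x1 + (1 - l) *: x2) (l * y1 + (1 - l) * y2) (l * z1 + (1 - l) * z2) (l *: v1 + (1 - l) *: v2) <=
  l * k r x1 y1 z1 v1 + (1 - l) * k r x2 y2 z2 v2.
Proof.
move=> l01 rT Uv1 Uv2.
exact: (convex_functionP (lcc_k lcc rT) (x := (((x1, y1), z1), v1)) (y := (((x2, y2), z2), v2)) l01).
Qed.

Let slope r x v (y z : R) := y * (k r x 1 0 v - k r x 0 0 v) + z * (k r x 0 1 v - k r x 0 0 v).

(* Semiconcavity with equal states is concavity in (y, z), so convexity makes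
   the generator affine in (y, z). *)
Let generator_affine r x v y z : 0 <= r <= T -> U v -> k r x y z v = k r x 0 0 v + slope r x v y z.
Proof.
move=> rT Uv; rewrite /slope addrA; apply: (@affine_plane R (fun y z => k r x y z v)).
move=> l p q p' q' l01; have [C1 _ cC] := sc_k sc.
have xE : l *: x + (1 - l) *: x = x by rewrite -scalerDl addrC subrK scale1r.
have vE : l *: v + (1 - l) *: v = v by rewrite -scalerDl addrC subrK scale1r.
apply/eqP; rewrite eq_le; apply/andP; split.
  have := generator_convex x x p p' q q' l01 rT Uv Uv.
  by rewrite xE vE.
have := cC l x x p p' q q' r v l01 rT Uv.
by rewrite subrr normr0 expr0n/= mulr0 xE subr_le0.
Qed.

(* Joint convexity between the far points (x1, N y, N z, v1) and
   (x2, - N y, - N z, v2) bounds N times the difference of the slopes. *)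
Let slope_le r x1 x2 v1 v2 y z : 0 <= r <= T -> U v1 -> U v2 ->
  slope r x2 v2 y z <= slope r x1 v1 y z.
Proof.
move=> rT Uv1 Uv2.
(* Only values at y = z = 0 enter [c]: the opposite far points cancel at the midpoint, so c does not
   depend on n. *)
pose c := k r x1 0 0 v1 + k r x2 0 0 v2 - 2 * k r (2^-1 *: x1 + (1 - 2^-1) *: x2) 0 0 (2^-1 *: v1 + (1 - 2^-1) *: v2).
have l01 : 0 <= (2^-1 : R) <= 1 by rewrite invr_ge0 ler0n invf_le1// ler1n.
apply: (@le_affine_bound _ _ _ c) => n.
have := generator_convex x1 x2 (n%:R * y) (- (n%:R * y)) (n%:R * z) (- (n%:R * z)) l01 rT Uv1 Uv2.
rewrite (generator_affine x1 _ _ rT Uv1) (generator_affine x2 _ _ rT Uv2).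
have -> : 2^-1 * (n%:R * y) + (1 - 2^-1) * (- (n%:R * y)) = 0 by field.
have -> : 2^-1 * (n%:R * z) + (1 - 2^-1) * (- (n%:R * z)) = 0 by field.
rewrite -[_ <= _ in X in X -> _](ler_pM2l (ltr0n R 2)) /c /slope.
set A := k r (_ + _) 0 0 _; set B := k r x1 0 0 v1; set B' := k r x2 0 0 v2.
move: n%:R => N.
set D1 := k r x1 1 0 v1 - B; set D2 := k r x1 0 1 v1 - B.
set E1 := k r x2 1 0 v2 - B'; set E2 := k r x2 0 1 v2 - B' => hh.
rewrite -subr_ge0; move: hh; rewrite -subr_ge0; by congr (0 <= _); field.
Qed.

(** The slopes are independent of state and control, hence they may be read off at the state 0 and
    the control [v0], where continuity in time and the Lipschitz bound L3 are inherited from [k]. *)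
Lemma generator_linear : exists al be : R -> R, exists L, [/\ continuous al, continuous be,
  (forall r, `|al r| <= L) /\ (forall r, `|be r| <= L) &
  forall r x v y z y' z', 0 <= r <= T -> U v ->
    k r x y z v - k r x y' z' v = al r * (y - y') + be r * (z - z')].
Proof.
(* Projecting time to [0, T] extends the slopes to bounded continuous functions on the line. *)
pose cl r := Num.max 0 (Num.min r T).
have clT r : 0 <= cl r <= T by rewrite /cl le_max lexx/= ge_max T0 ge_min lexx orbT.
have clE r : 0 <= r <= T -> cl r = r by move=> /andP[r0 rT]; rewrite /cl (min_idPl rT) (max_idPr r0).
have ccl : continuous cl.
  by move=> r; apply: (@continuous_max R _ (cst 0) (id \min cst T)); [exact: cst_continuous|apply: (@continuous_min R _ id (cst T)); [exact: id|exact: cst_continuous]].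
have ck y z : continuous (fun r => k (cl r) 0 y z v0).
  move=> r.
  have gc : {for r, continuous (fun r => (cl r, 0 : H, y, z, v0))}.
    have cp (K K' : topologicalType) (f : R -> K) (g : R -> K') : f @ r --> f r -> g @ r --> g r ->
        (fun r => (f r, g r)) @ r --> (f r, g r) by move=> cf cg; exact: (cvg_pair cf cg).
    by apply: (cp _ _ (fun r => (cl r, 0, y, z)) (fun=> v0)) (cvg_cst _);
      apply: (cp _ _ (fun r => (cl r, 0, y)) (fun=> z)) (cvg_cst _);
      apply: (cp _ _ (fun r => (cl r, 0)) (fun=> y)) (cvg_cst _);
      apply: (cp _ _ cl (fun=> 0)) (cvg_cst _); exact: ccl.
  have gD r' : [set p : R * H * R * R * H1 | 0 <= p.1.1.1.1 <= T /\ U p.2] (cl r', 0, y, z, v0) by split; [exact: clT|].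
  have /subspace_continuousP/(_ _ (gD r)) kc := lc_k_continuous lc.
  move=> W hW; have hg := gc _ (kc W hW).
  by apply: (@filterS _ (nbhs r) _ _ _ _ hg) => r' hr'; exact: hr' (gD r').
have [L3 [L4 [L5 [[L30 L40 L50] _ _ lcb]]]] := lc_bounds lc.
exists (fun r => k (cl r) 0 1 0 v0 - k (cl r) 0 0 0 v0).
exists (fun r => k (cl r) 0 0 1 v0 - k (cl r) 0 0 0 v0); exists L3; split.
- by move=> r; apply: continuousB; exact: ck.
- by move=> r; apply: continuousB; exact: ck.
- split => r; have [_ + _ _ _] := lcb _ _ (clT r) Uv0.
    by move=> /(_ 0 0 1 0 0 0); rewrite !(subr0, normr0, normr1, add0r, addr0, mulr1).
  by move=> /(_ 0 0 0 0 1 0); rewrite !(subr0, normr0, normr1, add0r, addr0, mulr1).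
move=> r x v y z y' z' rT Uv; rewrite clE// (generator_affine x y z rT Uv) (generator_affine x y' z' rT Uv).
have E y0 z0 : slope r x v y0 z0 = slope r 0 v0 y0 z0.
  by apply/eqP; rewrite eq_le !slope_le.
by rewrite !E /slope; ring.
Qed.

End generator.

Section backward_data.
Context (R : realType) (d : measure_display) (Om : measurableType d).
Context (P : probability Om R) (T : R) (w : R -> Om -> R).
Hypothesis w_bm : brownian_motion P T w.
Local Notation mu := (@lebesgue_measure R).
Local Notation M := (mu \x P)%E.
Local Notation F := (augmented_filtration P w).

(** The majorant of a path does not depend on time, so it is square integrable on the product over a
    bounded time interval. *)
Lemma square_integrable_sup_cut (K : normedModType R) (f : R -> Om -> K) t : t <= T ->
  progressive F t T f -> square_integrable_sup P t T f -> sqint M (cut t T (fun r om => `|f r om|)).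
Proof.
move=> tT pf [B [mB B2 fB]].
have mf := progressive_comp_cut w_bm tT pf (@norm_continuous _ _).
have sB : sqint P (fun om => `|B om|).
  by apply: (@sqint_le _ _ _ P _ B) => // [|om]; [exact: measurableT_comp|rewrite normr_id].
apply: (@sqint_ae_le _ _ _ M _ _ mf (sqint_cst t T sB)).
(* [ae_prod] concerns a vanishing function, so the inequality is encoded by the positive part of the
   excess. *)
have mg : measurable_fun setT (fun p => Num.max 0 (cut t T (fun r om => `|f r om|) p - cut t T (fun _ om => `|B om|) p)).
  by apply: measurable_maxr; [exact: measurable_cst|apply: measurable_funB => //; exact: (sqint_cst t T sB).1].
have ind0 (r : R) : 0 <= \1_`[t, T] r :> R by rewrite indicE.
have : {ae M, forall p, Num.max 0 (cut t T (fun r om => `|f r om|) p - cut t T (fun _ om => `|B om|) p) = 0}.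
  apply: ae_prod; first exact: mg.
  apply: ae_mono fB => om fB; apply: aeW => r.
  apply/max_idPl; rewrite subr_le0 /cut/= indicE mem_setE in_itv/=.
  have [rT|_] := boolP (t <= r <= T); last by rewrite !mul0r.
  by rewrite !mul1r (le_trans (fB r rT))// ler_norm.
apply: ae_mono => p /max_idPl; rewrite subr_le0 => h.
by rewrite !ger0_norm// mulr_ge0.
Qed.

Context (H H1 : hilbertType R) (sH : separable H) (sH1 : separable H1).
Context (U : set H1) (v0 : H1).
Context (a b : R -> H -> H1 -> H) (k : R -> H -> R -> R -> H1 -> R) (h : H -> R).
Hypothesis lc : lipschitz_condition T U v0 a b k h.

Definition generator (u : R -> Om -> H1) X Y Z r om : R :=
  k r (X r om) (Y r om) (Z r om) (u r om).

Record backward_data t (u : R -> Om -> H1) (X : R -> Om -> H) (Y Z : R -> Om -> R) : Prop := {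
  bd_sY : sqint M (cut t T Y);
  bd_sYr : forall r, t <= r <= T -> sqint P (Y r);
  bd_FY : Fm P w t (Y t);
  bd_sZ : sqint M (cut t T Z);
  bd_sh : sqint P (fun om => h (X T om));
  bd_sk : sqint M (cut t T (generator u X Y Z));
  bd_eq : forall s, t <= s <= T -> exists2 J, ito P w s T Z J &
    {ae P, forall om, Y s om = h (X T om) + tint s T (generator u X Y Z) om - J om} }.

Lemma backward_equation_data t u X Y Z : 0 <= t <= T ->
  (forall s om, t <= s <= T -> U (u s om)) -> progressive F t T u ->
  progressive F t T X -> square_integrable_sup P t T X ->
  backward_equation P T w k h t u X Y Z -> backward_data t u X Y Z.
Proof.
move=> /andP[t0 tT] Uu pu pX supX [[pY pZ] _ supY iZ eqY].
have [L3 [L4 [L5 [[L30 L40 L50] hL _ lcb]]]] := lc_bounds lc.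
have in0T r : t <= r <= T -> 0 <= r <= T by move=> /andP[tr ->]; rewrite (le_trans t0 tr).
have cid : continuous (id : R -> R) by move=> x; exact: cvg_id.
have snX := square_integrable_sup_cut tT pX supX.
have snY := square_integrable_sup_cut (K := R^o) tT pY supY.
have snZ := square_integrable_sqint (K := R^o) w_bm tT pZ iZ.
have mY := progressive_comp_cut w_bm tT pY cid.
have mZ := progressive_comp_cut w_bm tT pZ cid.
have cutE (f : R -> Om -> R) p : `|cut t T f p| <= `|cut t T (fun r om => `|f r om|) p|.
  by rewrite /cut !normrM normr_id.
have mD : measurable (`[t, T]%classic `*` [set: Om]) by exact: measurableX.
split.
- exact: (@sqint_le _ _ _ M _ _ mY (cutE Y) snY).
- move=> r rT; apply: (square_integrable_sup_sqint (K := R^o) w_bm (C := 1) pY supY cid _ rT).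
  by move=> x; rewrite mul1r.
- by apply: (progressive_comp_Fm pY cid); rewrite lexx tT.
- exact: (@sqint_le _ _ _ M _ _ mZ (cutE Z) snZ).
(* After subtracting [h 0] the terminal cost is bounded by L3 |x|, as the square integrability lemma
   asks; the constant is added back. *)
- have ch : continuous (fun x => h x - h 0).
    by move=> x; apply: continuousB; [exact: (lc_h_continuous lc)|exact: cst_continuous].
  have hL' x : `|h x - h 0| <= L3 * `|x| by rewrite -[x in _ * `|x|]subr0.
  have TT : t <= T <= T by rewrite tT lexx.
  have := sqintD (square_integrable_sup_sqint w_bm pX supX ch hL' TT) (sqintZ (h 0) (sqint1 P)).
  by congr sqint; apply/funext => om; rewrite mulr1 subrK.
- have mk : measurable_fun setT (cut t T (generator u X Y Z)).
    apply: measurable_cut; apply/(measurable_wrtP mD).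
    have dR := has_dense_seq_R R; have dH := has_dense_seq_separable sH.
    have dH1 := has_dense_seq_separable sH1.
    have m5 : measurable_wrt measurable (`[t, T]%classic `*` [set: Om])
        (fun p : R * Om => ((((p.1, X p.1 p.2), Y p.1 p.2), Z p.1 p.2), u p.1 p.2)).
      apply: measurable_wrt_pair => //.
      - by do 3 (apply: has_dense_seq_prod => //).
      - apply: measurable_wrt_pair => //.
        + by do 2 (apply: has_dense_seq_prod => //).
        + apply: measurable_wrt_pair => //.
          * by apply: has_dense_seq_prod.
          * apply: measurable_wrt_pair => //.
              by apply/(measurable_wrtP mD); exact: measurable_funS measurable_fst.
            exact: (progressive_measurable_wrt w_bm tT (lexx T) pX).
          * exact: (progressive_measurable_wrt w_bm tT (lexx T) pY).
        + exact: (progressive_measurable_wrt w_bm tT (lexx T) pZ).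
      - exact: (progressive_measurable_wrt w_bm tT (lexx T) pu).
    apply: (measurable_wrt_comp mD m5 _ (lc_k_continuous lc)).
    move=> p [/= + _]; rewrite in_itv/= => tp; split; [exact: in0T|exact: Uu].
  have s1 := sqint_cst t T (sqint1 P).
  apply: (@sqint_le _ _ _ M _ _ mk _ (sqintD (sqintD (sqintD (sqintZ L3 snX) (sqintZ L3 snY)) (sqintZ L3 snZ)) (sqintZ L5 s1))) => p.
  rewrite /cut indicE mem_setE in_itv/=.
  have [rT|_] := boolP (t <= p.1 <= T); last by rewrite !mul0r !mulr0 !addr0.
  have L30' := ltW L30; have L50' := ltW L50.
  rewrite !mul1r mulr1 [X in _ <= X]ger0_norm ?addr_ge0 ?mulr_ge0//.
  have [_ kL _ _ [_ _ k0]] := lcb _ _ (in0T _ rT) (Uu p.1 p.2 rT).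
  have := kL (X p.1 p.2) 0 (Y p.1 p.2) 0 (Z p.1 p.2) 0; rewrite !subr0 !mulrDr => kb.
  rewrite /generator -[k _ _ _ _ _](subrK (k p.1 0 0 0 (u p.1 p.2))) (le_trans (ler_normD _ _))// lerD//.
- move=> s sT; have [J iJ eqJ] := eqY s sT; exists J => //.
  case/andP: sT => ts sT; exact: (ito_integral_ito w_bm (le_trans t0 ts) sT (lexx T) iJ).
Qed.

End backward_data.

Section backward_convex.
Context (R : realType) (d : measure_display) (Om : measurableType d).
Context (P : probability Om R) (T : R) (w : R -> Om -> R).
Hypothesis w_bm : brownian_motion P T w.
Local Notation mu := (@lebesgue_measure R).
Local Notation M := (mu \x P)%E.
Context (H H1 : hilbertType R).
Context (U : set H1) (v0 : H1) (Uv0 : U v0).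
Context (a b : R -> H -> H1 -> H) (k : R -> H -> R -> R -> H1 -> R) (h : H -> R).
Hypothesis lc : lipschitz_condition T U v0 a b k h.
Hypothesis sc : semiconcavity_condition T U k h.
Hypothesis lcc : linear_convex_condition T U a b k h.
Variables (t l : R) (t0 : 0 <= t) (tT : t <= T) (l01 : 0 <= l <= 1).
Variables (u1 u2 u3 : R -> Om -> H1) (X1 X2 X3 : R -> Om -> H)
  (Y1 Y2 Y3 Z1 Z2 Z3 : R -> Om -> R).
Hypothesis u3E : forall r om, t <= r <= T -> u3 r om = l *: u1 r om + (1 - l) *: u2 r om.
Hypothesis Uu1 : forall r om, t <= r <= T -> U (u1 r om).
Hypothesis Uu2 : forall r om, t <= r <= T -> U (u2 r om).
Hypothesis Uu3 : forall r om, t <= r <= T -> U (u3 r om).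
Hypothesis X3T : {ae P, forall om, X3 T om = l *: X1 T om + (1 - l) *: X2 T om}.
Hypothesis X3E : {ae M, forall p, t <= p.1 <= T ->
    X3 p.1 p.2 = l *: X1 p.1 p.2 + (1 - l) *: X2 p.1 p.2}.
Local Notation backward_data := (backward_data P T w k h).
Local Notation generator := (generator k).
Hypothesis S1 : backward_data t u1 X1 Y1 Z1.
Hypothesis S2 : backward_data t u2 X2 Y2 Z2.
Hypothesis S3 : backward_data t u3 X3 Y3 Z3.

Let rcomb (y3 y1 y2 : R) := y3 + (- l) * y1 + (- (1 - l)) * y2.
Let pcomb (y3 y1 y2 : R -> Om -> R) r om := rcomb (y3 r om) (y1 r om) (y2 r om).

Let sqint_pcomb y3 y1 y2 : sqint M (cut t T y3) -> sqint M (cut t T y1) -> sqint M (cut t T y2) ->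
  sqint M (cut t T (pcomb y3 y1 y2)).
Proof.
move=> s3 s1 s2; have := sqintD (sqintD s3 (sqintZ (- l) s1)) (sqintZ (- (1 - l)) s2).
by congr sqint; apply/funext => p; rewrite /cut /pcomb /rcomb; ring.
Qed.

Let sqint_rcomb (y3 y1 y2 : Om -> R) : sqint P y3 -> sqint P y1 -> sqint P y2 ->
  sqint P (fun om => rcomb (y3 om) (y1 om) (y2 om)).
Proof. by move=> s3 s1 s2; exact: (sqintD (sqintD s3 (sqintZ (- l) s1)) (sqintZ (- (1 - l)) s2)). Qed.

Theorem backward_convex : {ae P, forall om, Y3 t om <= l * Y1 t om + (1 - l) * Y2 t om}.
Proof.
have T0 := le_trans t0 tT.
have [al [be [L [cal cbe [alL beL] kE]]]] := generator_linear T0 Uv0 lc sc lcc.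
pose k1 := generator u1 X1 Y1 Z1; pose k2 := generator u2 X2 Y2 Z2; pose k3 := generator u3 X3 Y3 Z3.
have := @linear_comparison _ _ _ P T w w_bm t L t0 tT al be (pcomb Y3 Y1 Y2) (pcomb Z3 Z1 Z2) (pcomb k3 k1 k2)
  (fun om => rcomb (h (X3 T om)) (h (X1 T om)) (h (X2 T om))) cal cbe alL beL.
have yle om : pcomb Y3 Y1 Y2 t om <= 0 -> Y3 t om <= l * Y1 t om + (1 - l) * Y2 t om.
  by rewrite /pcomb /rcomb !mulNr -addrA -opprD subr_le0.
move=> hc; apply: ae_mono (hc _ _ _ _ _ _ _ _ _) => {hc}; first by move=> om; exact: yle.
- exact: sqint_pcomb (bd_sY S3) (bd_sY S1) (bd_sY S2).
- exact: sqint_pcomb (bd_sZ S3) (bd_sZ S1) (bd_sZ S2).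
- exact: sqint_pcomb (bd_sk S3) (bd_sk S1) (bd_sk S2).
- move=> r rT; exact: sqint_rcomb (bd_sYr S3 rT) (bd_sYr S1 rT) (bd_sYr S2 rT).
- exact: (measurable_funD (measurable_funD (bd_FY S3) (measurable_funM (measurable_cst (- l)) (bd_FY S1)))
    (measurable_funM (measurable_cst (- (1 - l))) (bd_FY S2))).
- exact: sqint_rcomb (bd_sh S3) (bd_sh S1) (bd_sh S2).
- apply: ae_mono X3T => om ->; rewrite /rcomb !mulNr -addrA -opprD subr_le0.
  exact: (convex_functionP (lcc_h lcc) l01).
- apply: ae_mono X3E => p Xp pT; have pT0 : 0 <= p.1 <= T by case/andP: pT => tp ->; rewrite (le_trans t0 tp).
  (* Joint convexity is used at the combined (y, z), where the state is [X3] and the control [u3];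
     [kE] then moves (y, z) to (Y3, Z3) at the cost of the linear terms. *)
  have c1 := generator_convex lcc (X1 p.1 p.2) (X2 p.1 p.2) (Y1 p.1 p.2) (Y2 p.1 p.2) (Z1 p.1 p.2) (Z2 p.1 p.2)
    l01 pT0 (Uu1 p.2 pT) (Uu2 p.2 pT).
  rewrite -(Xp pT) -u3E// in c1.
  have := kE p.1 (X3 p.1 p.2) (u3 p.1 p.2) (Y3 p.1 p.2) (Z3 p.1 p.2) (l * Y1 p.1 p.2 + (1 - l) * Y2 p.1 p.2)
    (l * Z1 p.1 p.2 + (1 - l) * Z2 p.1 p.2) pT0 (Uu3 p.2 pT).
  rewrite /pcomb /rcomb /k1 /k2 /k3 /generator => c2.
  rewrite (_ : al _ * _ + _ = al p.1 * (Y3 p.1 p.2 - (l * Y1 p.1 p.2 + (1 - l) * Y2 p.1 p.2)) +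
      be p.1 * (Z3 p.1 p.2 - (l * Z1 p.1 p.2 + (1 - l) * Z2 p.1 p.2))); last by ring.
  by rewrite -c2; move: c1; lra.
- move=> s sT; have [J1 i1 e1] := bd_eq S1 sT; have [J2 i2 e2] := bd_eq S2 sT.
  have [J3 i3 e3] := bd_eq S3 sT; have [ts sT'] := andP sT.
  exists (fun om => rcomb (J3 om) (J1 om) (J2 om)).
    by apply: (ito_lin w_bm _ (le_trans t0 ts) (lexx T)); first exact: (ito_lin w_bm _ (le_trans t0 ts) (lexx T)).
  have q1 := integrable_slice_cut (sqint_cut_left ts (bd_sk S1)).
  have q2 := integrable_slice_cut (sqint_cut_left ts (bd_sk S2)).
  have q3 := integrable_slice_cut (sqint_cut_left ts (bd_sk S3)).
  apply: ae_mono (ae_and (ae_and e1 (ae_and e2 e3)) (ae_and q1 (ae_and q2 q3))).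
  move=> om [[{}e1 [{}e2 {}e3]] [{}q1 [{}q2 {}q3]]].
  rewrite /pcomb e1 e2 e3 /rcomb (tint_lin (f := fun r om => k3 r om + - l * k1 r om))//.
    by rewrite tint_lin//; rewrite -/k1 -/k2 -/k3; ring.
  have := integrableD measurableT q3 (integrableZl measurableT (- l) q1).
  by apply: eq_integrable => // r _ /=; rewrite cut_lin.
Qed.

End backward_convex.

(** * Convexity of the value function *)

Section admissible_convex.
Context (R : realType) (d : measure_display) (Om : measurableType d).
Context (P : probability Om R) (T : R) (w : R -> Om -> R).
Hypothesis w_bm : brownian_motion P T w.
Local Notation mu := (@lebesgue_measure R).
Local Notation M := (mu \x P)%E.
Local Notation F := (augmented_filtration P w).
Context (H1 : hilbertType R) (sH1 : separable H1).

Lemma progressive_lin t l m (u1 u2 : R -> Om -> H1) :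
  progressive F t T u1 -> progressive F t T u2 ->
  progressive F t T (fun r om => l *: u1 r om + m *: u2 r om).
Proof.
move=> p1 p2 s sT.
(* The sigma-algebra generated by these rectangles is used as a measurable structure, so that
   pairing and composition with a continuous map apply. *)
pose G := [set I `*` E | I in (measurable : set (set R)) & E in F s].
have mD : measurable (`[t, s]%classic `*` setT : set (g_sigma_algebraType G)).
  apply: sub_sigma_algebra; exists `[t, s]%classic => //; exists setT => //.
  exact: (@measurableT _ (filtType P w s)).
have d1 := has_dense_seq_separable sH1.
have m2 : @measurable_wrt (g_sigma_algebraType G) _ measurable (`[t, s]%classic `*` setT)
    (fun p : R * Om => (u1 p.1 p.2, u2 p.1 p.2)).
  by apply: (measurable_wrt_pair mD d1 d1); [exact: p1|exact: p2].
apply: (@measurable_wrt_comp _ (g_sigma_algebraType G) _ mD _ _ setT _ (fun q : H1 * H1 => l *: q.1 + m *: q.2) m2) => //.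
apply: continuous_subspaceT => q; apply: (@cvgD _ H1).
  by apply: (@cvgZl_tmp _ H1); exact: cvg_fst.
by apply: (@cvgZl_tmp _ H1); exact: cvg_snd.
Qed.

Context (U : set H1) (v0 : H1) (U_convex : convex_set U).

(** The exponent is halved so that the square is the moment of order [al], which brings the closure
    properties of [sqint] to bear. *)
Let moment t u al := sqint M (cut t T (fun r om => `|u r om - v0| `^ (al / 2))).

Let momentP t u al : t <= T -> progressive F t T u ->
  measurable_fun setT (cut t T (fun r om => `|u r om - v0| `^ (al / 2))) /\
  (\int[M]_p ((cut t T (fun r om => `|u r om - v0| `^ (al / 2)) p) ^+ 2)%:E =
   \int[P]_om \int[mu]_(s in `[t, T]) (`|u s om - v0| `^ al)%:E)%E.
Proof.
move=> tT pu.
have cn : continuous (fun x : H1 => `|x - v0|).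
  move=> x; apply: (@continuous_comp _ _ _ (fun x => x - v0)); last exact: norm_continuous.
  by apply: continuousB; [exact: id|exact: cst_continuous].
have m1 := progressive_comp_cut w_bm tT pu cn.
have mh : measurable_fun setT (cut t T (fun r om => `|u r om - v0| `^ (al / 2))).
  have m2 := measurableT_comp (measurable_powR (al / 2)) m1.
  have mind : measurable_fun setT (fun p : R * Om => \1_`[t, T] p.1 : R).
    by apply: (measurableT_comp (f := \1_`[t, T] : R -> R)) => //; exact: measurable_indic.
  have := measurable_funM mind m2; apply: eq_measurable_fun => p _.
  rewrite /cut/= indicE; case: (_ \in _); by rewrite ?mul1r ?mul0r.
split => //; rewrite (integral_M_cut P mh).
apply: eq_integral => om _; apply: eq_integral => r _; congr EFin.
by rewrite -powR_mulrn ?powR_ge0// -powRrM divfK.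
Qed.

Lemma admissible_convex t l u1 u2 : 0 <= t <= T -> 0 <= l <= 1 ->
  admissible P T w U v0 t u1 -> admissible P T w U v0 t u2 ->
  admissible P T w U v0 t (fun r om => l *: u1 r om + (1 - l) *: u2 r om).
Proof.
move=> /andP[t0 tT] /andP[l0 l1] [U1 p1 m1] [U2 p2 m2].
have p3 := progressive_lin l (1 - l) p1 p2.
split; [move=> s om sT|exact: p3|move=> al al1].
  have := U_convex (Itv01 l0 l1) (mem_set (U1 s om sT)) (mem_set (U2 s om sT)).
  by rewrite inE.
have [mh1 E1] := momentP al tT p1; have [mh2 E2] := momentP al tT p2; have [mh3 E3] := momentP al tT p3.
have s1 : moment t u1 al by split => //; rewrite E1 m1.
have s2 : moment t u2 al by split => //; rewrite E2 m2.
rewrite -E3; suff [] : moment t (fun r om => l *: u1 r om + (1 - l) *: u2 r om) al by [].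
apply: (@sqint_le _ _ _ M _ _ mh3 _ (sqintD s1 s2)) => p.
rewrite /cut -mulrDr !normrM ler_wpM2l// !ger0_norm ?addr_ge0 ?powR_ge0//.
set a := u1 _ _; set b := u2 _ _.
(* The distance to [v0] is convex, hence at most the larger of the two distances; its power is then
   at most the sum of the two powers. *)
have le1 : `|l *: a + (1 - l) *: b - v0| <= Num.max `|a - v0| `|b - v0|.
  have -> : l *: a + (1 - l) *: b - v0 = l *: (a - v0) + (1 - l) *: (b - v0).
    by rewrite !scalerBr addrACA -opprD -scalerDl [l + _]addrC subrK scale1r.
  rewrite (le_trans (ler_normD _ _))// !normrZ (ger0_norm l0) (ger0_norm (x := 1 - l)) ?subr_ge0//.
  set A := `|a - v0|; set B := `|b - v0|; set m := Num.max A B.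
  have Am : A <= m by rewrite le_max lexx.
  have Bm : B <= m by rewrite le_max lexx orbT.
  apply: (@le_trans _ _ (l * m + (1 - l) * m)); last by rewrite -mulrDl addrC subrK mul1r.
  by rewrite lerD// ler_wpM2l// subr_ge0.
have al2 : 0 <= al / 2 by rewrite divr_ge0// (le_trans _ al1).
apply: le_trans (ge0_ler_powR al2 _ _ le1) _; rewrite ?nnegrE// ?le_max ?normr_ge0//.
by case: (leP `|a - v0| `|b - v0|) => _; rewrite ?lerDl ?lerDr powR_ge0.
Qed.

End admissible_convex.

Lemma ae_const (d : measure_display) (Om : measurableType d) (R : realType) (P : probability Om R) (A : Prop) :
  {ae P, forall om : Om, A} -> A.
Proof.
move=> [N [mN N0 sN]]; apply: contrapT => nA.
have NT : N = setT by apply/seteqP; split => // om _; apply: sN.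
by move: N0; rewrite NT probability_setT => /eqP; rewrite onee_eq0.
Qed.

Theorem theorem4p5 (R : realType) (d : measure_display)
  (Om : measurableType d) (P : probability Om R)
  (T : R) (T_gt0 : 0 < T)
  (w : R -> Om -> R) (w_bm : brownian_motion P T w)
  (V H Vs H1 : hilbertType R) (H1_separable : separable H1)
  (j : {linear V -> H}) (pair : Vs -> {linear V -> R^o})
  (triple : gelfand_triple j pair)
  (A : R -> {linear V -> Vs}) (B : R -> {linear V -> H})
  (U : set H1) (v0 : H1) (U_v0 : U v0) (U_convex : convex_set U)
  (a b : R -> H -> H1 -> H) (k : R -> H -> R -> R -> H1 -> R) (h : H -> R)
  (operator_cond : operator_condition T j pair A B)
  (lipschitz_cond : lipschitz_condition T U v0 a b k h)
  (derivative_cond : derivative_lipschitz_condition T U a b)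
  (semiconcavity_cond : semiconcavity_condition T U k h)
  (linear_convex_cond : linear_convex_condition T U a b k h)
  (X : R -> H -> (R -> Om -> H1) -> R -> Om -> H)
  (Y Z : R -> H -> (R -> Om -> H1) -> R -> Om -> R)
  (X_solves : forall t x u, 0 <= t <= T -> admissible P T w U v0 t u ->
     state_equation P T w j pair A B a b t x u (X t x u))
  (YZ_solves : forall t x u, 0 <= t <= T -> admissible P T w U v0 t u ->
     backward_equation P T w k h t u (X t x u) (Y t x u) (Z t x u))
  (val : R -> H -> R) (val_def : value_function P T w U v0 Y val) :
  forall t, 0 <= t <= T -> @convex_function R H setT (val t).
Proof.
move=> t tT.
suff main l (x1 x2 : H) : 0 <= l <= 1 ->
    val t (l *: x1 + (1 - l) *: x2) <= l * val t x1 + (1 - l) * val t x2.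
  by move=> l x1 x2 _ _; apply: main; apply/andP; split.
move=> l01.
have [t0 tT'] := andP tT.
have sH := gelfand_separableH triple.
have [x3 x3E] : exists x3, x3 = l *: x1 + (1 - l) *: x2 by eexists.
have data x u : admissible P T w U v0 t u ->
    (exists XV, state_data P T w j pair A B a b t x u (X t x u) XV) /\
    backward_data P T w k h t u (X t x u) (Y t x u) (Z t x u).
  move=> au; have [Uu pu _] := au; have se := X_solves t x u tT au; have [pX _ sX _] := se.
  split; first exact: (state_equation_data w_bm H1_separable triple operator_cond lipschitz_cond tT Uu pu se).
  exact: (backward_equation_data w_bm sH H1_separable lipschitz_cond tT Uu pu pX sX (YZ_solves t x u tT au)).
have key u1 u2 : admissible P T w U v0 t u1 -> admissible P T w U v0 t u2 ->
    {ae P, forall om, val t x3 <= l * Y t x1 u1 t om + (1 - l) * Y t x2 u2 t om}.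
  move=> a1 a2; have a3 := admissible_convex w_bm H1_separable U_convex tT l01 a1 a2.
  have [[V1 s1] b1] := data x1 _ a1; have [[V2 s2] b2] := data x2 _ a2; have [[V3 s3] b3] := data x3 _ a3.
  have [U1 _ _] := a1; have [U2 _ _] := a2; have [U3 _ _] := a3.
  have [XT XM] := state_affine w_bm H1_separable triple U_v0 operator_cond lipschitz_cond
    (lcc_a linear_convex_cond) (lcc_b linear_convex_cond) t0 tT' x3E (fun r om _ => erefl) U1 U2 U3 s1 s2 s3.
  have TT : t <= T <= T by rewrite tT' lexx.
  have bc := backward_convex w_bm U_v0 lipschitz_cond semiconcavity_cond linear_convex_cond t0 tT' l01
    (fun r om _ => erefl) U1 U2 U3 (XT T TT) XM b1 b2 b3.
  have [_ vle _] := val_def t x3 tT.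
  have v3 := vle _ (ex_intro2 _ _ _ a3 erefl).
  by apply: ae_mono (ae_and v3 bc) => om [/= h1 h2]; exact: le_trans h1 h2.
have tt : t <= t <= T by rewrite lexx tT'.
have mY x u : admissible P T w U v0 t u -> measurable_fun setT (Y t x u t).
  by move=> au; have [_ bd] := data x u au; exact: (bd_sYr bd tt).1.
have [l0' l1'] := andP l01.
rewrite -x3E.
(* The endpoints are treated apart because the inequality is divided by l and by 1 - l below. *)
have [lz|lnz] := eqVneq l 0; first by rewrite x3E lz subr0 scale0r add0r scale1r mul0r add0r mul1r.
have [lo|lno] := eqVneq l 1; first by rewrite x3E lo subrr scale0r addr0 scale1r mul0r addr0 mul1r.
have lp : 0 < l by rewrite lt_neqAle eq_sym lnz l0'.
have lq : 0 < 1 - l by rewrite subr_gt0 lt_neqAle lno l1'.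
(* For fixed [u2], solving [key] for the cost of [u1] exhibits a measurable lower bound of all these
   costs, hence of their essential infimum. *)
have step1 u2 : admissible P T w U v0 t u2 ->
    {ae P, forall om, val t x3 <= l * val t x1 + (1 - l) * Y t x2 u2 t om}.
  move=> a2; have [_ _ inf1] := val_def t x1 tT.
  have := inf1 (fun om => l^-1 * (val t x3 - (1 - l) * Y t x2 u2 t om)).
  have mg : measurable_fun setT (fun om => l^-1 * (val t x3 - (1 - l) * Y t x2 u2 t om)).
    apply: measurable_funM => //; apply: measurable_funB => //; apply: measurable_funM => //; exact: mY.
  move=> /(_ mg) H0.
  have : {ae P, forall om, l^-1 * (val t x3 - (1 - l) * Y t x2 u2 t om) <= cst (val t x1) om}.
    apply: H0 => f [u1 a1 <-]; apply: ae_mono (key _ _ a1 a2) => om hk.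
    by rewrite ler_pdivrMl// lerBlDr.
  by apply: ae_mono => om; rewrite ler_pdivrMl// lerBlDr.
have [_ _ inf2] := val_def t x2 tT.
(* The value function is deterministic, so the claim may be proved almost surely, where the second
   essential infimum acts. *)
apply: (@ae_const _ _ _ P).
have := inf2 (fun=> (1 - l)^-1 * (val t x3 - l * val t x1)) (measurable_cst _).
move=> H0.
have : {ae P, forall om, (1 - l)^-1 * (val t x3 - l * val t x1) <= cst (val t x2) om}.
  apply: H0 => f [u2 a2 <-]; apply: ae_mono (step1 _ a2) => om hk.
  by rewrite ler_pdivrMl// lerBlDl.
by apply: ae_mono => om; rewrite ler_pdivrMl// lerBlDl.
Qed.
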